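(* Suppose that $v$ satisfies Assumptions A, B and C (stated in the context) on the compact rectangle $T$. Then $$\lim_{r\to0+}\ \sup_{x,y\in T:\,0<\Delta(x,y)\le r}\frac{|v(x)-v(y)|}{\Delta(x,y)\sqrt{\log(\Delta(x,y)^{-1})}}=\kappa\quad\text{a.s.}$$ and $$\lim_{r\to0+}\ \sup_{x,y\in T:\,0<d(x,y)\le r}\frac{|v(x)-v(y)|}{d(x,y)\sqrt{\log(d(x,y)^{-1})}}=\kappa'\quad\text{a.s.}$$ for some positive finite constants $\kappa$ and $\kappa'$ satisfying $$\sqrt{2Qc_2}\le\kappa\le\sqrt{2Q}\,c_1\quad\text{and}\quad\sqrt{2Qc_2}\,c_1^{-1}\le\kappa'\le\sqrt{2Q},$$ where $c_2$ is the constant in Assumption B and $c_1$ is a constant such that, for some $\varepsilon_1>0$, $\|v(x)-v(y)\|_{L^2}\le c_1\Delta(x,y)$ for all $x,y\in T$ with $\Delta(x,y)\le\varepsilon_1$ (such $c_1,\varepsilon_1$ exist under Assumption A).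
   Context: Let $k\ge1$, let $v=\{v(x):x\in\mathbb R^k\}$ be a real-valued continuous centered Gaussian random field, and let $T\subset\mathbb R^k$ be a compact rectangle (a product of compact intervals of positive length). Write $\|X\|_{L^2}=(\mathbb E[X^2])^{1/2}$. Assumption A. There exists a centered Gaussian random field $\{v(A,x):A\in\mathscr B(\mathbb R_+),x\in T\}$, where $\mathscr B(\mathbb R_+)$ is the Borel $\sigma$-algebra of $\mathbb R_+=[0,\infty)$, such that: (a) for every $x\in T$, $A\mapsto v(A,x)$ is an independently scattered Gaussian noise (values on disjoint sets are independent, and $v(\bigcup_nA_n,x)=\sum_nv(A_n,x)$ in $L^2$ for disjoint $A_n$) with $v(\mathbb R_+,x)=v(x)$, and the processes $v(A,\cdot)$ and $v(B,\cdot)$ are independent whenever $A$ and $B$ are disjoint; (b) there exist constants $c_0>0$, $a_0\ge0$ and $\gamma_j>0$, $j=1,\dots,k$, such that for all $a_0\le a<b\le\infty$ and $x,y\in T$ (with $b^{-1}=0$ if $b=\infty$), $$\|v([a,b),x)-v(x)-v([a,b),y)+v(y)\|_{L^2}\le c_0\Big(\sum_{j=1}^ka^{\gamma_j}|x_j-y_j|+b^{-1}\Big)$$ and $$\|v([0,a_0),x)-v([0,a_0),y)\|_{L^2}\le c_0\sum_{j=1}^k|x_j-y_j|.$$ Notation: $\alpha_j=(\gamma_j+1)^{-1}\in(0,1)$, $Q=\sum_{j=1}^k\alpha_j^{-1}$, $\Delta(x,y)=\sum_{j=1}^k|x_j-y_j|^{\alpha_j}$ and $d(x,y)=\|v(x)-v(y)\|_{L^2}$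 for $x,y\in\mathbb R^k$. Assumption B (strong local nondeterminism). There exists a constant $c_2>0$ such that for all integers $n\ge1$ and all $x,x^1,\dots,x^n\in T$, $\mathrm{Var}(v(x)\mid v(x^1),\dots,v(x^n))\ge c_2\min_{0\le i\le n}\Delta^2(x,x^i)$, where $x^0=0$. Assumption C. There exists a constant $c_3>0$ such that $\|v(x)-v(y)\|_{L^2}\ge c_3\Delta(x,y)$ for all $x,y\in T$. *)

(* Defs.v *)
From HB Require Import structures.
From mathcomp Require Import all_boot all_order all_algebra.
From mathcomp Require Import all_classical all_reals all_analysis.

Set Implicit Arguments.
Unset Strict Implicit.
Unset Printing Implicit Defensive.

Import Order.TTheory GRing.Theory Num.Theory.
Import numFieldNormedType.Exports.

Local Open Scope classical_set_scope.
Local Open Scope ring_scope.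

Section probability_notions.
Context {d : measure_display} {Omega : measurableType d} {R : realType}.
Variable P : probability Omega R.

(* [fine] is harmless here: it is only applied to Gaussian random variables,
   for which the second moment is finite. *)
Definition L2norm (X : Omega -> R) : R :=
  Num.sqrt (fine 'E_P[fun w => X w ^+ 2]).

(* Centered Gaussian law, including the degenerate law [dirac 0], which has to
   be listed apart because the library's [normal_prob m 0] is not a Dirac
   mass. *)
Definition centered_gaussian (X : Omega -> R) : Prop :=
  (forall B : set R, measurable B -> P (X @^-1` B) = \d_(0 : R) B) \/
  (exists2 s : R, 0 < s &
    forall B : set R, measurable B -> P (X @^-1` B) = normal_prob 0 s B).

Definition centered_gaussian_field (I : Type) (J : set I)
    (X : I -> {RV P >-> R}) : Prop :=
  forall (n : nat) (t : 'I_n -> I) (a : 'I_n -> R), (forall i, J (t i)) ->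
    centered_gaussian (fun w => \sum_(i < n) a i * X (t i) w).

Definition sigma_gen (I : Type) (J : set I) (X : I -> Omega -> R) :
    set (set Omega) :=
  <<s \bigcup_(i in J) preimage_set_system setT (X i) measurable >>.

Definition independent_sets (F G : set (set Omega)) : Prop :=
  forall A B, F A -> G B -> P (A `&` B) = (P A * P B)%E.

(* Taking some [B i] equal to [setT] gives the product rule for subfamilies. *)
Definition mutually_independent (n : nat) (X : 'I_n -> Omega -> R) : Prop :=
  forall B : 'I_n -> set R, (forall i, measurable (B i)) ->
    P (\bigcap_i (X i @^-1` B i)) = (\prod_(i < n) P (X i @^-1` B i))%E.

(* [Z] is a version of E[X | G], where [G] is a sub-sigma-algebra. *)
Definition is_cond_expectation (G : set (set Omega)) (X Z : Omega -> R) :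
    Prop :=
  [/\ forall B : set R, measurable B -> G (Z @^-1` B),
      P.-integrable setT (EFin \o Z) &
      forall A, G A ->
        (\int[P]_(w in A) (Z w)%:E = \int[P]_(w in A) (X w)%:E)%E].

(* [V] is a version of Var(X | G) = E[(X - E[X | G])^2 | G]. *)
Definition is_cond_variance (G : set (set Omega)) (X V : Omega -> R) : Prop :=
  exists2 Z, is_cond_expectation G X Z &
    is_cond_expectation G (fun w => (X w - Z w) ^+ 2) V.

End probability_notions.

Section random_fields.
Context {d : measure_display} {Omega : measurableType d} {R : realType}.
Variables (P : probability Omega R) (k : nat).

Definition rectangle (l u : 'rV[R]_k) : set 'rV[R]_k :=
  [set x | forall j, l 0 j <= x 0 j <= u 0 j].

Definition alpha (gamma : 'I_k -> R) (j : 'I_k) : R := (gamma j + 1)^-1.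

Definition Qdim (gamma : 'I_k -> R) : R := \sum_(j < k) (alpha gamma j)^-1.

Definition Delta (gamma : 'I_k -> R) (x y : 'rV[R]_k) : R :=
  \sum_(j < k) `|x 0 j - y 0 j| `^ alpha gamma j.

Definition canonical_dist (v : 'rV[R]_k -> {RV P >-> R}) (x y : 'rV[R]_k) : R :=
  L2norm P (fun w => v x w - v y w).

Definition borel_Rplus (A : set R) : Prop :=
  measurable A /\ A `<=` [set t | 0 <= t].

(* The half-open interval [a, b) with b <= +oo. *)
Definition Ico (a : R) (b : \bar R) : set R :=
  [set t | a <= t /\ (t%:E < b)%E].

Definition assumptionA (v : 'rV[R]_k -> {RV P >-> R}) (T : set 'rV[R]_k)
    (gamma : 'I_k -> R) : Prop :=
  exists u : set R -> 'rV[R]_k -> {RV P >-> R},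
  [/\ centered_gaussian_field [set p | borel_Rplus p.1 /\ T p.2]
        (fun p : set R * 'rV[R]_k => u p.1 p.2),
      forall x, T x ->
        [/\ forall (n : nat) (A : 'I_n -> set R),
              (forall i, borel_Rplus (A i)) -> trivIset setT A ->
              mutually_independent P (fun i => u (A i) x),
            forall A : nat -> set R,
              (forall i, borel_Rplus (A i)) -> trivIset setT A ->
              L2norm P (fun w => u (\bigcup_i A i) x w
                                 - \sum_(i < n) u (A i) x w)
                @[n --> \oo] --> (0 : R) &
            {ae P, forall w, u [set t | 0 <= t] x w = v x w}],
      forall A B, borel_Rplus A -> borel_Rplus B -> A `&` B = set0 ->
        independent_sets P (sigma_gen T (u A)) (sigma_gen T (u B)) &
      exists c0 a0 : R,
      [/\ 0 < c0, 0 <= a0, forall j, 0 < gamma j,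
          forall (a : R) (b : \bar R) (x y : 'rV[R]_k),
            a0 <= a -> (a%:E < b)%E -> T x -> T y ->
            L2norm P (fun w => u (Ico a b) x w - v x w
                               - u (Ico a b) y w + v y w)
            <= c0 * (\sum_(j < k) a `^ gamma j * `|x 0 j - y 0 j|
                     + fine b^-1%E) &
          forall x y : 'rV[R]_k, T x -> T y ->
            L2norm P (fun w => u (Ico 0 a0%:E) x w - u (Ico 0 a0%:E) y w)
            <= c0 * \sum_(j < k) `|x 0 j - y 0 j|]].

(* The minimum below starts from the term of index 0, for the point x^0 = 0. *)
Definition assumptionB (v : 'rV[R]_k -> {RV P >-> R}) (T : set 'rV[R]_k)
    (gamma : 'I_k -> R) (c2 : R) : Prop :=
  0 < c2 /\
  forall (n : nat) (x : 'rV[R]_k) (xs : 'I_n -> 'rV[R]_k),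
    (1 <= n)%N -> T x -> (forall i, T (xs i)) ->
    exists2 V : Omega -> R,
      is_cond_variance P (sigma_gen setT (fun i => v (xs i))) (v x) V &
      {ae P, forall w,
        c2 * \big[Num.min/Delta gamma x 0 ^+ 2]_(i < n)
               Delta gamma x (xs i) ^+ 2 <= V w}.

Definition assumptionC (v : 'rV[R]_k -> {RV P >-> R}) (T : set 'rV[R]_k)
    (gamma : 'I_k -> R) : Prop :=
  exists2 c3 : R, 0 < c3 &
    forall x y, T x -> T y -> c3 * Delta gamma x y <= canonical_dist v x y.

Definition local_upper_bound (v : 'rV[R]_k -> {RV P >-> R})
    (T : set 'rV[R]_k) (gamma : 'I_k -> R) (c1 : R) : Prop :=
  exists2 eps1 : R, 0 < eps1 &
    forall x y, T x -> T y -> Delta gamma x y <= eps1 ->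
      canonical_dist v x y <= c1 * Delta gamma x y.

(* Supremum of |f x - f y| / (D x y sqrt (log (1 / D x y))) over x, y in T with
   0 < D x y <= r; only small r matter, so that the logarithm is positive. *)
Definition modulus (T : set 'rV[R]_k) (D : 'rV[R]_k -> 'rV[R]_k -> R)
    (f : 'rV[R]_k -> R) (r : R) : \bar R :=
  ereal_sup [set (`|f p.1 - f p.2| /
                  (D p.1 p.2 * Num.sqrt (ln (D p.1 p.2)^-1)))%:E
            | p in [set p | [/\ T p.1, T p.2 & 0 < D p.1 p.2 <= r]]].

End random_fields.

(* Main.v *)
(* All moduli are computed along a countable dense set of dyadic anisotropic
   grids, the level n grid having mesh about 2^-n for Delta and about 2^(Qn)
   points.

   Upper bound: by a union bound and Borel-Cantelli, eventually every increment
   between neighbours at distance about 2^-n on the grid of level n + e is at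
   most d sqrt(2 Q (1 + eta) n ln 2); chaining below level n + e costs only
   O(2^-e), and e, eta are arbitrary. Hence kappa' <= sqrt(2 Q).

   Zero-one law: the noise of [0, n) is Lipschitz, hence negligible for Delta,
   so the event that the limsup of the modulus is at most q does not change when v
   is replaced by the noise of [n, oo), which is independent of the noise of
   [0, n). The latter tends to v in L2, so the event is independent of v, and of
   itself. Therefore kappa := inf {q | the event has probability 1} is the
   almost sure value of the limit.

   Lower bound: choose about r^-Q disjoint pairs at distance r, all mutually at
   distance at least r. Assumption B bounds from below by sqrt c2 * r the norm of
   each increment minus any linear combination of the preceding ones; for
   Gaussian variables the residual is independent of the past, so the
   probability that all increments are at most q r sqrt(ln 1/r) tends to 0
   quickly if q < sqrt(2 Q c2). Finally d <= c1 Delta gives kappa <= c1 kappa'. *)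
Require Import Defs.
From HB Require Import structures.
From mathcomp Require Import all_boot all_order all_algebra.
From mathcomp Require Import all_classical all_reals all_analysis.
From mathcomp Require Import measurable_realfun.
From mathcomp Require Import ring lra.

Set Implicit Arguments.
Unset Strict Implicit.
Unset Printing Implicit Defensive.

Import Order.TTheory GRing.Theory Num.Theory.
Import numFieldNormedType.Exports.

Local Open Scope classical_set_scope.
Local Open Scope ring_scope.

(** * Gaussian laws *)

(** Apart from the noises on disjoint sets, the hypotheses speak only of the laws of single linear
    combinations, so independence must be extracted from one-dimensional characteristic functions.
    The device is a bounded [g] whose integral against [cos (U + c)] vanishes for all [U] in a
    linear space and all phases [c]. By the product formula for cosines, such a [g] may be
    multiplied by the indicator of an event on one element of the space at a time, so Fourier
    uniqueness on the line suffices for all cylinders. This serves twice: for orthogonal Gaussian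
    variables in the lower bound, and in the zero-one law, where cosines are also what passes to the
    L2 limit.

    The sharp upper constant belongs to [canonical_dist], since Gaussian tails see the exact norm of
    an increment; the sharp lower constant belongs to [Delta], the quantity in assumption B. Each
    critical value has only one direct estimate. The inequality between the two critical values
    supplies the others, including the positivity of [kappa'].

    The zero-one law needs an event stable under negligible perturbations, hence the relaxed modulus
    [tail_modulus_le], which has the same critical value. *)

Section normal_law.
Context {R : realType}.
Implicit Types (m s : R).
Local Notation mu := (@lebesgue_measure R).

(** Change of variables produces the Radon-Nikodym derivative, which equals [normal_pdf] almost
    everywhere because both have the same integral over every measurable set. *)
Lemma ge0_integral_normal m s (f : R -> R) : (forall x, 0 <= f x) ->
  measurable_fun setT f ->
  (\int[normal_prob m s]_x (f x)%:E =
   \int[mu]_x (f x * normal_pdf m s x)%:E)%E.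
Proof.
move=> f0 mf.
have dom := @normal_prob_dominates R m s.
rewrite -(Radon_Nikodym_SigmaFinite.change_of_variables dom)//=; last exact/measurable_EFinP.
under [RHS]eq_integral do rewrite EFinM.
have mpdf : measurable_fun setT (fun x => (normal_pdf m s x)%:E).
  by apply/measurable_EFinP; exact: measurable_normal_pdf.
have RNi := Radon_Nikodym_SigmaFinite.f_integrable dom.
apply: ae_eq_integral => //.
- apply: emeasurable_funM; first exact/measurable_EFinP.
  exact: measurable_int RNi.
- by apply: emeasurable_funM => //; exact/measurable_EFinP.
- apply: ae_eqe_mul2l => /=.
  apply: integral_ae_eq => // E _ mE.
  by rewrite -Radon_Nikodym_SigmaFinite.f_integral.
Qed.

Lemma integrable_normal m s (f : R -> R) : measurable_fun setT f ->
  mu.-integrable setT (fun x => (f x * normal_pdf m s x)%:E) ->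
  (normal_prob m s).-integrable setT (EFin \o f).
Proof.
move=> mf /integrableP[mfp ifp]; apply/integrableP; split.
  exact/measurable_EFinP.
rewrite (_ : (fun x => `|(EFin \o f) x|%E) = fun x => (`|f x|)%:E); last first.
  by apply/funext => x.
rewrite ge0_integral_normal//; last exact: measurableT_comp.
apply: le_lt_trans ifp; rewrite le_eqVlt; apply/orP; left; apply/eqP.
apply: eq_integral => x _ /=; rewrite normrM (ger0_norm (normal_pdf_ge0 _ _ _))//.
Qed.

Lemma Rintegral_normal m s (f : R -> R) : measurable_fun setT f ->
  mu.-integrable setT (fun x => (f x * normal_pdf m s x)%:E) ->
  \int[normal_prob m s]_x f x = \int[mu]_x (f x * normal_pdf m s x).
Proof.
move=> mf ifp.
have ifn := integrable_normal mf ifp.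
rewrite /Rintegral; congr fine.
rewrite integralE [RHS]integralE.
have mp : measurable_fun setT (fun x : R => Num.max (f x) 0).
  by apply: measurable_maxr.
have mn : measurable_fun setT (fun x : R => Num.max (- f x) 0).
  by apply: measurable_maxr => //; exact: measurableT_comp.
congr (_ - _)%E.
  transitivity (\int[normal_prob m s]_x (Num.max (f x) 0)%:E)%E.
    by apply: eq_integral => x _; rewrite funeposE EFin_max.
  rewrite ge0_integral_normal//; last first.
    by move=> x; rewrite le_max lexx orbT.
  apply: eq_integral => x _; rewrite funeposE -EFin_max; congr EFin.
  by rewrite maxr_pMl ?normal_pdf_ge0// mul0r.
transitivity (\int[normal_prob m s]_x (Num.max (- f x) 0)%:E)%E.
  by apply: eq_integral => x _; rewrite funenegE EFin_max.
rewrite ge0_integral_normal//; last first.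
  by move=> x; rewrite le_max lexx orbT.
apply: eq_integral => x _; rewrite funenegE -EFin_max; congr EFin.
by rewrite maxr_pMl ?normal_pdf_ge0// mul0r mulNr.
Qed.

Lemma normal_pdf_gt0E s x : 0 < s ->
  normal_pdf 0 s x = normal_peak s * expR (- x ^+ 2 / (2 * s ^+ 2)).
Proof.
move=> s0; rewrite normal_pdfE ?gt_eqF// /normal_fun subr0.
by rewrite (mulr_natl _ 2).
Qed.

(* Writing the density of N(m, s^2) as that of N(m, (s / lam)^2) times a factor
   that is small far from m. *)
Lemma normal_pdf_scale m s (lam x : R) : 0 < s -> 0 < lam ->
  normal_pdf m s x =
  lam^-1 * expR (- (1 - lam ^+ 2) * (x - m) ^+ 2 / (2 * s ^+ 2)) *
  normal_pdf m (s / lam) x.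
Proof.
move=> s0 l0.
have sn0 : s != 0 by rewrite gt_eqF.
have ln0 : lam != 0 by rewrite gt_eqF.
rewrite !normal_pdfE ?mulf_neq0 ?invr_neq0// /normal_fun /normal_peak.
rewrite mulrACA -expRD; congr (_ * expR _); last by field; rewrite sn0 ln0.
rewrite expr_div_n -!mulrnAr [X in _ = _ * (Num.sqrt X)^-1]mulrAC [in RHS]sqrtrM; last first.
  by rewrite mulr_ge0 ?sqr_ge0// mulrn_wge0 ?pi_ge0.
rewrite sqrtrV ?sqr_ge0// sqrtr_sqr gtr0_norm// invfM invrK.
by rewrite mulrCA mulVf// mulr1.
Qed.

(** The factor split off by [normal_pdf_scale] is bounded on the tail by its value at distance
    [s * z], and the remaining density integrates to 1. A small [lam] brings the exponent close to
    the optimal one at the price of the factor [lam^-1], harmless in a union bound. *)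
Lemma normal_prob_tail m s (lam z : R) : 0 < s -> 0 < lam -> lam < 1 -> 0 <= z ->
  (normal_prob m s [set x : R | (s * z <= `|x - m|)%R] <=
   (lam^-1 * expR (- (1 - lam ^+ 2) * z ^+ 2 / 2))%R%:E)%E.
Proof.
move=> s0 l0 l1 z0; rewrite /normal_prob.
set C := lam^-1 * _.
have C0 : 0 <= C by rewrite mulr_ge0 ?invr_ge0 ?ltW ?expR_gt0.
have mV : measurable [set x : R | (s * z <= `|x - m|)%R].
  rewrite -[X in measurable X]setTI; apply: measurable_fun_le => //.
  apply: measurableT_comp => //; exact: measurable_funB.
apply: (@le_trans _ _
   (\int[mu]_(x in [set x : R | (s * z <= `|x - m|)%R]) (C%:E * (normal_pdf m (s / lam) x)%:E)))%E.
  apply: ge0_le_integral => //.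
  - by move=> x _; rewrite lee_fin normal_pdf_ge0.
  - by apply/measurable_EFinP; apply: measurable_funTS; exact: measurable_normal_pdf.
  - apply/measurable_EFinP/measurable_funTS; apply: measurable_funM => //.
    exact: measurable_normal_pdf.
  - move=> x /= xz; rewrite lee_fin (@normal_pdf_scale m s lam)//.
    apply: ler_wpM2r; first exact: normal_pdf_ge0.
    apply: ler_wpM2l; first by rewrite invr_ge0 ltW.
    rewrite ler_expR !mulNr lerN2 -!mulrA; apply: ler_wpM2l.
      by rewrite subr_ge0 exprn_ile1 ?ltW.
    have h : (s * z) ^+ 2 <= (x - m) ^+ 2.
      rewrite -(real_normK (num_real (x - m))) lerXn2r// nnegrE.
      by rewrite (mulr_ge0 (ltW s0)).
    rewrite [leLHS](_ : _ = (s * z) ^+ 2 / (2 * s ^+ 2)); last by field; rewrite gt_eqF.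
    by rewrite mulrA ler_pM2r ?invr_gt0 ?mulr_gt0 ?exprn_gt0.
apply: (@le_trans _ _ (C%:E * \int[mu]_x (normal_pdf m (s / lam) x)%:E)%E); last first.
  by rewrite integral_normal_pdf mule1.
rewrite ge0_integralZl//.
- rewrite lee_wpmul2l//; apply: ge0_subset_integral => //.
  + by apply/measurable_EFinP; exact: measurable_normal_pdf.
  + by move=> x _; rewrite lee_fin normal_pdf_ge0.
- by apply/measurable_EFinP; apply: measurable_funTS; exact: measurable_normal_pdf.
- by move=> x _; rewrite lee_fin normal_pdf_ge0.
Qed.

(** Only the mass of the interval from [z] to [z + s] is kept, with the density bounded below by its
    value at the right end; this is the [+ 1] in the exponent. *)
Lemma normal_prob_lower s (z : R) : 0 < s -> 0 <= z ->
  ((normal_peak 1 * expR (- (z / s + 1) ^+ 2 / 2))%R%:E <=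
   normal_prob 0 s `]z, +oo[%classic)%E.
Proof.
move=> s0 z0; rewrite /normal_prob.
have pk : normal_peak s = normal_peak 1 / s.
  rewrite /normal_peak expr1n mul1r -mulrnAr sqrtrM ?sqr_ge0//.
  by rewrite sqrtr_sqr gtr0_norm// invfM mulrC.
apply: (@le_trans _ _ (\int[mu]_(x in `]z, (z + s)%R[) (normal_pdf 0 s x)%:E)%E); last first.
  apply: ge0_subset_integral => //.
  - by apply/measurable_EFinP; apply: measurable_funTS; exact: measurable_normal_pdf.
  - by move=> x _; rewrite lee_fin normal_pdf_ge0.
  - by apply: subset_itv; rewrite bnd_simp.
apply: (@le_trans _ _ (\int[mu]_(x in `]z, (z + s)%R[)
    (normal_peak 1 / s * expR (- (z / s + 1) ^+ 2 / 2))%R%:E)%E).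
  rewrite integral_cst//= lebesgue_measure_itv/= lte_fin ltrDl s0 -EFinD -EFinM lee_fin.
  by rewrite [z + s]addrC addrK mulrAC divfK ?gt_eqF.
apply: ge0_le_integral => //.
- move=> x _; rewrite lee_fin mulr_ge0 ?expR_ge0// divr_ge0 ?(ltW s0)//.
  exact: normal_peak_ge0.
- by apply/measurable_EFinP; apply: measurable_funTS; exact: measurable_normal_pdf.
- move=> x /=; rewrite in_itv/= => /andP[zx xz]; rewrite lee_fin normal_pdf_gt0E// pk.
  apply: ler_wpM2l; first by rewrite divr_ge0 ?(ltW s0) ?normal_peak_ge0.
  rewrite ler_expR !mulNr lerN2 invfM mulrA (mulrAC _ 2^-1) ler_pM2r//.
  have x0 : 0 <= x by rewrite (le_trans z0)// ltW.
  rewrite -expr_div_n lerXn2r ?nnegrE ?addr_ge0 ?divr_ge0 ?(ltW s0)//.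
  by rewrite ler_pdivrMr// mulrDl divfK ?gt_eqF// mul1r ltW.
Qed.

(** Integration by parts on the whole line: the fundamental theorem of calculus on growing symmetric
    intervals, then dominated convergence by [f] itself. *)
Lemma integral_derive_decay (F f : R -> R) :
  (forall x : R, is_derive x 1 F (f x)) -> continuous f ->
  mu.-integrable setT (EFin \o f) ->
  F n%:R - F (- n%:R) @[n --> \oo] --> (0 : R) -> \int[mu]_x f x = 0.
Proof.
move=> dF cf intf F0.
have mf : measurable_fun setT f by exact: continuous_measurable_fun.
have cF : continuous F.
  move=> x; apply: differentiable_continuous; apply/derivable1_diffP.
  by case: (dF x).
have FE n : (\int[mu]_(x in `[(- n.+1%:R)%R, n.+1%:R]) (f x)%:E = (F n.+1%:R - F (- n.+1%:R))%:E)%E.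
  rewrite (@continuous_FTC2 _ f F)//.
  - by rewrite (@lt_trans _ _ 0)// oppr_lt0.
  - exact: continuous_subspaceT.
  - split.
    + by move=> x _; case: (dF x).
    + by apply: cvg_at_right_filter; exact: cF.
    + by apply: cvg_at_left_filter; exact: cF.
  - by move=> x _; rewrite derive1E; apply: derive_val.
pose f_ n (x : R) := ((f \_ `[(- n.+1%:R)%R, n.+1%:R]) x)%:E.
have [] := @dominated_convergence _ _ _ mu setT measurableT f_ (EFin \o f) (EFin \o (fun x => `|f x|)).
- move=> n; apply/measurable_EFinP/measurable_restrict => //.
  by rewrite setTI; apply: measurable_funTS.
- exact/measurable_EFinP.
- apply/aeW => x _; apply: cvg_near_cst.
  near=> n; rewrite /f_ patchE mem_set//= in_itv/= -ler_norml.
  near: n; exists (Num.truncn `|x|) => // n /= xn.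
  by rewrite (le_trans (ltW (truncnS_gt _)))// ler_nat.
- exact: integrable_norm.
- apply/aeW => x n _; rewrite /f_ patchE; case: ifP => _ //=.
  by rewrite normr0 lee_fin.
move=> _ _ lim1.
have : (\int[mu]_x f_ n x)%E @[n --> \oo] --> (0:R)%:E.
  rewrite (_ : (fun n => _) = fun n => (F n.+1%:R - F (- n.+1%:R))%:E).
    apply: cvg_EFin; first exact: nearW.
    by rewrite -(cvg_shiftS (fun n => F n%:R - F (- n%:R))) in F0.
  apply/funext => n; rewrite -FE [RHS]integral_mkcond.
  by apply: eq_integral => x _; rewrite /f_ patchE [RHS]patchE; case: ifP.
move=> /cvg_lim l1; rewrite /Rintegral -(cvg_lim _ lim1)// l1.
Unshelve. all: by end_near. Qed.

Lemma sqr_expRN_le (a x : R) : 0 < a -> x ^+ 2 * expR (- (a * x ^+ 2)) <= a^-1.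
Proof.
move=> a0; rewrite expRN -ler_pdivlMr ?invr_gt0 ?expR_gt0// invrK mulrC -ler_pdivrMr ?invr_gt0// invrK mulrC.
by rewrite (le_trans _ (expR_ge1Dx _))// lerDr.
Qed.

(** Doubling the standard deviation absorbs the square: [sqr_expRN_le] at rate [3 / 8 / s ^+ 2],
    times the factor 2 of [normal_pdf_scale], gives 16/3, rounded up to 8. *)
Lemma sqr_normal_pdf_le s (x : R) : 0 < s ->
  x ^+ 2 * normal_pdf 0 s x <= 8 * s ^+ 2 * normal_pdf 0 (s / 2^-1) x.
Proof.
move=> s0; rewrite (@normal_pdf_scale 0 s 2^-1)// subr0 invrK (mulrA (x ^+ 2)).
apply: ler_wpM2r; first exact: normal_pdf_ge0.
set a := 3 / 8 / s ^+ 2.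
have -> : - (1 - 2^-1 ^+ 2) * x ^+ 2 / (2 * s ^+ 2) = - (a * x ^+ 2).
  by rewrite /a; field; rewrite gt_eqF.
have a0 : 0 < a by rewrite /a !divr_gt0 ?exprn_gt0.
have h := sqr_expRN_le x a0.
rewrite mulrCA (le_trans (ler_wpM2l _ h))//.
rewrite /a !invfM !invrK -subr_ge0 (_ : _ - _ = 8 / 3 * s ^+ 2); last by field.
by rewrite mulr_ge0 ?sqr_ge0.
Qed.

Lemma integrable_sqr_normal_pdf s : 0 < s ->
  mu.-integrable setT (fun x : R => (x ^+ 2 * normal_pdf 0 s x)%:E).
Proof.
move=> s0.
apply: (@le_integrable _ _ _ mu setT measurableT _ (fun x => (8 * s ^+ 2)%:E * (normal_pdf 0 (s / 2^-1) x)%:E)%E).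
- apply/measurable_EFinP; apply: measurable_funM; first exact: measurable_funX.
  exact: measurable_normal_pdf.
- move=> x _; rewrite -EFinM !abse_EFin lee_fin !ger0_norm ?sqr_normal_pdf_le//.
  + by rewrite mulr_ge0 ?normal_pdf_ge0// mulr_ge0 ?sqr_ge0.
  + by rewrite mulr_ge0 ?sqr_ge0 ?normal_pdf_ge0.
- by apply: integrableZl => //; exact: integrable_normal_pdf.
Qed.

Lemma integrable_quadratic_normal_pdf s (g : R -> R) : 0 < s -> measurable_fun setT g ->
  (forall x, `|g x| <= 1 + x ^+ 2) ->
  mu.-integrable setT (fun x : R => (g x * normal_pdf 0 s x)%:E).
Proof.
move=> s0 mg gle.
apply: (@le_integrable _ _ _ mu setT measurableT _ (fun x => (normal_pdf 0 s x)%:E + (x ^+ 2 * normal_pdf 0 s x)%:E)%E).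
- by apply/measurable_EFinP; apply: measurable_funM => //; exact: measurable_normal_pdf.
- move=> x _; rewrite -EFinD !abse_EFin lee_fin.
  rewrite -[X in X + _]mul1r -mulrDl !normrM ler_wpM2r//.
  by rewrite (le_trans (gle _))// ler_norm.
- apply: integrableD => //; first exact: integrable_normal_pdf.
  exact: integrable_sqr_normal_pdf.
Qed.

Lemma is_derive_normal_pdf s (x : R) : 0 < s ->
  is_derive x 1 (normal_pdf 0 s) (- (x / s ^+ 2) * normal_pdf 0 s x).
Proof.
move=> s0.
pose g (y : R) := - (2 * s ^+ 2)^-1 * y ^+ 2.
have -> : normal_pdf 0 s = normal_peak s \*: (expR \o g).
  apply/funext => y; rewrite normal_pdf_gt0E//= /g.
  by congr (_ * expR _); rewrite mulrC mulrN mulNr.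
have dg : is_derive x 1 g (- (x / s ^+ 2)).
  have d2 : is_derive x (1:R) ((id : R -> R) * id) (2 * x).
    by apply: is_derive_eq; rewrite /GRing.scale/=; ring.
  rewrite (_ : g = (- (2 * s ^+ 2)^-1) \*: ((id : R -> R) * id)).
    by apply: is_derive_eq; rewrite /GRing.scale/=; field; rewrite gt_eqF.
  by apply/funext => y; rewrite /g /GRing.scale/= expr2.
rewrite (_ : - (x / s ^+ 2) * _ = normal_peak s *: (expR (g x) * - (x / s ^+ 2))).
  exact: is_deriveZ.
by rewrite /= /GRing.scale/=; ring.
Qed.

Lemma normal_pdf_le_sqr s (x : R) : 0 < s -> x != 0 ->
  normal_pdf 0 s x <= normal_peak s * (2 * s ^+ 2) / x ^+ 2.
Proof.
move=> s0 x0; rewrite normal_pdf_gt0E// -mulrA ler_wpM2l ?normal_peak_ge0//.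
have a0 : 0 < (2 * s ^+ 2)^-1 by rewrite invr_gt0 mulr_gt0 ?exprn_gt0.
have := sqr_expRN_le x a0; rewrite invrK => h.
rewrite ler_pdivlMr ?exprn_even_gt0// mulrC.
by rewrite (_ : - x ^+ 2 / _ = - ((2 * s ^+ 2)^-1 * x ^+ 2))// mulrC mulrN.
Qed.

Lemma cvg_bounded_linear_normal_pdf s (g : R -> R) : 0 < s ->
  (forall x, `|g x| <= `|x|) ->
  g n%:R * normal_pdf 0 s n%:R @[n --> \oo] --> (0 : R).
Proof.
move=> s0 gle.
pose C := normal_peak s * (2 * s ^+ 2).
have C0 : 0 <= C by rewrite mulr_ge0 ?normal_peak_ge0// mulr_ge0 ?sqr_ge0.
apply: (@squeeze_cvgr _ _ _ _ (fun n => - (C * n%:R^-1)) (fun n => C * n%:R^-1)).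
- exists 1%N => // n /= n0.
  rewrite -ler_norml normrM (ger0_norm (normal_pdf_ge0 _ _ _)).
  apply: (@le_trans _ _ (n%:R * (C / n%:R ^+ 2))).
    apply: ler_pM => //; first exact: normal_pdf_ge0.
      by rewrite (le_trans (gle _))// ger0_norm.
    by apply: normal_pdf_le_sqr => //; rewrite pnatr_eq0 -lt0n.
  rewrite le_eqVlt; apply/orP; left; apply/eqP; field.
  by rewrite pnatr_eq0 -lt0n.
- rewrite -oppr0 -(mulr0 C); apply: cvgN; apply: cvgM; first exact: cvg_cst.
  by apply/gtr0_cvgV0; [exists 1%N => // n /=; rewrite ltr0n|exact: cvgr_idn].
- rewrite -(mulr0 C); apply: cvgM; first exact: cvg_cst.
  by apply/gtr0_cvgV0; [exists 1%N => // n /=; rewrite ltr0n|exact: cvgr_idn].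
Qed.

Lemma normal_pdfN s (x : R) : 0 < s -> normal_pdf 0 s (- x) = normal_pdf 0 s x.
Proof. by move=> s0; rewrite !normal_pdf_gt0E// sqrrN. Qed.

Lemma norm_le_1Dsqr (x : R) : `|x| <= 1 + x ^+ 2.
Proof.
rewrite ler_norml; apply/andP; split.
  by have := sqr_ge0 (x + 2^-1); nra.
by have := sqr_ge0 (x - 2^-1); nra.
Qed.

(** Stein's identity. The derivative of the density is [- x / s ^+ 2] times the density, so the
    difference of the two sides, up to the factor [s ^+ 2], is the integral of the derivative of
    [g * normal_pdf 0 s], which decays. It yields both the second moment and the differential
    equation of the characteristic function. *)
Lemma normal_stein s (g dg : R -> R) : 0 < s ->
  (forall x : R, is_derive x 1 g (dg x)) -> continuous dg ->
  (forall x, `|g x| <= `|x|) -> (forall x, `|dg x| <= 1 + x ^+ 2) ->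
  \int[mu]_x (x * g x * normal_pdf 0 s x) = s ^+ 2 * \int[mu]_x (dg x * normal_pdf 0 s x).
Proof.
move=> s0 gdg cdg gle dgle.
have cg : continuous g.
  move=> x; apply: differentiable_continuous; apply/derivable1_diffP.
  by case: (gdg x).
have cpdf : continuous (normal_pdf 0 s) by apply: continuous_normal_pdf; rewrite gt_eqF.
have cxg : continuous (fun x : R => x * g x) by move=> x; apply: cvgM; [exact: cvg_id|exact: cg].
have idg : mu.-integrable setT (fun x : R => (dg x * normal_pdf 0 s x)%:E).
  by apply: integrable_quadratic_normal_pdf => //; exact: continuous_measurable_fun.
have ixg : mu.-integrable setT (fun x : R => (x * g x * normal_pdf 0 s x)%:E).
  apply: integrable_quadratic_normal_pdf => //; first exact: continuous_measurable_fun.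
  move=> x; rewrite normrM (@le_trans _ _ (`|x| * `|x|)) ?ler_wpM2l//.
  by rewrite -expr2 real_normK ?num_real// lerDr.
pose f x := dg x * normal_pdf 0 s x - (s ^+ 2)^-1 * (x * g x * normal_pdf 0 s x).
have := @integral_derive_decay (g * normal_pdf 0 s) f.
rewrite /f RintegralB//; last first.
  by apply: (eq_integrable _ _ _ _ (integrableZl _ (s ^- 2) ixg)).
rewrite RintegralZl// => h.
suff e : \int[mu]_x (dg x * normal_pdf 0 s x) -
    s ^- 2 * \int[mu]_x (x * g x * normal_pdf 0 s x) = 0.
  move/eqP: e; rewrite subr_eq0 => /eqP ->.
  by rewrite mulVKf// gt_eqF ?exprn_gt0.
apply: h.
- move=> x; have dp := is_derive_normal_pdf x s0; have dgx := gdg x.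
  apply: is_derive_eq; rewrite /GRing.scale/=. ring.
- move=> x; apply: cvgB; first by apply: cvgM; [exact: cdg|exact: cpdf].
  apply: cvgM; first exact: cvg_cst. apply: cvgM; [exact: cxg|exact: cpdf].
- have := integrableB measurableT idg (integrableZl measurableT (s ^- 2) ixg).
  by apply: eq_integrable.
- rewrite -[X in _ --> X](subr0 0); apply: cvgB; first exact: (@cvg_bounded_linear_normal_pdf s g).
  rewrite (_ : (fun n : nat => _) = fun n : nat => g (- n%:R) * normal_pdf 0 s n%:R); last first.
    by apply/funext => n; rewrite -(normal_pdfN _ s0).
  apply: (@cvg_bounded_linear_normal_pdf s (fun x => g (- x))) => // x.
  by rewrite (le_trans (gle _))// normrN.
Qed.

Lemma normal_second_moment s : 0 < s -> \int[mu]_x (x ^+ 2 * normal_pdf 0 s x) = s ^+ 2.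
Proof.
move=> s0; have := @normal_stein s id (fun=> 1) s0.
under eq_Rintegral do rewrite -expr2.
under [X in s ^+ 2 * X]eq_Rintegral do rewrite mul1r.
rewrite [X in s ^+ 2 * X]/Rintegral integral_normal_pdf mulr1; apply => //.
- by move=> x; exact: cvg_cst.
- by move=> x; rewrite normr1 lerDl sqr_ge0.
Qed.

Lemma norm_sin_le (x : R) : `|sin x| <= `|x|.
Proof.
wlog x0 : x / 0 <= x => [hw|].
  have [/hw//|/ltW x0] := leP 0 x.
  by rewrite -normrN -sinN -(normrN x) hw// oppr_ge0.
move: x0; rewrite le_eqVlt => /predU1P[<-|x0]; first by rewrite sin0.
have [|c _] := @MVT R sin cos 0 x x0 (fun y _ => is_derive_sin y).
  by apply: continuous_subspaceT => y; exact: continuous_sin.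
rewrite sin0 !subr0 => ->; rewrite normrM ler_piMl// ler_norml cos_geN1 cos_le1//.
Qed.

Lemma is_derive_cosM (t r : R) : is_derive r 1 (fun r => cos (r * t)) (- (t * sin (r * t))).
Proof.
have dl : is_derive r (1:R) ( *%R^~ t : R -> R) t.
  rewrite (_ : ( *%R^~ t : R -> R) = t \*: (id : R -> R)); last first.
    by apply/funext => y; rewrite /GRing.scale/= mulrC.
  by apply: is_derive_eq; rewrite /GRing.scale/= mulr1.
have := @is_derive1_comp _ cos ( *%R^~ t) r _ _ (is_derive_cos (r * t)) dl.
by rewrite mulNr mulrC.
Qed.

Lemma is_derive_sinM (t r : R) : is_derive r 1 (fun r => sin (t * r)) (t * cos (t * r)).
Proof.
have dl : is_derive r (1:R) ( *%R t : R -> R) t.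
  rewrite (_ : ( *%R t : R -> R) = t \*: (id : R -> R))//.
  by apply: is_derive_eq; rewrite /GRing.scale/= mulr1.
have := @is_derive1_comp _ sin ( *%R t) r _ _ (is_derive_sin (t * r)) dl.
by rewrite mulrC.
Qed.

(** Differentiation under the integral sign, dominated uniformly in [r] by [(1 + x ^+ 2)] times the
    density. *)
Lemma is_derive_integral_cos s (r : R) : 0 < s ->
  is_derive r 1 (fun r => \int[mu]_x (cos (r * x) * normal_pdf 0 s x))
   (- \int[mu]_x (x * sin (r * x) * normal_pdf 0 s x)).
Proof.
move=> s0.
pose f (r x : R) := cos (r * x) * normal_pdf 0 s x.
have dfE (a x : R) : is_derive a 1 (f ^~ x) (- (x * sin (a * x)) * normal_pdf 0 s x).
  rewrite (_ : f ^~ x = normal_pdf 0 s x \*: (fun a => cos (a * x))); last first.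
    by apply/funext => y; rewrite /f mulrC.
  have := is_derive_cosM x a => ?.
  by apply: is_derive_eq; rewrite /GRing.scale/= mulrC.
have intf (a : R) : mu.-integrable setT (EFin \o f a).
  apply: integrable_quadratic_normal_pdf => //.
    apply: continuous_measurable_fun => x; apply: continuous_comp; last exact: continuous_cos.
    by apply: cvgM; [exact: cvg_cst|exact: cvg_id].
  move=> x; rewrite (@le_trans _ _ 1)// ?lerDl ?sqr_ge0//.
  by rewrite ler_norml cos_geN1 cos_le1.
have Ir : `](r - 1), (r + 1)[%classic r by rewrite /= in_itv/= ltrBlDr !ltrDl ltr01.
have d1f a x : partial1of2 f a x = - (x * sin (a * x)) * normal_pdf 0 s x.
  by rewrite partial1of2E; apply: derive_val.
have G0 (x : R) : 0 <= (1 + x ^+ 2) * normal_pdf 0 s x.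
  by rewrite mulr_ge0 ?normal_pdf_ge0// addr_ge0 ?sqr_ge0.
have intG : mu.-integrable setT (EFin \o (fun x : R => (1 + x ^+ 2) * normal_pdf 0 s x)).
  apply: integrable_quadratic_normal_pdf => //.
    by apply: measurable_funD => //; exact: measurable_funX.
  by move=> x; rewrite ger0_norm// addr_ge0 ?sqr_ge0.
have Gub a x : `](r - 1), (r + 1)[%classic a -> [set: R] x ->
    `|partial1of2 f a x| <= (1 + x ^+ 2) * normal_pdf 0 s x.
  move=> _ _; rewrite d1f normrM (ger0_norm (normal_pdf_ge0 _ _ _)).
  apply: ler_wpM2r; first exact: normal_pdf_ge0.
  rewrite normrN normrM (@le_trans _ _ `|x|)//.
    by rewrite ler_piMr// ler_norml sin_geN1 sin_le1.
  exact: norm_le_1Dsqr.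
have derf a x : `](r - 1), (r + 1)[%classic a -> [set: R] x -> derivable (f ^~ x) a 1.
  by move=> _ _; case: (dfE a x).
have c := @derivable_under_integral _ _ _ mu f setT measurableT r _ _ Ir (fun a _ => intf a) derf _ G0 intG Gub.
have e := @differentiation_under_integral _ _ _ mu f setT measurableT r _ _ Ir (fun a _ => intf a) derf _ G0 intG Gub.
apply: DeriveDef => //; rewrite -derive1E e.
rewrite -[RHS]mulN1r -RintegralZl//.
  by apply: eq_Rintegral => x _; rewrite d1f mulN1r mulNr.
apply: integrable_quadratic_normal_pdf => //.
  apply: continuous_measurable_fun => x; apply: cvgM; first exact: cvg_id.
  apply: continuous_comp; last exact: continuous_sin.
  by apply: cvgM; [exact: cvg_cst|exact: cvg_id].
move=> x; rewrite normrM (@le_trans _ _ `|x|)//.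
  by rewrite ler_piMr// ler_norml sin_geN1 sin_le1.
exact: norm_le_1Dsqr.
Qed.

(** Stein's identity for [r^-1 * sin (r * x)] turns the derivative of the integral [C] into
    [- s ^+ 2 * r * C r]. Hence [C r * expR (s ^+ 2 * r ^+ 2 / 2)] is constant, equal to its value 1
    at 0. The point [r = 0] is separate because of the division by [r]. *)
Lemma normal_integral_cos s t : 0 < s ->
  \int[mu]_x (cos (t * x) * normal_pdf 0 s x) = expR (- (s ^+ 2 * t ^+ 2 / 2)).
Proof.
move=> s0.
pose C r := \int[mu]_x (cos (r * x) * normal_pdf 0 s x).
have dC (r : R) : is_derive r 1 C (- s ^+ 2 * r * C r).
  have := is_derive_integral_cos r s0; rewrite -/C.
  have [->|r0] := eqVneq r 0.
    under eq_Rintegral do rewrite mul0r sin0 mulr0 mul0r.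
    by rewrite /Rintegral integral0 oppr0 mulr0 mul0r.
  have := @normal_stein s (fun x => r^-1 * sin (r * x)) (fun x => cos (r * x)) s0.
  rewrite -/(C r) => h.
  rewrite (_ : \int[mu]_x _ = r * (s ^+ 2 * C r)); first by rewrite mulrCA !mulNr mulrA.
  have hd (x : R) : is_derive x 1 (fun x => r^-1 * sin (r * x)) (cos (r * x)).
    have := is_derive_sinM r x => ?.
    rewrite (_ : (fun x => _) = r^-1 \*: (fun x => sin (r * x)))//.
    by apply: is_derive_eq; rewrite /GRing.scale/= mulrA mulVf ?mul1r.
  rewrite -(h hd); last first.
  - move=> x; rewrite (@le_trans _ _ 1)// ?lerDl ?sqr_ge0//.
    by rewrite ler_norml cos_geN1 cos_le1.
  - move=> x; rewrite normrM normfV ler_pdivrMl ?normr_gt0// -normrM; exact: norm_sin_le.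
  - move=> x; apply: continuous_comp; last exact: continuous_cos.
    by apply: cvgM; [exact: cvg_cst|exact: cvg_id].
  rewrite -RintegralZl//.
    by apply: eq_Rintegral => x _; field.
  apply: integrable_quadratic_normal_pdf => //.
    apply: continuous_measurable_fun => x; apply: cvgM; first exact: cvg_id.
    apply: cvgM; first exact: cvg_cst.
    apply: continuous_comp; last exact: continuous_sin.
    by apply: cvgM; [exact: cvg_cst|exact: cvg_id].
  move=> x; rewrite normrM (@le_trans _ _ (`|x| * `|x|)) ?ler_wpM2l//.
    by rewrite normrM normfV ler_pdivrMl ?normr_gt0// -normrM; exact: norm_sin_le.
  by rewrite -expr2 real_normK ?num_real// lerDr.
have : (C t * expR (s ^+ 2 * t ^+ 2 / 2)) = C 0 * expR (s ^+ 2 * 0 ^+ 2 / 2).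
  pose G r := C r * expR (s ^+ 2 * r ^+ 2 / 2).
  apply: (@is_derive_0_is_cst _ G) => r.
  pose h (y : R) := s ^+ 2 / 2 * (y * y).
  have dh : is_derive r (1:R) h (s ^+ 2 * r).
    rewrite (_ : h = (s ^+ 2 / 2) \*: ((id : R -> R) * id))//.
    by apply: is_derive_eq; rewrite /GRing.scale/=; field.
  have dCr := dC r.
  rewrite (_ : G = C * (expR \o h)).
    by apply: is_derive_eq; rewrite /GRing.scale/=; ring.
  by apply/funext => y; rewrite /G /h /=; congr (_ * expR _); ring.
rewrite expr0n mulr0 mul0r expR0 mulr1 expRN => e.
rewrite -/(C t) (canRL (mulfK _) e) ?gt_eqF ?expR_gt0//.
rewrite [X in X / _](_ : _ = 1) ?mul1r// /C.
under eq_Rintegral do rewrite mul0r cos0 mul1r.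
by rewrite /Rintegral integral_normal_pdf.
Qed.

End normal_law.

(** * Expectations and transfer to the law *)

Section real_expectation.
Context {d : measure_display} {Omega : measurableType d} {R : realType}.
Variable P : probability Omega R.
Implicit Types X Y : Omega -> R.

Lemma bounded_integrable X (M : R) : measurable_fun setT X ->
  (forall w, `|X w| <= M) -> P.-integrable setT (EFin \o X).
Proof.
move=> mX XM; apply: measurable_bounded_integrable => //.
  by rewrite (le_lt_trans (probability_le1 P measurableT)) ?ltry.
exists M; split; first exact: num_real.
by move=> x Mx w _ /=; rewrite (le_trans (XM w))// ltW.
Qed.

Lemma Rintegral_cst1 (c : R) : \int[P]_w c = c.
Proof. by rewrite Rintegral_cst//= [X in fine X](_ : _ = 1%E) ?mulr1//; exact: probability_setT. Qed.

Lemma Rintegral_indic (A : set Omega) : measurable A -> \int[P]_w (\1_A w : R) = fine (P A).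
Proof. by move=> mA; rewrite /Rintegral integral_indic// setIT. Qed.

Lemma ae_eq_integrable (f g : Omega -> \bar R) : measurable_fun setT f ->
  P.-integrable setT g -> {ae P, forall w, f w = g w} -> P.-integrable setT f.
Proof.
move=> mf /integrableP[mg ig] fg; apply/integrableP; split => //.
rewrite (@ge0_ae_eq_integral _ _ _ P setT _ (abse \o g))//.
- exact: measurableT_comp.
- exact: measurableT_comp.
- by move=> w _; exact: abse_ge0.
- by apply: filterS fg => w /= ->.
Qed.

Lemma ae_eq_Rintegral (f g : Omega -> R) : measurable_fun setT f ->
  measurable_fun setT g -> {ae P, forall w, f w = g w} ->
  \int[P]_w f w = \int[P]_w g w.
Proof.
move=> mf mg fg; rewrite /Rintegral; congr fine.
apply: ae_eq_integral => //; [exact/measurable_EFinP|exact/measurable_EFinP|].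
by apply: filterS fg => w /= ->.
Qed.

Lemma normal_law_Rintegral (s : R) X (f : R -> R) :
  measurable_fun setT X -> measurable_fun setT f ->
  (forall B : set R, measurable B -> P (X @^-1` B) = normal_prob 0 s B) ->
  P.-integrable setT (EFin \o (f \o X)) ->
  \int[P]_w f (X w) = \int[normal_prob 0 s]_x f x.
Proof.
move=> mX mf lawX intfX; rewrite /Rintegral; congr fine.
have mX' : measurable_fun setT (X : Omega -> measurableTypeR R) := mX.
transitivity (\int[pushforward P (X : Omega -> measurableTypeR R)]_x (EFin \o f) x)%E.
  rewrite (@integral_pushforward _ _ _ _ _ _ mX' _ _ (EFin \o f))//.
  exact/measurable_EFinP.
apply: eq_measure_integral => A mA _.
exact: lawX.
Qed.

Lemma normal_law_integrable (s : R) X (f : R -> R) :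
  measurable_fun setT X -> measurable_fun setT f ->
  (forall B : set R, measurable B -> P (X @^-1` B) = normal_prob 0 s B) ->
  (normal_prob 0 s).-integrable setT (EFin \o f) ->
  P.-integrable setT (EFin \o (f \o X)).
Proof.
move=> mX mf lawX /integrableP[_ intf]; apply/integrableP; split.
  by apply/measurable_EFinP; exact: measurableT_comp.
apply: le_lt_trans intf; rewrite le_eqVlt; apply/orP; left; apply/eqP.
have mX' : measurable_fun setT (X : Omega -> measurableTypeR R) := mX.
transitivity (\int[pushforward P (X : Omega -> measurableTypeR R)]_x `|(EFin \o f) x|)%E.
  rewrite (@ge0_integral_pushforward _ _ _ _ _ _ mX')//.
  by apply: measurableT_comp => //; exact/measurable_EFinP.
apply: eq_measure_integral => A mA _.
exact: lawX.
Qed.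

Lemma dirac_law_ae X : measurable_fun setT X ->
  (forall B : set R, measurable B -> P (X @^-1` B) = \d_(0 : R) B) ->
  {ae P, forall w, X w = 0}.
Proof.
move=> mX lawX; exists (X @^-1` ~` [set 0]); split => //.
- by rewrite -[_ @^-1` _]setTI; apply: mX => //; exact: measurableC.
- have -> := lawX (~` [set 0]) (measurableC (measurable_set1 _)).
  by rewrite diracE memNset//=; apply.
Qed.

End real_expectation.

(** * Centered Gaussian variables *)

Section gaussian_variable.
Context {d : measure_display} {Omega : measurableType d} {R : realType}.
Variable P : probability Omega R.
Implicit Types X Y : Omega -> R.

Lemma L2normE X : L2norm P X = Num.sqrt (\int[P]_w X w ^+ 2).
Proof. by rewrite /L2norm unlock. Qed.

Lemma L2norm_ge0 X : 0 <= L2norm P X.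
Proof. exact: sqrtr_ge0. Qed.

Lemma L2norm_sqr X : L2norm P X ^+ 2 = \int[P]_w X w ^+ 2.
Proof. by rewrite L2normE sqr_sqrtr// Rintegral_ge0// => w _; exact: sqr_ge0. Qed.

(** The existential parameter of the law must be [L2norm P X], by the second moment; the Dirac case
    is exactly norm 0. The norm thus determines the law. *)
Lemma gaussian_law X : measurable_fun setT X -> centered_gaussian P X ->
  P.-integrable setT (EFin \o (fun w => X w ^+ 2)) /\
  ((L2norm P X = 0 /\ forall B : set R, measurable B -> P (X @^-1` B) = \d_(0 : R) B) \/
   (0 < L2norm P X /\ forall B : set R, measurable B -> P (X @^-1` B) = normal_prob 0 (L2norm P X) B)).
Proof.
move=> mX.
have msq : measurable_fun setT (fun x : R => x ^+ 2) by exact: measurable_funX.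
case=> [lawX|[s s0 lawX]].
  have X0 := dirac_law_ae mX lawX.
  have intX : P.-integrable setT (EFin \o (fun w => X w ^+ 2)).
    apply: (@ae_eq_integrable _ _ _ P _ (cst 0%E)); last 2 first.
    - exact: integrable0.
    - by apply: filterS X0 => w /= ->; rewrite expr0n.
    - by apply/measurable_EFinP; exact: (measurableT_comp msq mX).
  split => //; left; split => //; rewrite L2normE.
  rewrite (@ae_eq_Rintegral _ _ _ P _ (cst 0))//.
  - by rewrite Rintegral_cst1 sqrtr0.
  - exact: (measurableT_comp msq mX).
  - by apply: filterS X0 => w /= ->; rewrite expr0n.
have isq := integrable_normal msq (integrable_sqr_normal_pdf s0).
have intX := normal_law_integrable mX msq lawX isq; split => //; right.
have -> : L2norm P X = s.
  rewrite L2normE (normal_law_Rintegral mX msq lawX intX).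
  rewrite Rintegral_normal ?normal_second_moment//; last exact: integrable_sqr_normal_pdf.
  by rewrite sqrtr_sqr gtr0_norm.
by split.
Qed.

Lemma gaussian_eq_law X Y : measurable_fun setT X -> measurable_fun setT Y ->
  centered_gaussian P X -> centered_gaussian P Y ->
  L2norm P X = L2norm P Y ->
  forall B : set R, measurable B -> P (X @^-1` B) = P (Y @^-1` B).
Proof.
move=> mX mY gX gY e B mB.
have [_ [[X0 lX]|[X0 lX]]] := gaussian_law mX gX; have [_ [[Y0 lY]|[Y0 lY]]] := gaussian_law mY gY.
- by rewrite lX// lY.
- by move: Y0; rewrite -e X0 ltxx.
- by move: X0; rewrite e Y0 ltxx.
- by rewrite (lX _ mB) (lY _ mB) e.
Qed.

Lemma gaussian_integral_cos X t : measurable_fun setT X -> centered_gaussian P X ->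
  \int[P]_w cos (t * X w) = expR (- (L2norm P X ^+ 2 * t ^+ 2 / 2)).
Proof.
move=> mX gX.
have mc : measurable_fun setT (fun x : R => cos (t * x)).
  apply: continuous_measurable_fun => x; apply: continuous_comp; last exact: continuous_cos.
  by apply: cvgM; [exact: cvg_cst|exact: cvg_id].
have intX : P.-integrable setT (EFin \o ((fun x : R => cos (t * x)) \o X)).
  apply: (@bounded_integrable _ _ _ _ _ 1); first exact: measurableT_comp.
  by move=> w; exact: cos_max.
have [_ [[X0 lX]|[X0 lX]]] := gaussian_law mX gX.
  have Xae := dirac_law_ae mX lX.
  rewrite (@ae_eq_Rintegral _ _ _ P _ (cst 1))//.
  - by rewrite Rintegral_cst1 X0 expr0n !mul0r oppr0 expR0.
  - exact: (measurableT_comp mc mX).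
  - by apply: filterS Xae => w /= ->; rewrite mulr0 cos0.
rewrite (normal_law_Rintegral mX mc lX intX) Rintegral_normal ?normal_integral_cos//.
apply: integrable_quadratic_normal_pdf => // x.
by rewrite (le_trans (cos_max _))// lerDl sqr_ge0.
Qed.

(** With a strict inequality the bound also covers degenerate variables, for which the event is
    null. *)
Lemma gaussian_tail X (lam z : R) : measurable_fun setT X -> centered_gaussian P X ->
  0 < lam -> lam < 1 -> 0 <= z ->
  (P [set w | (L2norm P X * z < `|X w|)%R] <=
   (lam^-1 * expR (- (1 - lam ^+ 2) * z ^+ 2 / 2))%R%:E)%E.
Proof.
move=> mX gX l0 l1 z0.
pose B : set R := [set x | L2norm P X * z < `|x|].
have mB : measurable B.
  rewrite -[X in measurable X]setTI; exact: measurable_fun_ltr.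
rewrite (_ : [set w | _] = X @^-1` B)//.
have [_ [[X0 lX]|[X0 lX]]] := gaussian_law mX gX; rewrite lX//.
  rewrite /B X0 mul0r diracE memNset ?lee_fin ?mulr_ge0 ?expR_ge0 ?invr_ge0 ?ltW//=.
  by rewrite normr0 ltxx.
apply: le_trans (normal_prob_tail 0 X0 l0 l1 z0).
rewrite le_measure ?inE//.
  rewrite -[X in measurable X]setTI; apply: measurable_fun_le => //.
  apply: measurableT_comp => //; exact: measurable_funB.
by move=> x; rewrite /B /= subr0 => /ltW.
Qed.

Lemma gaussian_lower X (z : R) : measurable_fun setT X -> centered_gaussian P X ->
  0 < L2norm P X -> 0 <= z ->
  ((normal_peak 1 * expR (- (z / L2norm P X + 1) ^+ 2 / 2))%R%:E <=
   P [set w | (z < X w)%R])%E.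
Proof.
move=> mX gX X0 z0.
have [_ [[Y0 lX]|[_ lX]]] := gaussian_law mX gX; first by rewrite Y0 ltxx in X0.
apply: (le_trans (normal_prob_lower X0 z0)); rewrite -lX//.
rewrite le_eqVlt; apply/orP; left; apply/eqP; congr (P _).
by apply/seteqP; split => w /=; rewrite in_itv/= andbT.
Qed.

End gaussian_variable.

Lemma Fubini_bounded {d1 d2 : measure_display} {T1 : measurableType d1}
    {T2 : measurableType d2} {R : realType} (m1 : probability T1 R)
    (m2 : probability T2 R) (f : T1 * T2 -> R) (M : R) :
  measurable_fun setT f -> (forall z, `|f z| <= M) ->
  \int[m1]_x \int[m2]_y f (x, y) = \int[m2]_y \int[m1]_x f (x, y).
Proof.
move=> mf fM.
have intf : (m1 \x m2)%E.-integrable setT (EFin \o f).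
  apply: measurable_bounded_integrable => //.
    rewrite [ltLHS](_ : _ = (m1 setT * m2 setT)%E); last first.
      by rewrite -product_measure1E// setXTT.
    by rewrite lte_mul_pinfty// ?fin_num_measure// (le_lt_trans (probability_le1 m2 measurableT)) ?ltry.
  exists M; split; first exact: num_real.
  by move=> x Mx z _ /=; rewrite (le_trans (fM z))// ltW.
have := Fubini intf => /=.
have E1 x : (\int[m2]_y (f (x, y))%:E = (\int[m2]_y f (x, y))%:E)%E.
  rewrite /Rintegral fineK//; apply: integrable_fin_num => //.
  apply: (@bounded_integrable _ _ _ _ _ M) => //.
  by apply: measurableT_comp.
have E2 y : (\int[m1]_x (f (x, y))%:E = (\int[m1]_x f (x, y))%:E)%E.
  rewrite /Rintegral fineK//; apply: integrable_fin_num => //.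
  apply: (@bounded_integrable _ _ _ _ _ M) => //.
  by apply: measurableT_comp.
move=> e; rewrite /Rintegral -[in LHS](eq_integral _ _ (fun x _ => E1 x)).
by rewrite -[in RHS](eq_integral _ _ (fun x _ => E2 x)) e.
Qed.

(** * Uniqueness for Fourier transforms *)

Section fourier_uniqueness.
Context {d : measure_display} {Omega : measurableType d} {R : realType}.
Variable P : probability Omega R.
Variables (g W : Omega -> R) (M : R).
Hypothesis mg : measurable_fun setT g.
Hypothesis mW : measurable_fun setT W.
Hypothesis gM : forall w, `|g w| <= M.
Hypothesis fourier0 : forall t c, \int[P]_w (g w * cos (t * W w + c)) = 0.

(* Integrating the hypothesis in [t] against a Gaussian weight. *)
Lemma fourier0_gauss (s y : R) : 0 < s ->
  \int[P]_w (g w * expR (- (s ^+ 2 * (W w - y) ^+ 2 / 2))) = 0.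
Proof.
move=> s0.
pose f (z : Omega * R) := g z.1 * cos ((W z.1 - y) * z.2).
have := @Fubini_bounded _ _ _ (measurableTypeR R) R P (normal_prob 0 s) f M.
rewrite /f /=.
have -> : \int[P]_w \int[normal_prob 0 s]_t (g w * cos ((W w - y) * t)) =
   \int[P]_w (g w * expR (- (s ^+ 2 * (W w - y) ^+ 2 / 2))).
  apply: eq_Rintegral => w _.
  have mc : measurable_fun setT (fun x : R => cos ((W w - y) * x)).
    apply: continuous_measurable_fun => x; apply: continuous_comp; last exact: continuous_cos.
    by apply: cvgM; [exact: cvg_cst|exact: cvg_id].
  have ic : (lebesgue_measure).-integrable setT
      (fun x : R => (cos ((W w - y) * x) * normal_pdf 0 s x)%:E).
    apply: integrable_quadratic_normal_pdf => // x.
    by rewrite (le_trans (cos_max _))// lerDl sqr_ge0.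
  rewrite RintegralZl//; last exact: integrable_normal.
  by rewrite Rintegral_normal// normal_integral_cos.
move=> ->.
- transitivity (\int[normal_prob 0 s]_t (0 : R)); last by rewrite /Rintegral integral0.
  apply: eq_Rintegral => t _; rewrite -[RHS](fourier0 t (- (t * y))).
  by apply: eq_Rintegral => w _; congr (_ * cos _); ring.
- apply: measurable_funM.
    by apply: (measurableT_comp mg); exact: measurable_fst.
  apply: (@measurableT_comp _ _ _ _ _ _ (@cos R)).
    by apply: continuous_measurable_fun; exact: continuous_cos.
  apply: measurable_funM; last exact: measurable_snd.
  apply: measurable_funB => //.
  by apply: (measurableT_comp mW); exact: measurable_fst.
- move=> z; rewrite normrM (le_trans _ (gM z.1))// ler_piMr//; exact: cos_max.
Qed.

Lemma measurable_joint_normal_pdf (e : R) : 0 < e ->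
  measurable_fun setT (fun z : Omega * R => normal_pdf (W z.1) e z.2).
Proof.
move=> e0.
rewrite (_ : (fun z => _) = fun z : Omega * R => normal_pdf 0 e (z.2 - W z.1)); last first.
  by apply/funext => z; rewrite !normal_pdfE ?gt_eqF// /normal_fun subr0.
apply: (@measurableT_comp _ _ _ _ _ _ (normal_pdf (0 : R) e)).
  exact: measurable_normal_pdf.
apply: measurable_funB; first exact: measurable_snd.
by apply: (measurableT_comp mW); exact: measurable_fst.
Qed.

Lemma uniform_normal_pdf (e a b : R) w (ab : a < b) :
  (\int[uniform_prob ab]_t (normal_pdf (W w) e t)%:E =
      ((b - a)^-1 * fine (normal_prob (W w) e `[a, b]))%:E)%E.
Proof.
rewrite integral_uniform.
- by rewrite EFinM fineK// fin_num_measure.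
- by apply/measurable_EFinP; exact: measurable_normal_pdf.
- by move=> t; rewrite lee_fin normal_pdf_ge0.
Qed.

(** Measurability in the mean comes from Tonelli: the probability of the interval is, up to scaling,
    the integral of a jointly measurable density against the uniform law. *)
Lemma measurable_normal_prob_itv (a b e : R) : a < b -> 0 < e ->
  measurable_fun setT (fun w => fine (normal_prob (W w) e `[a, b])).
Proof.
move=> ab e0.
rewrite (_ : (fun w => _) = fun w => (b - a) *
    fine (\int[uniform_prob ab]_t (normal_pdf (W w) e t)%:E)); last first.
  by apply/funext => w; rewrite uniform_normal_pdf/= mulVKf// subr_eq0 gt_eqF.
apply: measurable_funM => //; apply: measurableT_comp => //.
apply: (@measurable_fun_fubini_tonelli_F _ _ Omega (measurableTypeR R) R
  (uniform_prob ab) (fun z => (normal_pdf (W z.1) e z.2)%:E)).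
- by apply/measurable_EFinP; exact: measurable_joint_normal_pdf.
- by move=> z; rewrite lee_fin normal_pdf_ge0.
Qed.

(** With [s = e^-1], the weight in [fourier0_gauss] is proportional to the density of N([W w],
    [e ^+ 2]) at [y]; averaging over [y] in [[a, b]] gives the smoothed indicator of the
    interval. *)
Lemma fourier0_normal (a b e : R) : a < b -> 0 < e ->
  \int[P]_w (g w * fine (normal_prob (W w) e `[a, b])) = 0.
Proof.
move=> ab e0.
pose f (z : Omega * R) := g z.1 * normal_pdf (W z.1) e z.2.
have M0 : 0 <= M by rewrite (le_trans _ (gM point)).
have fE w y : normal_pdf (W w) e y =
    normal_peak e * expR (- (e^-1 ^+ 2 * (W w - y) ^+ 2 / 2)).
  rewrite normal_pdfE ?gt_eqF// /normal_fun; congr (_ * expR _).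
  by field; rewrite gt_eqF.
have := @Fubini_bounded _ _ _ (measurableTypeR R) R P (uniform_prob ab) f (M * normal_peak e).
rewrite /f /=.
have -> : \int[P]_w \int[uniform_prob ab]_t (g w * normal_pdf (W w) e t) =
   (b - a)^-1 * \int[P]_w (g w * fine (normal_prob (W w) e `[a, b])).
  have iN w := uniform_normal_pdf e w ab.
  have inner w : \int[uniform_prob ab]_t (g w * normal_pdf (W w) e t) =
      (b - a)^-1 * (g w * fine (normal_prob (W w) e `[a, b])).
    rewrite RintegralZl//; first by rewrite mulrCA; congr (_ * _); rewrite /Rintegral iN.
    apply: (@bounded_integrable _ _ _ (uniform_prob ab) _ (normal_peak e)).
      exact: measurable_normal_pdf.
    by move=> t; rewrite ger0_norm ?normal_pdf_ge0// normal_pdf_ub// gt_eqF.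
  rewrite -RintegralZl//; first by apply: eq_Rintegral => w _; exact: inner.
  apply: (@bounded_integrable _ _ _ _ _ M).
    apply: measurable_funM => //.
    exact: measurable_normal_prob_itv.
  move=> w; rewrite normrM (le_trans _ (gM w))// ler_piMr//.
  rewrite ger0_norm ?fine_ge0// -lee_fin fineK ?fin_num_measure//.
  exact: probability_le1.
have -> : \int[uniform_prob ab]_y \int[P]_w (g w * normal_pdf (W w) e y) = 0.
  transitivity (\int[uniform_prob ab]_t (0 : R)); last by rewrite /Rintegral integral0.
  apply: eq_Rintegral => t _.
  rewrite (_ : (fun w => _) = fun w => normal_peak e *
       (g w * expR (- (e^-1 ^+ 2 * (W w - t) ^+ 2 / 2)))); last first.
    by apply/funext => w; rewrite fE mulrCA.
  rewrite RintegralZl//; first by rewrite fourier0_gauss ?mulr0// invr_gt0.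
  apply: (@bounded_integrable _ _ _ _ _ M).
    apply: measurable_funM => //; apply: measurableT_comp => //.
    apply: measurableT_comp => //; apply: measurable_funM => //.
    apply: measurable_funM => //; apply: measurable_funX.
    exact: measurable_funB.
  move=> w; rewrite normrM (le_trans _ (gM w))// ler_piMr//.
  rewrite ger0_norm ?expR_ge0// -[leRHS]expR0 ler_expR oppr_le0.
  by rewrite divr_ge0// mulr_ge0// sqr_ge0.
move=> h.
suff /eqP : (b - a)^-1 * \int[P]_w (g w * fine (normal_prob (W w) e `[a, b])) = 0.
  by rewrite mulf_eq0 invr_eq0 subr_eq0 gt_eqF//= => /eqP.
apply: h.
- apply: measurable_funM; last exact: measurable_joint_normal_pdf.
  by apply: (measurableT_comp mg); exact: measurable_fst.
- move=> z; rewrite normrM; apply: ler_pM => //.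
  by rewrite ger0_norm ?normal_pdf_ge0// normal_pdf_ub// gt_eqF.
Qed.

Let h n : R := n.+1%:R^-1.

(** Distance [h n] is [(h n)^-1] standard deviations. The tail at [lam = 2^-1] is at most
    [16 / 3 * h n ^+ 2], and [h n <= 1]. *)
Lemma normal_prob_far (m : R) n (B : set R) : measurable B ->
  (forall x, B x -> h n <= `|x - m|) ->
  fine (normal_prob m (h n ^+ 2) B) <= 6 * h n.
Proof.
move=> mB hB.
have h0 : 0 < h n by rewrite invr_gt0 ltr0n.
have h1 : h n <= 1 by rewrite invf_le1 ?ler1n ?ltr0n.
rewrite -lee_fin fineK ?fin_num_measure//.
have l0 : 0 < (2^-1 : R) by [].
have l1 : (2^-1 : R) < 1 by rewrite invf_lt1// ltr1n.
have z0 : 0 <= (h n)^-1 by rewrite invr_ge0 ltW.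
apply: le_trans (le_trans (normal_prob_tail m (exprn_gt0 2 h0) l0 l1 z0) _).
  rewrite le_measure ?inE//.
    rewrite -[X in measurable X]setTI; apply: measurable_fun_le => //.
    by apply: measurableT_comp => //; exact: measurable_funB.
  by move=> x /hB; rewrite /= expr2 mulfK// gt_eqF.
rewrite lee_fin invrK.
have -> : - (1 - 2^-1 ^+ 2) * (h n)^-1 ^+ 2 / 2 = - (3 / 8 * (h n)^-1 ^+ 2) :> R by field; rewrite gt_eqF.
have a0 : 0 < (3 / 8 : R) by rewrite divr_gt0.
have := sqr_expRN_le (h n)^-1 a0; set E := expR _ => hE.
have E0 : 0 <= E by exact: expR_ge0.
have : E <= 8 / 3 * h n ^+ 2.
  rewrite -(@ler_pM2l _ ((h n)^-1 ^+ 2)) ?exprn_gt0 ?invr_gt0//.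
  by rewrite (le_trans hE)// invf_div exprVn mulrCA mulVf ?mulr1// gt_eqF ?exprn_gt0.
by nra.
Qed.

Lemma cvg_normal_indic (a b m : R) : a < b ->
  fine (normal_prob m (h n ^+ 2) `[a + h n, b + h n]) @[n --> \oo] -->
  (\1_(`]a, b]%classic : set R) m : R).
Proof.
move=> ab.
have hcvg : h n @[n --> \oo] --> (0 : R) by exact: cvg_harmonic.
have hsmall (c : R) : 0 < c -> \forall n \near \oo, 2 * h n < c.
  move=> c0; have /cvgrPdist_lt/(_ (c / 2)) := hcvg.
  rewrite divr_gt0// => /(_ isT); apply: filterS => n /=.
  rewrite sub0r normrN gtr0_norm ?invr_gt0 ?ltr0n// => hn.
  by rewrite mulrC -ltr_pdivlMr.
have h0 n : 0 < h n by rewrite invr_gt0 ltr0n.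
apply/cvgrPdist_le => eps eps0.
have eps3 : \forall n \near \oo, 6 * h n <= eps.
  have := hsmall (eps / 3); rewrite divr_gt0// => /(_ isT); apply: filterS => n.
  by rewrite ltr_pdivlMr// => /ltW; apply: le_trans; rewrite le_eqVlt; apply/orP; left; apply/eqP; ring.
rewrite indicE; have [|] := boolP (m \in _).
  rewrite inE/= in_itv/= => /andP[am mb].
  have := hsmall (m - a); rewrite subr_gt0 => /(_ am) near1.
  near=> n.
  have mB : measurable (`[a + h n, b + h n]%classic : set R) by [].
  have -> : 1 - fine (normal_prob m (h n ^+ 2) `[a + h n, b + h n]) =
     fine (normal_prob m (h n ^+ 2) (~` `[a + h n, b + h n])).
    have -> := probability_setC (normal_prob m (h n ^+ 2)) mB.
    by rewrite -[in RHS](fineK (fin_num_measure (normal_prob m (h n ^+ 2)) _ mB)).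
  rewrite ger0_norm ?fine_ge0//.
  apply: (@le_trans _ _ (6 * h n)); last by near: n.
  apply: normal_prob_far; first exact: measurableC.
  have : 2 * h n < m - a by near: n.
  move=> hn x /=; rewrite in_itv/= => /negP; rewrite negb_and -!ltNge => /orP[xa|xb].
    by rewrite ler_normr opprB; apply/orP; right; lra.
  by rewrite ler_normr; apply/orP; left; lra.
rewrite notin_setE/= in_itv/= => /negP; rewrite negb_and -leNgt -ltNge.
move=> amb.
have near2 : \forall n \near \oo, (m <= a) || (2 * h n < m - b).
  case/orP: amb => [ma|bm]; first by apply: nearW => n; rewrite ma.
  have := hsmall (m - b); rewrite subr_gt0 => /(_ bm); apply: filterS => n ->.
  by rewrite orbT.
near=> n.
rewrite sub0r normrN ger0_norm ?fine_ge0//.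
apply: (@le_trans _ _ (6 * h n)); last by near: n.
apply: normal_prob_far => // x /=; rewrite in_itv/= => /andP[ax xb].
have /orP[ma|mb] : (m <= a) || (2 * h n < m - b) by near: n.
  by rewrite ler_normr; apply/orP; left; lra.
by rewrite ler_normr opprB; apply/orP; right; lra.
Unshelve. all: by end_near. Qed.

(* The window is shifted by [h n], which dominates the standard deviation
   [h n ^+ 2], so that the endpoints are treated correctly even at atoms of [W]. *)
Lemma fourier0_itv (a b : R) : a < b ->
  \int[P]_w (g w * \1_(`]a, b]%classic : set R) (W w)) = 0.
Proof.
move=> ab.
have : (\int[P]_w (g w * fine (normal_prob (W w) (h n ^+ 2) `[a + h n, b + h n])) )
   @[n --> \oo] --> \int[P]_w (g w * \1_(`]a, b]%classic : set R) (W w)).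
  have mI : measurable_fun setT (fun w => g w * (\1_(`]a, b]%classic : set R) (W w) : R)).
    by apply: measurable_funM => //; apply: measurableT_comp => //.
  have h0 n : 0 < h n ^+ 2 by rewrite exprn_gt0 ?invr_gt0 ?ltr0n.
  have abn n : a + h n < b + h n by rewrite ltrD2r.
  have mN n : measurable_fun setT (fun w => g w * fine (normal_prob (W w) (h n ^+ 2) `[a + h n, b + h n])).
    by apply: measurable_funM => //; exact: measurable_normal_prob_itv.
  have [] := @dominated_convergence _ _ _ P setT measurableT
    (fun n w => (g w * fine (normal_prob (W w) (h n ^+ 2) `[a + h n, b + h n]))%:E)
    (fun w => (g w * \1_(`]a, b]%classic : set R) (W w))%:E) (cst M%:E).
  - by move=> n; exact/measurable_EFinP.
  - exact/measurable_EFinP.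
  - apply/aeW => w _; apply: cvg_EFin; first exact: nearW.
    by apply: cvgM; [exact: cvg_cst|exact: cvg_normal_indic].
  - exact: (@bounded_integrable _ _ _ P (cst M) `|M|).
  - apply/aeW => w n _; rewrite lee_fin normrM (le_trans _ (gM w))// ler_piMr//.
    rewrite ger0_norm ?fine_ge0// -lee_fin fineK ?fin_num_measure//.
    exact: probability_le1.
  move=> i1 _ c; rewrite /Rintegral; apply: fine_cvg; rewrite fineK//.
  exact: integrable_fin_num.
under eq_fun do rewrite fourier0_normal ?ltrD2r ?exprn_gt0 ?invr_gt0 ?ltr0n//.
by move=> /cvg_lim <-//; rewrite lim_cst.
Qed.

(** Half-open intervals form a generating pi-system. Complements are handled by the vanishing of the
    total integral, which is the hypothesis at frequency and phase 0. *)
Lemma fourier0_preimage (B : set R) : measurable B ->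
  (\int[P]_(w in W @^-1` B) (g w)%:E = 0)%E.
Proof.
have ig : P.-integrable setT (EFin \o g) by exact: (@bounded_integrable _ _ _ _ _ M).
have mWB (C : set R) : measurable C -> measurable (W @^-1` C).
  by move=> mC; rewrite -[_ @^-1` _]setTI; exact: mW.
have igB (C : set R) : measurable C -> P.-integrable (W @^-1` C) (EFin \o g).
  by move=> mC; apply: integrableS ig => //; exact: mWB.
have igT : (\int[P]_w (g w)%:E = 0)%E.
  have := fourier0 0 0; under eq_Rintegral do rewrite mul0r addr0 cos0 mulr1.
  by rewrite /Rintegral => e; rewrite -[LHS]fineK ?e//; exact: integrable_fin_num.
move=> mB.
apply: (@dynkin_induction _ (measurableTypeR R) (@ocitv R)
   (fun B => (\int[P]_(w in W @^-1` B) (g w)%:E = 0)%E)) => //.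
- exact: ocitvI.
- move=> _ [[a b] _ <-]/=.
  have [ab|ba] := ltP a b; last first.
    by rewrite set_itv_ge ?bnd_simp -?leNgt// preimage_set0 integral_set0.
  have := fourier0_itv ab; rewrite /Rintegral => e.
  have mI : measurable (W @^-1` (`]a, b]%classic : set R)) by exact: mWB.
  have E : (\int[P]_(w in W @^-1` `]a, b]) (g w)%:E =
      \int[P]_w (g w * \1_(`]a, b]%classic : set R) (W w))%:E)%E.
    rewrite integral_mkcond; apply: eq_integral => w _.
    rewrite patchE indicE; have -> : (w \in W @^-1` `]a, b]) = (W w \in (`]a, b]%classic : set R)) by [].
    by case: ifP; rewrite ?mulr1 ?mulr0.
  rewrite E -[LHS]fineK ?e//; rewrite -E.
  by apply: integrable_fin_num => //; exact: igB.
- move=> S mS S0.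
  have := @integral_setU _ _ _ P _ _ (EFin \o g) (mWB _ mS) (mWB _ (measurableC mS)).
  rewrite -preimage_setU setUCr preimage_setT igT S0 add0e => <- //.
    by apply/measurable_EFinP.
  by rewrite disj_set2E -preimage_setI setICr preimage_set0.
- move=> F mF tF F0; rewrite preimage_bigcup integral_bigcup//.
  + by rewrite eseries0.
  + move=> i j _ _ [w [Fi Fj]]; apply: (tF i j) => //; by exists (W w).
  + by move=> k; exact: (mWB (F k) (mF k)).
  + rewrite -preimage_bigcup; apply: igB; exact: (bigcupT_measurable _ mF).
Qed.

End fourier_uniqueness.

(** * Gaussian spaces *)

Section square_integrable.
Context {d : measure_display} {Omega : measurableType d} {R : realType}.
Variable P : probability Omega R.
Implicit Types X Y Z : Omega -> R.

Definition sqint X : Prop :=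
  measurable_fun setT X /\ P.-integrable setT (EFin \o (fun w => X w ^+ 2)).

Definition inner X Y : R := \int[P]_w (X w * Y w).

Lemma sqint_integrableM X Y : sqint X -> sqint Y ->
  P.-integrable setT (EFin \o (fun w => X w * Y w)).
Proof.
move=> [mX iX] [mY iY].
apply: (@le_integrable _ _ _ P setT measurableT _
   (EFin \o ((fun w => X w ^+ 2) \+ (fun w => Y w ^+ 2)))).
- by apply/measurable_EFinP; exact: measurable_funM.
- move=> w _; rewrite /= lee_fin normrM [leRHS]ger0_norm ?addr_ge0 ?sqr_ge0//.
  rewrite -(real_normK (num_real (X w))) -(real_normK (num_real (Y w))).
  have : 0 <= `|X w| by []. have : 0 <= `|Y w| by [].
  by move: `|X w| `|Y w| => a b; nra.
- by have := integrableD measurableT iX iY; apply: eq_integrable.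
Qed.

Lemma sqint_lin (a : R) X Y : sqint X -> sqint Y -> sqint (fun w => a * X w + Y w).
Proof.
move=> sX sY; have iXY := sqint_integrableM sX sY; case: sX sY => mX iX [mY iY].
have mZ : measurable_fun setT (fun w => a * X w + Y w).
  by apply: measurable_funD => //; exact: measurable_funM.
split=> //.
have := integrableD measurableT (integrableD measurableT
  (integrableZl measurableT (a ^+ 2) iX) (integrableZl measurableT (2 * a) iXY)) iY.
apply: eq_integrable => // w _ /=; rewrite -!EFinM -!EFinD; congr EFin; ring.
Qed.

Lemma sqint_integrable X : sqint X -> P.-integrable setT (EFin \o X).
Proof.
move=> sX; have s1 : sqint (cst 1).
  split=> //; apply: (@bounded_integrable _ _ _ _ _ 1); first exact: measurable_funX.
  by move=> w; rewrite /= expr1n normr1.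
have := sqint_integrableM sX s1; apply: eq_integrable => // w _ /=.
by rewrite mulr1.
Qed.

Lemma innerC X Y : inner X Y = inner Y X.
Proof. by apply: eq_Rintegral => w _; rewrite mulrC. Qed.

Lemma inner_lin (a : R) X Y Z : sqint X -> sqint Y -> sqint Z ->
  inner (fun w => a * X w + Y w) Z = a * inner X Z + inner Y Z.
Proof.
move=> sX sY sZ; have iX := sqint_integrableM sX sZ; have iY := sqint_integrableM sY sZ.
rewrite /inner -RintegralZl// -RintegralD//.
  by apply: eq_Rintegral => w _; rewrite mulrDl mulrA.
by have := integrableZl measurableT a iX; apply: eq_integrable.
Qed.

Lemma inner_ge0 X : 0 <= inner X X.
Proof. by apply: Rintegral_ge0 => w _; rewrite -expr2 sqr_ge0. Qed.

Lemma L2norm_inner X : L2norm P X ^+ 2 = inner X X.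
Proof. by rewrite L2norm_sqr; apply: eq_Rintegral => w _; rewrite expr2. Qed.

Lemma inner_sqr_lin (a : R) X Y : sqint X -> sqint Y ->
  inner (fun w => a * X w + Y w) (fun w => a * X w + Y w) =
  a ^+ 2 * inner X X + 2 * a * inner X Y + inner Y Y.
Proof.
move=> sX sY; have sZ := sqint_lin a sX sY.
rewrite inner_lin// (innerC X) (innerC Y) !inner_lin// (innerC Y X).
ring.
Qed.

(** The squared norm of [a * X + Y] is a nonnegative quadratic polynomial in [a]. *)
Lemma cauchy_schwarz X Y : sqint X -> sqint Y ->
  inner X Y ^+ 2 <= inner X X * inner Y Y.
Proof.
move=> sX sY.
have q a : 0 <= a ^+ 2 * inner X X + 2 * a * inner X Y + inner Y Y.
  by rewrite -inner_sqr_lin// inner_ge0.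
have := inner_ge0 X; rewrite le_eqVlt => /predU1P[X0|X0].
  have [->|n0] := eqVneq (inner X Y) 0; first by rewrite expr0n mulr_ge0// inner_ge0.
  (* The polynomial is now affine with nonzero slope; this [a] gives it the value -1. *)
  have := q (- (inner Y Y + 1) / (2 * inner X Y)); rewrite -X0 mulr0 add0r.
  rewrite (_ : _ + _ = -1); last by field.
  by rewrite lerNr oppr0 leNgt ltr01.
have := q (- inner X Y / inner X X).
rewrite (_ : _ + _ + _ = (inner X X * inner Y Y - inner X Y ^+ 2) / inner X X).
  by rewrite pmulr_lge0 ?invr_gt0// subr_ge0.
by field; rewrite gt_eqF.
Qed.

Lemma L2norm_triangle X Y : sqint X -> sqint Y ->
  L2norm P (fun w => X w + Y w) <= L2norm P X + L2norm P Y.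
Proof.
move=> sX sY.
rewrite -ler_sqr ?nnegrE ?addr_ge0 ?L2norm_ge0//.
have cs := cauchy_schwarz sX sY; rewrite -!L2norm_inner in cs.
have := inner_sqr_lin 1 sX sY.
under eq_fun do rewrite mul1r.
rewrite -!L2norm_inner => ->.
have : inner X Y <= L2norm P X * L2norm P Y.
  rewrite (le_trans (ler_norm _))// -ler_sqr ?nnegrE ?mulr_ge0 ?L2norm_ge0//.
  by rewrite real_normK ?num_real// exprMn.
by move: (L2norm P X) (L2norm P Y) (inner X Y) => a b c; nra.
Qed.

Lemma L2normZ (a : R) X : sqint X -> L2norm P (fun w => a * X w) = `|a| * L2norm P X.
Proof.
move=> [mX iX]; rewrite !L2normE -sqrtr_sqr -sqrtrM ?sqr_ge0// -RintegralZl//.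
by congr Num.sqrt; apply: eq_Rintegral => w _; rewrite exprMn.
Qed.

Lemma L2normN X : L2norm P (fun w => - X w) = L2norm P X.
Proof. by rewrite !L2normE; congr Num.sqrt; apply: eq_Rintegral => w _; rewrite sqrrN. Qed.

Lemma eq_L2norm X Y : X =1 Y -> L2norm P X = L2norm P Y.
Proof. by move=> XY; congr L2norm; apply/funext. Qed.

Lemma ae_eq_L2norm X Y : measurable_fun setT X -> measurable_fun setT Y ->
  {ae P, forall w, X w = Y w} -> L2norm P X = L2norm P Y.
Proof.
move=> mX mY XY; rewrite !L2normE; congr Num.sqrt; apply: ae_eq_Rintegral.
- exact: measurable_funX.
- exact: measurable_funX.
- by apply: filterS XY => w /= ->.
Qed.

Lemma sqint0 : sqint (cst 0).
Proof.
split=> //; apply: (@bounded_integrable _ _ _ _ _ 0); first exact: measurable_funX.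
by move=> w; rewrite /= expr0n normr0.
Qed.

Lemma sqintB X Y : sqint X -> sqint Y -> sqint (fun w => X w - Y w).
Proof.
move=> sX sY; rewrite (_ : (fun w => _) = fun w => -1 * Y w + X w).
  exact: sqint_lin.
by apply/funext => w; rewrite mulN1r addrC.
Qed.

Lemma L2norm_triangleB X Y : sqint X -> sqint Y ->
  L2norm P (fun w => X w - Y w) <= L2norm P X + L2norm P Y.
Proof.
move=> sX sY; rewrite -(L2normN Y); apply: L2norm_triangle => //.
rewrite (_ : (fun w => _) = fun w => 0 - Y w).
  by apply: sqintB => //; exact: sqint0.
by apply/funext => w; rewrite sub0r.
Qed.

End square_integrable.

Section gaussian_space.
Context {d : measure_display} {Omega : measurableType d} {R : realType}.
Variable P : probability Omega R.

(** A Gaussian space without L2 closure, since only projections onto finitely many elements occur.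
    Elements are plain functions, so that residuals can be formed freely; [H] may be empty, hence
    the element required to produce 0. *)
Definition gaussian_space (H : set (Omega -> R)) : Prop :=
  [/\ forall X, H X -> measurable_fun setT X,
      forall (a : R) X Y, H X -> H Y -> H (fun w => a * X w + Y w) &
      forall X, H X -> centered_gaussian P X].

Definition gspan (I : Type) (J : set I) (X : I -> {RV P >-> R}) : set (Omega -> R) :=
  [set Y | exists n (t : 'I_n -> I) (a : 'I_n -> R),
     (forall i, J (t i)) /\ Y = fun w => \sum_(i < n) a i * X (t i) w].

Lemma gspan_gaussian (I : Type) (J : set I) (X : I -> {RV P >-> R}) :
  centered_gaussian_field J X -> gaussian_space (gspan J X).
Proof.
move=> gX; split.
- move=> _ [n [t [a [Jt ->]]]].
  by apply: measurable_sum => i; exact: measurable_funM.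
- move=> c _ _ [n [t [a [Jt ->]]]] [m [s [b [Js ->]]]].
  exists (n + m)%N.
  exists (fun i => match fintype.split i with inl j => t j | inr j => s j end).
  exists (fun i => match fintype.split i with inl j => c * a j | inr j => b j end).
  split; first by move=> i; case: fintype.split.
  apply/funext => w; rewrite big_split_ord/=; congr (_ + _).
    rewrite big_distrr/=; apply: eq_bigr => i _.
    by case: (fintype.split _) (unsplitK (inl i : 'I_n + 'I_m)%type) => //= j [->]; rewrite mulrA.
  apply: eq_bigr => i _.
  by case: (fintype.split _) (unsplitK (inr i : 'I_n + 'I_m)%type) => //= j [->].
- by move=> _ [n [t [a [Jt ->]]]]; exact: gX.
Qed.

Lemma gspan_mem (I : Type) (J : set I) (X : I -> {RV P >-> R}) i :
  J i -> gspan J X (X i).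
Proof.
move=> Ji; exists 1%N, (fun=> i), (fun=> 1); split => //.
by apply/funext => w; rewrite big_ord1 mul1r.
Qed.

Variables (H : set (Omega -> R)) (gH : gaussian_space H).

Lemma gs_measurable X : H X -> measurable_fun setT X.
Proof. by case: gH => m _ _; exact: m. Qed.

Lemma gs_gaussian X : H X -> centered_gaussian P X.
Proof. by case: gH => _ _ m; exact: m. Qed.

Lemma gs_lin a X Y : H X -> H Y -> H (fun w => a * X w + Y w).
Proof. by case: gH => _ m _; exact: m. Qed.

Lemma gs_sqint X : H X -> sqint P X.
Proof.
move=> HX; split; first exact: gs_measurable.
by have [] := gaussian_law (gs_measurable HX) (gs_gaussian HX).
Qed.

Lemma gs0 X : H X -> H (cst 0).
Proof.
move=> HX; rewrite (_ : cst 0 = fun w => -1 * X w + X w); first exact: gs_lin.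
by apply/funext => w; rewrite mulN1r addNr.
Qed.

Lemma gsZ a X : H X -> H (fun w => a * X w).
Proof.
move=> HX; rewrite (_ : (fun w => _) = fun w => a * X w + cst 0 w).
  by apply: gs_lin => //; exact: gs0 HX.
by apply/funext => w; rewrite addr0.
Qed.

Lemma gsN X : H X -> H (fun w => - X w).
Proof.
move=> HX; rewrite (_ : (fun w => _) = fun w => -1 * X w); first exact: gsZ.
by apply/funext => w; rewrite mulN1r.
Qed.

Lemma gsD X Y : H X -> H Y -> H (fun w => X w + Y w).
Proof.
move=> HX HY; rewrite (_ : (fun w => _) = fun w => 1 * X w + Y w); first exact: gs_lin.
by apply/funext => w; rewrite mul1r.
Qed.

Lemma gsB X Y : H X -> H Y -> H (fun w => X w - Y w).
Proof. by move=> HX HY; apply: gsD => //; exact: gsN. Qed.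

Lemma gs_sum n (a : 'I_n -> R) (W : 'I_n -> Omega -> R) Z : H Z -> (forall i, H (W i)) ->
  H (fun w => \sum_(i < n) a i * W i w).
Proof.
elim: n a W => [|n IHn] a W HZ HW.
  rewrite (_ : (fun w => _) = cst 0); first exact: gs0 HZ.
  by apply/funext => w; rewrite big_ord0.
rewrite (_ : (fun w => _) = fun w =>
  a ord0 * W ord0 w + \sum_(i < n) a (lift ord0 i) * W (lift ord0 i) w).
  by apply: gs_lin => //; apply: IHn.
by apply/funext => w; rewrite big_ord_recl.
Qed.

Lemma measurable_comp_cos X c : H X -> measurable_fun setT (fun w => cos (X w + c)).
Proof.
move=> /gs_measurable mX; apply: (@measurableT_comp _ _ _ _ _ _ (@cos R)).
  by apply: continuous_measurable_fun; exact: continuous_cos.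
exact: measurable_funD.
Qed.

Lemma measurable_comp_sin X c : H X -> measurable_fun setT (fun w => sin (X w + c)).
Proof.
move=> /gs_measurable mX; apply: (@measurableT_comp _ _ _ _ _ _ (@sin R)).
  by apply: continuous_measurable_fun; exact: continuous_sin.
exact: measurable_funD.
Qed.

(** [X] and [- X] are centered Gaussian with the same norm, hence have the same law, and the sine is
    odd. *)
Lemma gs_integral_sin X : H X -> \int[P]_w sin (X w) = 0.
Proof.
move=> HX.
have mX := gs_measurable HX; have HN := gsN HX; have mN := gs_measurable HN.
have ms : measurable_fun setT (@sin R) by apply: continuous_measurable_fun; exact: continuous_sin.
have iS Y : measurable_fun setT Y -> P.-integrable setT (EFin \o (fun w => sin (Y w))).
  move=> mY; apply: (@bounded_integrable _ _ _ _ _ 1); first exact: measurableT_comp.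
  by move=> w; exact: sin_max.
have : \int[P]_w sin (X w) = \int[P]_w sin (- X w).
  rewrite /Rintegral; congr fine.
  have := @integral_pushforward _ _ _ _ _ _ mX P setT (EFin \o @sin R).
  rewrite preimage_setT /= => <-//; last 2 first.
  - exact/measurable_EFinP.
  - exact: iS.
  have := @integral_pushforward _ _ _ _ _ _ mN P setT (EFin \o @sin R).
  rewrite preimage_setT /= => <-//; last 2 first.
  - exact/measurable_EFinP.
  - exact: iS.
  apply: eq_measure_integral => A mA _; rewrite /pushforward.
  apply: gaussian_eq_law => //; [exact: gs_gaussian|exact: gs_gaussian|].
  by rewrite L2normN.
under [X in _ = X -> _]eq_Rintegral do rewrite sinN -mulN1r.
rewrite RintegralZl//; last exact: iS.
by rewrite mulN1r => /eqP; rewrite -addr_eq0 -mulr2n -mulr_natl mulf_eq0 pnatr_eq0/= => /eqP.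
Qed.

Lemma gs_integral_cosD X c : H X ->
  \int[P]_w cos (X w + c) = cos c * expR (- (inner P X X / 2)).
Proof.
move=> HX; have mX := gs_measurable HX.
have mc : measurable_fun setT (fun w => cos (X w)).
  by have := measurable_comp_cos 0 HX; under eq_fun do rewrite addr0.
have ms : measurable_fun setT (fun w => sin (X w)).
  by have := measurable_comp_sin 0 HX; under eq_fun do rewrite addr0.
have ic : P.-integrable setT (EFin \o (fun w => cos (X w))).
  by apply: (@bounded_integrable _ _ _ _ _ 1) => // w; exact: cos_max.
have is_ : P.-integrable setT (EFin \o (fun w => sin (X w))).
  by apply: (@bounded_integrable _ _ _ _ _ 1) => // w; exact: sin_max.
under eq_Rintegral do rewrite cosD mulrC [X in _ - X]mulrC.
rewrite RintegralB//.
- rewrite !RintegralZl// gs_integral_sin// mulr0 subr0.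
  have := gaussian_integral_cos 1 mX (gs_gaussian HX).
  under eq_Rintegral do rewrite mul1r.
  by move=> ->; rewrite expr1n mulr1 L2norm_inner.
- by have := integrableZl measurableT (cos c) ic; apply: eq_integrable.
- by have := integrableZl measurableT (sin c) is_; apply: eq_integrable.
Qed.

End gaussian_space.

(** * Independence of orthogonal Gaussian variables *)

Section gaussian_independence.
Context {d : measure_display} {Omega : measurableType d} {R : realType}.
Variable P : probability Omega R.

(** The pi-system of finite-dimensional events of [S], built one factor at a time to match the
    induction of [cos_orthogonal_cylinder]. *)
Inductive cylinder (S : set (Omega -> R)) : set Omega -> Prop :=
| cylinderT : cylinder S setT
| cylinderI W (B : set R) E : S W -> measurable B -> cylinder S E ->
    cylinder S (W @^-1` B `&` E).

(** A Fourier form of the vanishing of the conditional expectation of [g] given [S]; the free phase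
    [c] accounts for the sines. *)
Definition cos_orthogonal (S : set (Omega -> R)) (g : Omega -> R) : Prop :=
  [/\ measurable_fun setT g, exists M, forall w, `|g w| <= M &
      forall U c, S U -> \int[P]_w (g w * cos (U w + c)) = 0].

(** The product of [cos (U + c)] and [cos (t * W + c')] is a half sum of cosines of elements of [S]
    with phases. So [g * cos (U + c)] has zero Fourier transform along [W], and uniqueness replaces
    the cosine in [W] by the indicator. Iterating this avoids Fourier analysis in several
    dimensions. *)
Lemma cos_orthogonal_indic (S : set (Omega -> R)) g W (B : set R) :
  (forall X, S X -> measurable_fun setT X) ->
  (forall (a : R) X Y, S X -> S Y -> S (fun w => a * X w + Y w)) ->
  S W -> measurable B -> cos_orthogonal S g ->
  cos_orthogonal S (fun w => g w * \1_(W @^-1` B) w).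
Proof.
move=> mS linS SW mB [mg [M gM] g0].
have mW := mS _ SW.
have mWB : measurable (W @^-1` B) by rewrite -[_ @^-1` _]setTI; exact: mW.
split; first by apply: measurable_funM.
  exists M => w; rewrite normrM (le_trans _ (gM w))// ler_piMr// indicE.
  by case: (_ \in _); rewrite ?normr1 ?normr0.
move=> U c SU; have mU := mS _ SU.
have mcos (Y : Omega -> R) : measurable_fun setT Y -> measurable_fun setT (fun w => cos (Y w)).
  move=> mY; apply: (@measurableT_comp _ _ _ _ _ _ (@cos R)) => //.
  by apply: continuous_measurable_fun; exact: continuous_cos.
pose g' w := g w * cos (U w + c).
have mg' : measurable_fun setT g'.
  by apply: measurable_funM => //; apply: mcos; exact: measurable_funD.
have g'M w : `|g' w| <= M.
  by rewrite normrM (le_trans _ (gM w))// ler_piMr//; exact: cos_max.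
have icos (Y : Omega -> R) : measurable_fun setT Y ->
    P.-integrable setT (EFin \o (fun w => g w * cos (Y w))).
  move=> mY; apply: (@bounded_integrable _ _ _ _ _ M).
    by apply: measurable_funM => //; exact: mcos.
  by move=> w; rewrite normrM (le_trans _ (gM w))// ler_piMr//; exact: cos_max.
have four t c' : \int[P]_w (g' w * cos (t * W w + c')) = 0.
  transitivity (2^-1 * (\int[P]_w (g w * cos ((t * W w + U w) + (c + c'))) +
      \int[P]_w (g w * cos (((- t) * W w + U w) + (c - c'))))); last first.
    by rewrite !g0 ?addr0 ?mulr0//; exact: linS.
  have m1 (s e : R) : measurable_fun setT (fun w => s * W w + U w + e).
    apply: measurable_funD => //; apply: measurable_funD => //.
    exact: measurable_funM.
  rewrite -RintegralD//; [|exact: icos|exact: icos].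
  rewrite -RintegralZl//; last first.
    by have := integrableD measurableT (icos _ (m1 t (c + c'))) (icos _ (m1 (- t) (c - c')));
      apply: eq_integrable.
  apply: eq_Rintegral => w _; rewrite /g' -mulrDr -mulrA.
  rewrite (_ : t * W w + U w + (c + c') = (U w + c) + (t * W w + c')); last by ring.
  rewrite (_ : - t * W w + U w + (c - c') = (U w + c) - (t * W w + c')); last by ring.
  by rewrite (cosB (U w + c)) (cosD (U w + c) (t * W w + c')); field.
have h := @fourier0_preimage _ _ _ P g' W M mg' mW g'M four B mB.
transitivity (fine (\int[P]_(w in W @^-1` B) (g' w)%:E)%E); last by rewrite h.
rewrite /Rintegral; congr fine; rewrite [RHS]integral_mkcond; apply: eq_integral => w _.
rewrite patchE indicE /g'; case: ifP => _; rewrite ?mulr1 ?mulr0 ?mul0r//.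
Qed.

Lemma cos_orthogonal_cylinder (S : set (Omega -> R)) g E :
  (forall X, S X -> measurable_fun setT X) ->
  (forall (a : R) X Y, S X -> S Y -> S (fun w => a * X w + Y w)) ->
  cylinder S E -> cos_orthogonal S g ->
  cos_orthogonal S (fun w => g w * \1_E w).
Proof.
move=> mS linS cE; elim: cE g => [|W B {}E SW mB cE IH] g gS.
  rewrite (_ : (fun w => _) = g)//.
  by apply/funext => w; rewrite indicE in_setT mulr1.
rewrite (_ : (fun w => _) = fun w => g w * \1_(W @^-1` B) w * \1_E w).
  by apply: IH; exact: cos_orthogonal_indic.
by apply/funext => w; rewrite indicI /= mulrA.
Qed.

Lemma measurable_cylinder (S : set (Omega -> R)) E :
  (forall X, S X -> measurable_fun setT X) -> cylinder S E -> measurable E.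
Proof.
move=> mS; elim => // W B {}E SW mB _ mE; apply: measurableI => //.
by rewrite -[_ @^-1` _]setTI; exact: (mS _ SW).
Qed.

Lemma cylinder_setI (S : set (Omega -> R)) E F :
  cylinder S E -> cylinder S F -> cylinder S (E `&` F).
Proof.
move=> cE cF; elim: cE => [|W B {}E SW mB _ IH]; first by rewrite setTI.
by rewrite -setIA; exact: cylinderI.
Qed.

Variables (H : set (Omega -> R)) (gH : gaussian_space P H).
Variables (xi : Omega -> R) (Hxi : H xi).

Let S : set (Omega -> R) := [set X | H X /\ inner P xi X = 0].

Let mS X : S X -> measurable_fun setT X.
Proof. by case=> HX _; exact: (gs_measurable gH HX). Qed.

Let linS (a : R) X Y : S X -> S Y -> S (fun w => a * X w + Y w).
Proof.
move=> [HX X0] [HY Y0]; split; first exact: (gs_lin gH).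
have sX := gs_sqint gH HX; have sY := gs_sqint gH HY; have sxi := gs_sqint gH Hxi.
by rewrite innerC inner_lin// innerC X0 innerC Y0 mulr0 addr0.
Qed.

Let S0 : S (cst 0).
Proof.
split; first exact: (gs0 gH Hxi).
by rewrite /inner; under eq_Rintegral do rewrite mulr0; rewrite Rintegral_cst1.
Qed.

Let normE (t : R) U : S U ->
  inner P (fun w => t * xi w + U w) (fun w => t * xi w + U w) =
  t ^+ 2 * inner P xi xi + inner P U U.
Proof.
move=> [HU U0]; have sxi := gs_sqint gH Hxi; have sU := gs_sqint gH HU.
by rewrite inner_sqr_lin// U0 mulr0 addr0.
Qed.

Let icos (Y : Omega -> R) : measurable_fun setT Y ->
  P.-integrable setT (EFin \o (fun w => cos (Y w))).
Proof.
move=> mY; apply: (@bounded_integrable _ _ _ _ _ 1).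
  apply: (@measurableT_comp _ _ _ _ _ _ (@cos R)) => //.
  by apply: continuous_measurable_fun; exact: continuous_cos.
by move=> w; exact: cos_max.
Qed.

Let mlin (t c : R) U : H U -> measurable_fun setT (fun w => t * xi w + U w + c).
Proof. by move=> HU; apply: measurable_funD => //; exact: (gs_measurable gH (gs_lin gH t Hxi HU)). Qed.

(** Expanding the product of cosines leaves characteristic functions of [t * xi + U] and
    [- t * xi + U]; by orthogonality the squared norms add, so both factor as the subtracted mean
    times that of [U]. *)
Let cos_orthogonal_cos (t : R) :
  cos_orthogonal S (fun w => cos (t * xi w) - expR (- (t ^+ 2 * inner P xi xi / 2))).
Proof.
set e := expR _.
have mc : measurable_fun setT (fun w => cos (t * xi w)).
  by have := measurable_comp_cos gH 0 (gsZ gH t Hxi); under eq_fun do rewrite addr0.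
split.
- exact: measurable_funB.
- exists (1 + e) => w; rewrite (le_trans (ler_normB _ _))// lerD ?cos_max//.
  by rewrite ger0_norm// expR_ge0.
- move=> U c SU; have [HU U0] := SU.
  transitivity (2^-1 * (\int[P]_w cos ((t * xi w + U w) + c) +
      \int[P]_w cos (((- t) * xi w + U w) + c)) - e * \int[P]_w cos (U w + c)).
    rewrite -RintegralD//; [|exact/icos/mlin|exact/icos/mlin].
    have i2 := integrableD measurableT (icos (mlin t c HU)) (icos (mlin (- t) c HU)).
    have mUc : measurable_fun setT (fun w => U w + c).
      by apply: measurable_funD => //; exact: (gs_measurable gH HU).
    rewrite -!RintegralZl//; last exact: icos.
    rewrite -RintegralB//; last 2 first.
    + by have := integrableZl measurableT 2^-1 i2; apply: eq_integrable.
    + by have := integrableZl measurableT e (icos mUc); apply: eq_integrable.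
    apply: eq_Rintegral => w _.
    rewrite (_ : t * xi w + U w + c = (U w + c) + t * xi w); last by ring.
    rewrite (_ : - t * xi w + U w + c = (U w + c) - t * xi w); last by ring.
    by rewrite (cosB (U w + c)) (cosD (U w + c) (t * xi w)); field.
  rewrite !(gs_integral_cosD gH)//; [|exact: (gs_lin gH)|exact: (gs_lin gH)].
  rewrite !normE// sqrrN.
  rewrite (_ : - ((_ + _) / 2) = - (t ^+ 2 * inner P xi xi / 2) + - (inner P U U / 2)); last by field.
  by rewrite expRD -/e; field.
Qed.

Let cos_orthogonal_sin (t : R) : cos_orthogonal S (fun w => sin (t * xi w)).
Proof.
have ms : measurable_fun setT (fun w => sin (t * xi w)).
  by have := measurable_comp_sin gH 0 (gsZ gH t Hxi); under eq_fun do rewrite addr0.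
split => //; first by exists 1 => w; exact: sin_max.
move=> U c SU; have [HU U0] := SU.
(* A phase shift by [- pi / 2] writes sines as cosines; the two integrals are equal because the norm
   is even in [t]. *)
transitivity (2^-1 * (\int[P]_w cos ((t * xi w + U w) + (c - pi / 2)) -
    \int[P]_w cos (((- t) * xi w + U w) + (c - pi / 2)))).
  rewrite -RintegralB//; [|exact/icos/mlin|exact/icos/mlin].
  have i2 := integrableB measurableT (icos (mlin t (c - pi / 2) HU)) (icos (mlin (- t) (c - pi / 2) HU)).
  rewrite -RintegralZl//.
  apply: eq_Rintegral => w _.
  rewrite (_ : t * xi w + U w + (c - pi / 2) = ((U w + c) + t * xi w) - pi / 2); last by ring.
  rewrite (_ : - t * xi w + U w + (c - pi / 2) = ((U w + c) - t * xi w) - pi / 2); last by ring.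
  by rewrite !(cosB _ (pi / 2)) cos_pihalf sin_pihalf (sinB (U w + c)) (sinD (U w + c) (t * xi w)); field.
rewrite !(gs_integral_cosD gH)//; [|exact: (gs_lin gH)|exact: (gs_lin gH)].
by rewrite !normE// sqrrN subrr mulr0.
Qed.

(** Cosine and sine of [t * xi], once centered, stay orthogonal after multiplication by the
    indicator of [E]. Conversely, the centered indicator of [E] then has zero Fourier transform
    along [xi], and a second use of uniqueness gives independence from the events of [xi]. *)
Lemma gaussian_cylinder_indep E (A : set R) : cylinder S E -> measurable A ->
  P (xi @^-1` A `&` E) = (P (xi @^-1` A) * P E)%E.
Proof.
move=> cE mA; have mE := measurable_cylinder mS cE.
have mxi := gs_measurable gH Hxi.
pose p := fine (P E).
pose g w : R := \1_E w - p.
have mg : measurable_fun setT g by apply: measurable_funB.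
have p0 : 0 <= p by exact: fine_ge0.
have gM w : `|g w| <= 1 + p.
  rewrite (le_trans (ler_normB _ _))// lerD ?(ger0_norm p0)// indicE.
  by case: (_ \in _); rewrite ?normr1 ?normr0.
have iE : P.-integrable setT (EFin \o (\1_E : Omega -> R)) by exact: integrable_indic.
have mc (t : R) : measurable_fun setT (fun w => cos (t * xi w)).
  by have := measurable_comp_cos gH 0 (gsZ gH t Hxi); under eq_fun do rewrite addr0.
have ms (t : R) : measurable_fun setT (fun w => sin (t * xi w)).
  by have := measurable_comp_sin gH 0 (gsZ gH t Hxi); under eq_fun do rewrite addr0.
have four t c : \int[P]_w (g w * cos (t * xi w + c)) = 0.
  set e := expR (- (t ^+ 2 * inner P xi xi / 2)).
  have e1 : \int[P]_w (cos (t * xi w) * \1_E w) = e * p.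
    have [_ _ h] := cos_orthogonal_cylinder mS linS cE (cos_orthogonal_cos t).
    have := h (cst 0) 0 S0; under eq_Rintegral do rewrite addr0 cos0 mulr1 mulrBl.
    rewrite RintegralB//; last 2 first.
    + apply: (@bounded_integrable _ _ _ _ _ 1); first exact: measurable_funM.
      move=> w; rewrite normrM indicE; case: (_ \in _); rewrite ?normr1 ?normr0 ?mulr1 ?mulr0//.
      exact: cos_max.
    + by have := integrableZl measurableT e iE; apply: eq_integrable.
    by rewrite RintegralZl// Rintegral_indic// => /eqP; rewrite subr_eq0 => /eqP.
  have e2 : \int[P]_w (sin (t * xi w) * \1_E w) = 0.
    have [_ _ h] := cos_orthogonal_cylinder mS linS cE (cos_orthogonal_sin t).
    by have := h (cst 0) 0 S0; under eq_Rintegral do rewrite addr0 cos0 mulr1.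
  have e3 : \int[P]_w cos (t * xi w + c) = cos c * e.
    rewrite (gs_integral_cosD gH _ (gsZ gH t Hxi)); congr (_ * expR (- (_ / 2))).
    by rewrite -!L2norm_inner L2normZ ?exprMn ?real_normK ?num_real//; exact: (gs_sqint gH Hxi).
  have iA (Y : Omega -> R) : measurable_fun setT Y -> (forall w, `|Y w| <= 1) ->
      P.-integrable setT (EFin \o (fun w => Y w * \1_E w)).
    move=> mY Y1; apply: (@bounded_integrable _ _ _ _ _ 1); first exact: measurable_funM.
    move=> w; rewrite normrM indicE; case: (_ \in _); rewrite ?normr1 ?normr0 ?mulr1 ?mulr0//.
  have i1 := iA _ (mc t) (fun w => cos_max _).
  have i2 := iA _ (ms t) (fun w => sin_max _).
  have i1' := integrableZl measurableT (cos c) i1.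
  have i2' := integrableZl measurableT (sin c) i2.
  have i12 := integrableB measurableT i1' i2'.
  have mcc : measurable_fun setT (fun w => t * xi w + c).
    by apply: measurable_funD => //; exact: measurable_funM.
  have i3 := integrableZl measurableT p (icos mcc).
  transitivity (cos c * \int[P]_w (cos (t * xi w) * \1_E w) -
    sin c * \int[P]_w (sin (t * xi w) * \1_E w) - p * \int[P]_w cos (t * xi w + c)).
    rewrite -!RintegralZl//; last exact: icos.
    rewrite -RintegralB//.
    rewrite -RintegralB//.
    by apply: eq_Rintegral => w _; rewrite /g cosD; ring.
  by rewrite e1 e2 e3; ring.
have := @fourier0_preimage _ _ _ P g xi (1 + p) mg mxi gM four A mA.
have mxA : measurable (xi @^-1` A) by rewrite -[_ @^-1` _]setTI; exact: mxi.
rewrite /g; under eq_integral do rewrite EFinB.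
rewrite integralB//; last 2 first.
- exact: integrableS iE.
- by apply: finite_measure_integrable_cst.
rewrite integral_indic// integral_cst// => /eqP.
rewrite sube_eq ?add0e//.
- by rewrite setIC muleC /p fineK ?fin_num_measure// => /eqP.
- by rewrite fin_num_measure//; exact: measurableI.
Qed.

End gaussian_independence.

(** * Small balls *)

Section projection.
Context {d : measure_display} {Omega : measurableType d} {R : realType}.
Variable P : probability Omega R.
Variables (H : set (Omega -> R)) (gH : gaussian_space P H).

Lemma inner_suml n (a : 'I_n -> R) (W : 'I_n -> Omega -> R) Z : H Z -> (forall i, H (W i)) ->
  inner P (fun w => \sum_(i < n) a i * W i w) Z = \sum_(i < n) a i * inner P (W i) Z.
Proof.
move=> HZ; elim: n a W => [|n IHn] a W HW.
  rewrite big_ord0 /inner; under eq_Rintegral do rewrite big_ord0 mul0r.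
  exact: Rintegral_cst1.
rewrite big_ord_recl -IHn; last by move=> i.
rewrite -inner_lin.
- by congr inner; apply/funext => w; rewrite big_ord_recl.
- exact: (gs_sqint gH).
- by apply: (gs_sqint gH); apply: (gs_sum gH _ HZ).
- exact: (gs_sqint gH).
Qed.

(** The normal equations are solvable even for a singular Gram matrix: a column of its cokernel
    gives a combination [U] of norm 0, and then [inner P X U = 0] by the Cauchy-Schwarz
    inequality. *)
Lemma gs_projection n (W : 'I_n -> Omega -> R) X : H X -> (forall i, H (W i)) ->
  exists a : 'I_n -> R, forall j,
    inner P (fun w => X w - \sum_(i < n) a i * W i w) (W j) = 0.
Proof.
move=> HX HW.
pose G : 'M[R]_n := \matrix_(i, j) inner P (W i) (W j).
pose b : 'rV[R]_n := \row_j inner P X (W j).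
have : (b <= G)%MS.
  rewrite submxE; apply/eqP/rowP => j; rewrite !mxE.
  set C := cokermx G.
  pose U w := \sum_(i < n) C i j * W i w.
  have HU : H U by apply: (gs_sum gH _ HX).
  have UW i : inner P (W i) U = 0.
    have /matrixP/(_ i j) : G *m C = 0 by exact: mulmx_coker.
    rewrite !mxE => <-; rewrite innerC inner_suml//; apply: eq_bigr => l _.
    by rewrite [G i l]mxE mulrC innerC.
  have U0 : inner P U U = 0.
    by rewrite inner_suml// big1// => i _; rewrite UW mulr0.
  have XU : inner P X U = 0.
    have := cauchy_schwarz (gs_sqint gH HX) (gs_sqint gH HU).
    rewrite U0 mulr0 => h; apply/eqP; rewrite -sqrf_eq0 eq_le h/=.
    exact: sqr_ge0.
  rewrite -[RHS]XU innerC inner_suml//; apply: eq_bigr => i _.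
  by rewrite [b 0 i]mxE mulrC innerC.
move=> /submxP[D bD]; exists (fun i => D 0 i) => j.
have HS : H (fun w => \sum_(i < n) D 0 i * W i w) by apply: (gs_sum gH _ HX).
rewrite (_ : (fun w => _) = fun w => -1 * (\sum_(i < n) D 0 i * W i w) + X w); last first.
  by apply/funext => w; rewrite mulN1r addrC.
rewrite inner_lin; [|exact: (gs_sqint gH)|exact: (gs_sqint gH)|exact: (gs_sqint gH)].
rewrite inner_suml//.
have /rowP/(_ j) := bD; rewrite !mxE => ->.
rewrite mulN1r addrC; apply/eqP; rewrite subr_eq0; apply/eqP.
by apply: eq_bigr => i _; rewrite mxE.
Qed.

Variables (X : nat -> Omega -> R) (HX : forall i, H (X i)).
Variables (sigma theta : R) (sigma0 : 0 < sigma) (theta0 : 0 <= theta).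
Variable N : nat.
Hypothesis residual : forall i (a : 'I_i -> R), (i < N)%N ->
  sigma <= L2norm P (fun w => X i w - \sum_(j < i) a j * X j w).

Let B n := [set w | forall i, (i < n)%N -> `|X i w| <= theta].

(** Lower bound for one one-sided tail beyond [theta] of a Gaussian variable of norm at least
    [sigma]. *)
Let p := normal_peak 1 * expR (- (theta / sigma + 1) ^+ 2 / 2).

Let Bcyl (S : set (Omega -> R)) n : (forall j, (j < n)%N -> S (X j)) -> cylinder S (B n).
Proof.
elim: n => [|n IHn] SX.
  rewrite (_ : B 0 = setT); first exact: cylinderT.
  by apply/seteqP; split.
rewrite (_ : B n.+1 = X n @^-1` [set x | `|x| <= theta] `&` B n).
  apply: cylinderI; [exact: SX| |by apply: IHn => j jn; apply: SX; rewrite ltnW].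
  rewrite -[Y in measurable Y]setTI; exact: measurable_fun_ler.
apply/seteqP; split => w /=.
  by move=> h; split; [exact: h|move=> i iN; apply: h; rewrite ltnW].
by move=> [h1 h2] i; rewrite ltnS leq_eqVlt => /predU1P[->//|]; exact: h2.
Qed.

Let mX i : measurable_fun setT (X i). Proof. exact: (gs_measurable gH). Qed.

Let mB n : measurable (B n).
Proof.
apply: (@measurable_cylinder _ _ _ H); first by move=> Y; exact: (gs_measurable gH).
by apply: Bcyl => j _; exact: HX.
Qed.

Let p_ge0 : 0 <= p. Proof. by rewrite mulr_ge0 ?normal_peak_ge0 ?expR_ge0. Qed.

Let tail Y : H Y -> sigma <= L2norm P Y ->
  p <= fine (P [set w | theta < Y w]).
Proof.
move=> HY sY; have Y0 : 0 < L2norm P Y by exact: lt_le_trans sY.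
have mY := gs_measurable gH HY.
have mYt : measurable [set w | theta < Y w].
  by rewrite -[Z in measurable Z]setTI; exact: measurable_fun_ltr.
rewrite -lee_fin fineK ?fin_num_measure//.
apply: le_trans (gaussian_lower mY (gs_gaussian gH HY) Y0 theta0).
rewrite lee_fin ler_wpM2l ?normal_peak_ge0// ler_expR !mulNr lerN2 ler_pM2r//.
rewrite lerXn2r ?nnegrE ?addr_ge0 ?divr_ge0 ?(ltW sigma0) ?(ltW Y0)//.
by rewrite lerD2r ler_wpM2l// lef_pV2.
Qed.

(** Write [X n = xi + Y], with [Y] the projection on the past and [xi] independent of it. Where
    [Y >= 0], the event [xi > theta] pushes [X n] out of the ball; where [Y < 0], the event
    [xi < - theta] does. Splitting by the sign of [Y] removes a fraction at least [p] of each half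
    without conditional laws. *)
Let small_ball_step n : (n < N)%N ->
  fine (P (B n.+1)) <= (1 - p) * fine (P (B n)).
Proof.
move=> nN.
have [a proj] := gs_projection (HX n) (fun i : 'I_n => HX i).
pose Y w := \sum_(i < n) a i * X i w.
pose xi w := X n w - Y w.
have HY : H Y by apply: (gs_sum gH _ (HX 0)) => i; exact: HX.
have Hxi : H xi by exact: (gsB gH).
pose S := [set Z | H Z /\ inner P xi Z = 0].
have SX j : (j < n)%N -> S (X j).
  by move=> jn; split; [exact: HX|exact: (proj (Ordinal jn))].
have SY : S Y.
  split => //; rewrite innerC inner_suml// big1// => i _.
  by rewrite innerC (proj i) mulr0.
have cB := Bcyl SX.
have mxi := gs_measurable gH Hxi; have mY := gs_measurable gH HY.
pose A1 : set R := [set x | theta < x].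
pose A2 : set R := [set x | x < - theta].
pose C1 : set R := [set y | 0 <= y].
pose C2 : set R := [set y | y < 0].
have mA1 : measurable A1 by rewrite -[Z in measurable Z]setTI; exact: measurable_fun_ltr.
have mA2 : measurable A2 by rewrite -[Z in measurable Z]setTI; exact: measurable_fun_ltr.
have mC1 : measurable C1 by rewrite -[Z in measurable Z]setTI; exact: measurable_fun_ler.
have mC2 : measurable C2 by rewrite -[Z in measurable Z]setTI; exact: measurable_fun_ltr.
have c1 := cylinderI SY mC1 cB; have c2 := cylinderI SY mC2 cB.
have i1 := gaussian_cylinder_indep gH Hxi c1 mA1.
have i2 := gaussian_cylinder_indep gH Hxi c2 mA2.
have mE (Z : Omega -> R) (D : set R) : measurable_fun setT Z -> measurable D ->
    measurable (Z @^-1` D).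
  by move=> mZ mD; rewrite -[_ @^-1` _]setTI; exact: mZ.
have m1 := measurableI _ _ (mE _ _ mY mC1) (mB n).
have m2 := measurableI _ _ (mE _ _ mY mC2) (mB n).
have mF1 := measurableI _ _ (mE _ _ mxi mA1) m1.
have mF2 := measurableI _ _ (mE _ _ mxi mA2) m2.
have q1 : p <= fine (P (xi @^-1` A1)) by apply: tail => //; exact: residual.
have q2 : p <= fine (P (xi @^-1` A2)).
  rewrite (_ : xi @^-1` A2 = [set w | theta < - xi w]); last first.
    by apply/seteqP; split => w /=; rewrite /A2/= ltrNr.
  by apply: tail; [exact: (gsN gH)|rewrite L2normN; exact: residual].
have finP (E : set Omega) : measurable E -> P E \is a fin_num by move=> mE'; rewrite fin_num_measure.
set F1 := _ `&` (_ `&` B n) in i1 mF1; set F2 := _ `&` (_ `&` B n) in i2 mF2.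
have F12 : F1 `&` F2 = set0.
  by apply/seteqP; split => // w [[_ [/= h1 _]] [_ [/= h2 _]]]; move: h1 h2; rewrite /C1 /C2/= ltNge => ->.
have BF : B n.+1 `&` (F1 `|` F2) = set0.
  apply/seteqP; split => // w [hB hF].
  have := hB n (ltnSn n); rewrite (_ : X n w = xi w + Y w); last by rewrite /xi subrK.
  rewrite ler_norml => /andP[l1 l2].
  case: hF => [[]|[]]; rewrite /A1 /A2 /C1 /C2/= => h1 [h2 _]; lra.
have sub : B n.+1 `|` (F1 `|` F2) `<=` B n.
  move=> w [hB|[[_ [_ //]]|[_ [_ //]]]] i iN; apply: hB; exact: ltnW.
have eB : fine (P (B n)) = fine (P (Y @^-1` C1 `&` B n)) + fine (P (Y @^-1` C2 `&` B n)).
  rewrite -fineD ?finP// -measureU//; last first.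
    by apply/seteqP; split => // w [[/= h1 _] [/= h2 _]]; move: h1 h2; rewrite /C1 /C2/= ltNge => ->.
  congr (fine (P _)); apply/seteqP; split => w /=; last by case=> [[_]|[_]].
  by move=> hB; have [y0|y0] := leP 0 (Y w); [left|right].
have : fine (P (B n.+1)) + (fine (P F1) + fine (P F2)) <= fine (P (B n)).
  rewrite -fineD ?finP// -measureU// -fineD ?finP//; last exact: measurableU.
  rewrite -measureU//; last exact: measurableU.
  apply: fine_le; rewrite ?finP//; first by apply: measurableU => //; exact: measurableU.
  rewrite le_measure ?inE//; apply: measurableU => //; exact: measurableU.
rewrite i1 i2 !fineM ?finP//; [|exact: mE|exact: mE].
set x1 := fine (P (xi @^-1` A1)) in q1 *; set x2 := fine (P (xi @^-1` A2)) in q2 *.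
set y1 := fine (P (Y @^-1` C1 `&` B n)) in eB *; set y2 := fine (P (Y @^-1` C2 `&` B n)) in eB *.
have : 0 <= y1 by exact: fine_ge0.
have : 0 <= y2 by exact: fine_ge0.
rewrite eB; nra.
Qed.

(** Each variable multiplies the probability by at most [1 - p], which is at most [expR (- p)]. *)
Lemma gaussian_small_ball :
  fine (P [set w | forall i, (i < N)%N -> `|X i w| <= theta]) <=
  expR (- (N%:R * (normal_peak 1 * expR (- (theta / sigma + 1) ^+ 2 / 2)))).
Proof.
have mN : forall n, (n <= N)%N -> fine (P (B n)) <= expR (- (n%:R * p)).
  elim=> [_|n IHn nN].
    rewrite mul0r oppr0 expR0 -lee_fin fineK ?fin_num_measure//.
    exact: probability_le1.
  apply: (le_trans (small_ball_step nN)).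
  have h := IHn (ltnW nN).
  rewrite (_ : - (n.+1%:R * p) = - (n%:R * p) + - p); last by rewrite -addn1 natrD; ring.
  rewrite expRD mulrC.
  apply: (@le_trans _ _ (fine (P (B n)) * expR (- p))).
    by rewrite ler_wpM2l ?fine_ge0// -[1 - p]/(1 + - p) expR_ge1Dx.
  by rewrite ler_wpM2r ?expR_ge0.
exact: mN.
Qed.

End projection.

(** * Conditional variance and linear residuals *)

Section conditional_variance.
Context {d : measure_display} {Omega : measurableType d} {R : realType}.
Variable P : probability Omega R.

Import HBNNSimple.

(* Orthogonality passes from indicators to functions through simple functions of [U]. *)
Lemma orthogonal_ge0_comp (D U : Omega -> R) (f : R -> R) : sqint P D -> sqint P U ->
  measurable_fun setT f -> (forall x, 0 <= f x <= `|x|) ->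
  (forall B : set R, measurable B -> (\int[P]_(w in U @^-1` B) (D w)%:E = 0)%E) ->
  \int[P]_w (D w * f (U w)) = 0.
Proof.
move=> sD sU mf f0 DU.
have [mD _] := sD; have [mU _] := sU.
have iD := sqint_integrable sD.
have mfE : measurable_fun setT (EFin \o f) by exact/measurable_EFinP.
pose h := nnsfun_approx measurableT mfE.
have hf x : h n x @[n --> \oo] --> f x.
  have f0' y : setT y -> (0%R <= (EFin \o f) y)%E.
    by move=> _; rewrite lee_fin; case/andP: (f0 y).
  by have /fine_cvgP[_ +] := cvg_nnsfun_approx measurableT mfE f0' (I : setT x).
have hle n x : h n x <= f x.
  rewrite -(cvg_lim (@Rhausdorff R) (hf x)).
  apply: nondecreasing_cvgn_le; last by apply/cvg_ex; exists (f x); exact: hf.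
  by move=> i j ij; apply/lefP; exact: nd_nnsfun_approx.
have mUB (B : set R) : measurable B -> measurable (U @^-1` B).
  by move=> mB; rewrite -[_ @^-1` _]setTI; exact: mU.
have mhU n : measurable_fun setT (fun w => h n (U w)).
  by apply: (@measurableT_comp _ _ _ _ _ _ (h n)).
have h0 n : (\int[P]_w (D w * h n (U w))%:E = 0)%E.
  under eq_integral do rewrite fimfunE fsbig_finite//= mulr_sumr -sumEFin.
  have iB r : P.-integrable setT
      (fun w => (D w)%:E * (\1_(U @^-1` (h n @^-1` [set r])) w)%:E)%E.
    apply: (@le_integrable _ _ _ P setT measurableT _ (EFin \o D)) => //.
    + apply: emeasurable_funM; first exact/measurable_EFinP.
      by apply/measurable_EFinP; apply: measurable_indic; exact: mUB.
    + move=> w _; rewrite lee_fin normrM ler_piMr// indicE.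
      by case: (_ \in _); rewrite ?normr1 ?normr0.
  have iterm r : P.-integrable setT (fun w => (D w * (r * \1_(h n @^-1` [set r]) (U w)))%:E).
    have := integrableZl measurableT r (iB r); apply: eq_integrable => // w _.
    by rewrite -!EFinM mulrCA.
  rewrite integral_sum//.
  rewrite big1// => r _.
  transitivity (\int[P]_w (r%:E * ((D w)%:E * (\1_(U @^-1` (h n @^-1` [set r])) w)%:E)))%E.
    by apply: eq_integral => w _; rewrite -!EFinM mulrCA.
  rewrite integralZl//.
  rewrite (_ : \int[P]_w _ = \int[P]_(w in U @^-1` (h n @^-1` [set r])) (D w)%:E)%E.
    by rewrite DU ?mule0//.
  rewrite [RHS]integral_mkcond; apply: eq_integral => w _.
  by rewrite patchE indicE; case: ifP => _; rewrite ?mule1 ?mule0.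
have [] := @dominated_convergence _ _ _ P setT measurableT
   (fun n w => (D w * h n (U w))%:E) (fun w => (D w * f (U w))%:E)
   (fun w => (`|D w * U w|)%:E).
- by move=> n; apply/measurable_EFinP; exact: measurable_funM.
- by apply/measurable_EFinP; apply: measurable_funM => //; exact: measurableT_comp.
- apply/aeW => w _; apply: cvg_EFin; first exact: nearW.
  by apply: cvgM; [exact: cvg_cst|exact: hf].
- exact: (integrable_norm (sqint_integrableM sD sU)).
- apply/aeW => w n _; rewrite lee_fin !normrM ler_wpM2l//.
  by rewrite ger0_norm// (le_trans (hle _ _))//; case/andP: (f0 (U w)).
move=> _ _ /cvg_lim; under eq_fun do rewrite h0.
by rewrite lim_cst// /Rintegral => <-.
Qed.

Lemma sqint_sum n (a : 'I_n -> R) (W : 'I_n -> Omega -> R) :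
  (forall i, sqint P (W i)) -> sqint P (fun w => \sum_(i < n) a i * W i w).
Proof.
elim: n a W => [|n IHn] a W sW.
  rewrite (_ : (fun w => _) = cst 0); first exact: sqint0.
  by apply/funext => w; rewrite big_ord0.
rewrite (_ : (fun w => _) = fun w =>
  a ord0 * W ord0 w + \sum_(i < n) a (lift ord0 i) * W (lift ord0 i) w).
  by apply: sqint_lin => //; apply: IHn.
by apply/funext => w; rewrite big_ord_recl.
Qed.

Lemma orthogonal_measurable (D U : Omega -> R) : sqint P D -> sqint P U ->
  (forall B : set R, measurable B -> (\int[P]_(w in U @^-1` B) (D w)%:E = 0)%E) ->
  inner P D U = 0.
Proof.
move=> sD sU DU.
have mp : measurable_fun setT (fun x : R => Num.max x 0) by exact: measurable_maxr.
have mn : measurable_fun setT (fun x : R => Num.max (- x) 0) by apply: measurable_maxr => //; exact: measurableT_comp.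
have bp (x : R) : 0 <= Num.max x 0 <= `|x|.
  by rewrite le_max lexx orbT ge_max ler_norm normr_ge0.
have bn (x : R) : 0 <= Num.max (- x) 0 <= `|x|.
  by rewrite -(normrN x); exact: bp.
have hp := orthogonal_ge0_comp sD sU mp bp DU.
have hn := orthogonal_ge0_comp sD sU mn bn DU.
have sc (f : R -> R) : measurable_fun setT f -> (forall x, 0 <= f x <= `|x|) -> sqint P (fun w => f (U w)).
  case: sU => mU iU mf bf; split; first exact: measurableT_comp.
  apply: (@le_integrable _ _ _ P setT measurableT _ (EFin \o (fun w => U w ^+ 2))) => //.
    by apply/measurable_EFinP; apply: measurable_funX; exact: measurableT_comp.
  move=> w _; rewrite lee_fin !normrX; have /andP[f0 fx] := bf (U w).
  by rewrite lerXn2r// ger0_norm.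
transitivity (\int[P]_w (D w * Num.max (U w) 0) - \int[P]_w (D w * Num.max (- U w) 0)).
  2: by rewrite hp hn subrr.
rewrite -RintegralB//.
- apply: eq_Rintegral => w _; rewrite -mulrBr; congr (_ * _).
  have [u0|u0] := leP (U w) 0.
    by rewrite max_l ?oppr_ge0// sub0r opprK.
  by rewrite max_r ?oppr_le0 ?(ltW u0)// subr0.
- exact: (sqint_integrableM sD (sc _ mp bp)).
- exact: (sqint_integrableM sD (sc _ mn bn)).
Qed.

(** Pythagoras: [X - Y] is the sum of [X - Z] and [Z - Y], the latter measurable for the
    conditioning sigma-algebra and hence orthogonal to the former. The squared norm of [X - Z] is
    the integral of [V]. In this linear form assumption B can be combined with Gaussian
    projections. *)
Lemma conditional_variance_le (n : nat) (W : 'I_n -> {RV P >-> R}) (X : {RV P >-> R})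
    (V : Omega -> R) (c : R) (a : 'I_n -> R) :
  sqint P X -> (forall i, sqint P (W i)) ->
  is_cond_variance P (sigma_gen setT (fun i => W i : Omega -> R)) X V ->
  {ae P, forall w, c <= V w} ->
  c <= inner P (fun w => X w - \sum_(i < n) a i * W i w)
               (fun w => X w - \sum_(i < n) a i * W i w).
Proof.
move=> sX sW [Z [Zmeas iZ ZE] [_ iV VE]] cV.
pose GG := \bigcup_(i in [set: 'I_n]) preimage_set_system setT (W i : Omega -> R) measurable.
pose TG : measurableType _ := g_sigma_algebraType GG.
have sub A : <<s GG >> A -> measurable A.
  apply: smallest_sub; first exact: sigma_algebra_measurable.
  by move=> _ [i _ [B mB <-]]; exact: (measurable_funPT (W i)).
have ZG : measurable_fun setT (Z : TG -> R) by move=> _ B mB; rewrite setTI; exact: Zmeas.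
have mZ : measurable_fun setT Z.
  by move=> _ B mB; rewrite setTI; apply: sub; exact: Zmeas.
have [mX _] := sX.
pose D w := X w - Z w.
(* The integral of the square of [D] over the whole space equals that of the integrable [V], hence
   is finite. *)
have sD : sqint P D.
  have mD := measurable_funB mX mZ.
  split => //; apply/integrableP; split.
    by apply/measurable_EFinP; exact: measurable_funX.
  have GT : <<s GG >> setT by exact: (@measurableT _ TG).
  under eq_integral do rewrite /= ger0_norm ?sqr_ge0//.
  by rewrite -VE// ltey_eq integrable_fin_num.
have sZ : sqint P Z.
  rewrite (_ : Z = fun w => X w - D w); first exact: sqintB.
  by apply/funext => w; rewrite /D subKr.
pose Y w := \sum_(i < n) a i * W i w.
have YG : measurable_fun setT (Y : TG -> R).
  apply: measurable_sum => i; apply: measurable_funM => //.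
  move=> _ B mB; rewrite setTI. apply: sub_sigma_algebra.
  by exists i => //; exists B => //; rewrite setTI.
have sY : sqint P Y.
  exact: sqint_sum.
have sU := sqintB sZ sY.
have DU : inner P D (fun w => Z w - Y w) = 0.
  apply: orthogonal_measurable => // B mB.
  have GB : <<s GG >> ((fun w => Z w - Y w) @^-1` B).
    by have := measurable_funB ZG YG measurableT mB; rewrite setTI.
  have mUB := sub _ GB.
  have [iX iZ'] := (sqint_integrable sX, sqint_integrable sZ).
  under eq_integral do rewrite EFinB.
  rewrite integralB//; [|exact: integrableS iX|exact: integrableS iZ'].
  rewrite ZE// subee// integrable_fin_num//; exact: integrableS iX.
have -> : (fun w => X w - Y w) = fun w => 1 * D w + (Z w - Y w).
  by apply/funext => w; rewrite /D mul1r addrA subrK.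
rewrite inner_sqr_lin// DU mulr0 addr0 expr1n mul1r.
rewrite (@le_trans _ _ (inner P D D)) ?lerDl ?inner_ge0//.
rewrite -[c](Rintegral_cst1 P) /inner /Rintegral.
have [mD iD] := sD.
have GT : <<s GG >> setT by exact: (@measurableT _ TG).
have -> : (\int[P]_w (D w * D w)%:E = \int[P]_w (V w)%:E)%E.
  by rewrite VE//; apply: eq_integral => w _; rewrite expr2.
have mV : measurable_fun setT V by case/integrableP: iV => /measurable_EFinP.
(* The bound on [V] holds only almost surely; the maximum with [c] satisfies it everywhere with the
   same integral. *)
have mV' : measurable_fun setT (fun w => Num.max (V w) c) by exact: measurable_maxr.
have VV' : {ae P, forall w, Num.max (V w) c = V w}.
  by apply: filterS cV => w cVw; rewrite max_l.
have iV' : P.-integrable setT (EFin \o (fun w => Num.max (V w) c)).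
  apply: (ae_eq_integrable _ iV); first exact/measurable_EFinP.
  by apply: filterS VV' => w /= ->.
have ic : P.-integrable setT (EFin \o (fun=> c)) by exact: finite_measure_integrable_cst.
rewrite -[X in fine X <= _]/(\int[P]_w (EFin \o (fun=> c)) w)%E.
have -> : (\int[P]_w (V w)%:E = \int[P]_w (Num.max (V w) c)%:E)%E.
  apply: ae_eq_integral => //; [exact/measurable_EFinP|exact/measurable_EFinP|].
  by apply: filterS VV' => w /= ->.
apply: fine_le; [exact: integrable_fin_num|exact: integrable_fin_num|].
by apply: le_integral => // w _; rewrite lee_fin le_max lexx orbT.
Qed.

End conditional_variance.

(** * The anisotropic metric and its grids *)

Section powR_extra.
Context {R : realType}.
Implicit Types a b p x : R.

(** A fraction [c / (a + b)] in the unit interval is at most its power [p], and the two fractions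
    sum to 1. *)
Lemma powR_subadd a b p : 0 <= a -> 0 <= b -> 0 < p <= 1 ->
  (a + b) `^ p <= a `^ p + b `^ p.
Proof.
move=> a0 b0 /andP[p0 p1].
have [->|an0] := eqVneq a 0; first by rewrite powR0 ?gt_eqF// !add0r.
have ab : 0 < a + b by rewrite ltr_wpDr// lt_neqAle eq_sym an0.
have h c : 0 <= c -> c <= a + b -> c / (a + b) * (a + b) `^ p <= c `^ p.
  move=> c0 cab; have [->|cn0] := eqVneq c 0; first by rewrite powR0 ?gt_eqF// !mul0r.
  have cab' : 0 < c / (a + b) <= 1.
    by rewrite divr_gt0//= ?ler_pdivrMr// ?mul1r// lt_neqAle eq_sym cn0.
  have cE : c = c / (a + b) * (a + b) by rewrite divfK// lt0r_neq0.
  rewrite [X in _ <= X `^ p]cE powRM ?divr_ge0 ?(ltW ab)//.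
  by rewrite ler_wpM2r ?powR_ge0// ger1_powR.
have := lerD (h a a0 _) (h b b0 _); rewrite lerDl lerDr => /(_ b0 a0).
by rewrite -mulrDl -mulrDl divff ?mul1r// gt_eqF.
Qed.

End powR_extra.

Section anisotropic_metric.
Context {R : realType} (k : nat) (gamma : 'I_k -> R).
Hypothesis gamma_gt0 : forall j, 0 < gamma j.
Implicit Types x y z : 'rV[R]_k.

Lemma alpha_itv j : 0 < alpha gamma j <= 1.
Proof.
have := gamma_gt0 j => g0; rewrite invr_gt0 addr_gt0//= invf_le1 ?addr_gt0//.
by rewrite lerDr ltW.
Qed.

Lemma alpha_gt0 j : 0 < alpha gamma j. Proof. by have /andP[] := alpha_itv j. Qed.

Lemma Delta_ge0 x y : 0 <= Delta gamma x y.
Proof. by apply: sumr_ge0 => j _; exact: powR_ge0. Qed.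

Lemma Delta_sym x y : Delta gamma x y = Delta gamma y x.
Proof. by apply: eq_bigr => j _; rewrite distrC. Qed.

Lemma Delta_triangle y x z : Delta gamma x z <= Delta gamma x y + Delta gamma y z.
Proof.
rewrite /Delta -big_split/=; apply: ler_sum => j _.
have -> : x 0 j - z 0 j = (x 0 j - y 0 j) + (y 0 j - z 0 j) by rewrite addrA subrK.
apply: le_trans (powR_subadd _ _ (alpha_itv j)) => //.
apply: ge0_ler_powR; rewrite ?nnegrE ?addr_ge0//.
- by rewrite ltW ?alpha_gt0.
- exact: ler_normD.
Qed.

Lemma coord_le_Delta x y j : `|x 0 j - y 0 j| `^ alpha gamma j <= Delta gamma x y.
Proof. by rewrite /Delta (bigD1 j)//= lerDl sumr_ge0// => i _; exact: powR_ge0. Qed.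

Lemma norm_coord_le x y j c : Delta gamma x y <= c ->
  `|x 0 j - y 0 j| <= c `^ (gamma j + 1).
Proof.
move=> Dc; have c0 : 0 <= c by exact: le_trans (Delta_ge0 x y) Dc.
have g0 : 0 < gamma j + 1 by rewrite addr_gt0.
have -> : `|x 0 j - y 0 j| = (`|x 0 j - y 0 j| `^ alpha gamma j) `^ (gamma j + 1).
  by rewrite -powRrM mulVf ?gt_eqF// powRr1.
apply: ge0_ler_powR; rewrite ?nnegrE ?powR_ge0 ?(ltW g0)//.
exact: le_trans (coord_le_Delta _ _ _) Dc.
Qed.

Lemma Qdim_ge0 : 0 <= Qdim gamma.
Proof. by apply: sumr_ge0 => j _; rewrite invrK addr_ge0 ?ltW. Qed.

Lemma QdimE : Qdim gamma = \sum_(j < k) (gamma j + 1).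
Proof. by apply: eq_bigr => j _; rewrite invrK. Qed.

Lemma Qdim_gt0 : (0 < k)%N -> 0 < Qdim gamma.
Proof.
move=> k0; rewrite QdimE (bigD1 (Ordinal k0))//= ltr_pwDl ?addr_gt0//.
by apply: sumr_ge0 => j _; rewrite addr_ge0 ?ltW.
Qed.

End anisotropic_metric.

Lemma card_family_le (B k : nat) (F : 'I_k -> pred 'I_B) (c : 'I_k -> nat) :
  (forall j, (#|F j| <= c j)%N) ->
  (#|(family F : simpl_pred {ffun 'I_k -> 'I_B})| <= \prod_j c j)%N.
Proof.
move=> Fc; rewrite card_family foldrE big_map big_enum/=.
by apply: leq_prod => j _; exact: Fc.
Qed.

Lemma card_ord_le (B m : nat) : (#|[pred i : 'I_B | (i <= m)%N]| <= m.+1)%N.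
Proof.
rewrite -[leqRHS]card_ord.
rewrite -(@card_in_imset _ _ (fun i : 'I_B => (inord i : 'I_m.+1))).
  exact: max_card.
move=> i j /=; rewrite !inE => im jm e.
by apply/val_inj; rewrite /= -(@inordK m i)// -[RHS](@inordK m j)// e.
Qed.

Lemma card_ord_near (B M i0 : nat) :
  (#|[pred i : 'I_B | (i <= i0 + M)%N && (i0 <= i + M)%N]| <= (M.*2).+1)%N.
Proof.
rewrite -[leqRHS]card_ord.
rewrite -(@card_in_imset _ _ (fun i : 'I_B => (inord (i + M - i0)%N : 'I_(M.*2).+1))).
  exact: max_card.
move=> i j /=; rewrite !inE => /andP[i1 i2] /andP[j1 j2] /(congr1 val)/=.
rewrite !inordK; last 2 first.
- by rewrite ltnS leq_subLR -addnn addnA leq_add2r.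
- by rewrite ltnS leq_subLR -addnn addnA leq_add2r.
by move=> e; apply/val_inj => /=; apply/eqP; rewrite -(eqn_add2r M) -(subnK i2) e subnK.
Qed.

Section grid.
Context {R : realType} (k : nat) (gamma : 'I_k -> R) (l u : 'rV[R]_k).
Hypothesis gamma_gt0 : forall j, 0 < gamma j.
Hypothesis lu : forall j, l 0 j < u 0 j.
Implicit Types (x y : 'rV[R]_k) (n : nat).

Let T := rectangle l u.
Let L j := u 0 j - l 0 j.
Let L_gt0 j : 0 < L j. Proof. by rewrite subr_gt0. Qed.

(* A cell of level [n] has [Delta]-diameter of order [2 ^- n]. *)
Definition depth n (j : 'I_k) : nat := Num.truncn (n%:R * (gamma j + 1)).

Lemma depth_le n j : (depth n j)%:R <= n%:R * (gamma j + 1).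
Proof. by rewrite truncn_le mulr_ge0// addr_ge0 ?ltW. Qed.

Lemma depth_gt n j : n%:R * (gamma j + 1) < (depth n j).+1%:R.
Proof. exact: truncnS_gt. Qed.

Lemma depth_mono n n' j : (n <= n')%N -> (depth n j <= depth n' j)%N.
Proof. by move=> nn; apply: le_truncn; rewrite ler_wpM2r ?ler_nat// addr_ge0 ?ltW. Qed.

Definition gridpt n (i : 'I_k -> nat) : 'rV[R]_k :=
  \row_j (l 0 j + (u 0 j - l 0 j) * ((i j)%:R / 2 ^+ depth n j)).

Definition grididx n x (j : 'I_k) : nat :=
  Num.truncn (2 ^+ depth n j * ((x 0 j - l 0 j) / (u 0 j - l 0 j))).

Definition gridproj n x := gridpt n (grididx n x).

Let frac x j := (x 0 j - l 0 j) / L j.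

Let frac_itv x j : T x -> 0 <= frac x j <= 1.
Proof.
move=> /(_ j)/andP[lx xu]; rewrite divr_ge0 ?subr_ge0 ?(ltW (lu j))//=.
by rewrite ler_pdivrMr// mul1r lerD2r.
Qed.

Let pow2_gt0 n : 0 < 2 ^+ n :> R. Proof. by rewrite exprn_gt0. Qed.

Lemma grididx_le n x j : T x -> (grididx n x j <= 2 ^ depth n j)%N.
Proof.
move=> Tx; have /andP[f0 f1] := frac_itv j Tx.
rewrite -(@ler_nat R) (le_trans _ (_ : 2 ^+ depth n j * frac x j <= _))//.
  by rewrite truncn_le mulr_ge0// ltW.
by rewrite natrX ler_piMr// ltW.
Qed.

Lemma gridpt_rectangle n (i : 'I_k -> nat) :
  (forall j, (i j <= 2 ^ depth n j)%N) -> T (gridpt n i).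
Proof.
move=> i2 j; rewrite mxE lerDl mulr_ge0 ?(ltW (L_gt0 j)) ?divr_ge0 ?(ltW (pow2_gt0 _))//=.
rewrite -lerBrDl ler_piMr ?(ltW (L_gt0 j))// ler_pdivrMr// mul1r.
by rewrite -natrX ler_nat.
Qed.

Lemma gridproj_rectangle n x : T x -> T (gridproj n x).
Proof. by move=> Tx; apply: gridpt_rectangle => j; exact: grididx_le. Qed.

Lemma gridproj_coord n x j : T x ->
  `|x 0 j - gridproj n x 0 j| <= (u 0 j - l 0 j) / 2 ^+ depth n j.
Proof.
move=> Tx; have /andP[f0 f1] := frac_itv j Tx.
have xE : x 0 j = l 0 j + L j * frac x j.
  by rewrite /frac mulrCA mulfV ?mulr1 ?gt_eqF// addrC subrK.
rewrite mxE {1}xE opprD addrACA subrr add0r -mulrBr normrM gtr0_norm//.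
rewrite -/(L j) ler_wpM2l ?(ltW (L_gt0 j))//.
have /andP[i1 i2] : (grididx n x j)%:R <= 2 ^+ depth n j * frac x j < (grididx n x j).+1%:R.
  by apply: truncn_itv; rewrite mulr_ge0// ltW.
rewrite ler_norml; apply/andP; split.
  by rewrite (@le_trans _ _ 0) ?oppr_le0 ?invr_ge0 ?(ltW (pow2_gt0 _))// subr_ge0 ler_pdivrMr// mulrC.
rewrite lerBlDr -[X in X + _]mul1r -mulrDl ler_pdivlMr// mulrC (le_trans (ltW i2))//.
by rewrite -natr1 addrC.
Qed.

Lemma gridproj_gridpt n n' (i : 'I_k -> nat) : (n <= n')%N ->
  gridproj n' (gridpt n i) = gridpt n i.
Proof.
move=> nn'; apply/rowP => j; rewrite !mxE; congr (_ + _ * _).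
rewrite /grididx mxE addrAC subrr add0r mulrAC mulfV ?mul1r ?gt_eqF ?subr_gt0//.
have e : 2 ^+ depth n' j = 2 ^+ (depth n' j - depth n j) * 2 ^+ depth n j :> R.
  by rewrite -exprD subnK// depth_mono.
have -> : 2 ^+ depth n' j * ((i j)%:R / 2 ^+ depth n j) =
    (2 ^ (depth n' j - depth n j) * i j)%:R :> R.
  rewrite e natrM natrX; field; exact: lt0r_neq0.
rewrite natrK e natrM natrX; field.
by rewrite !lt0r_neq0.
Qed.

(** Points are characterized as fixed by the projection, so that the chain of projections of a grid
    point stops after finitely many steps. *)
Definition grid n : set 'rV[R]_k := [set x | T x /\ gridproj n x = x].

Lemma grid_gridproj n x : T x -> grid n (gridproj n x).
Proof. by move=> Tx; split; [exact: gridproj_rectangle|exact: gridproj_gridpt]. Qed.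

Lemma grid_mono n n' : (n <= n')%N -> grid n `<=` grid n'.
Proof. by move=> nn' x [Tx <-]; split; [exact: gridproj_rectangle|exact: gridproj_gridpt]. Qed.

Definition dense_grid : set 'rV[R]_k := [set x | exists n, grid n x].

Lemma dense_grid_rectangle x : dense_grid x -> T x.
Proof. by case=> n []. Qed.

(** The factor 2 pays for rounding [depth] down: [(depth n j) * alpha] is still larger than
    [n - 1]. *)
Definition mesh : R := 2 * \sum_(j < k) (u 0 j - l 0 j) `^ alpha gamma j.

Lemma mesh_ge0 : 0 <= mesh.
Proof. by rewrite mulr_ge0// sumr_ge0// => j _; exact: powR_ge0. Qed.

Lemma Delta_gridproj n x : T x -> Delta gamma x (gridproj n x) <= mesh * 2 ^- n.
Proof.
move=> Tx; rewrite /Delta /mesh mulrAC mulr_sumr; apply: ler_sum => j _.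
have a0 := alpha_gt0 gamma_gt0 j; have /andP[_ a1] := alpha_itv gamma_gt0 j.
apply: (@le_trans _ _ ((L j / 2 ^+ depth n j) `^ alpha gamma j)).
  by apply: ge0_ler_powR; rewrite ?nnegrE ?(ltW a0) ?divr_ge0 ?(ltW (L_gt0 j)) ?(ltW (pow2_gt0 _)) ?gridproj_coord.
rewrite powRM ?invr_ge0 ?(ltW (L_gt0 j)) ?(ltW (pow2_gt0 _))// mulrC ler_wpM2r ?powR_ge0//.
rewrite -[2 ^+ depth n j]powR_mulrn// -powRN -powRrM.
rewrite [leRHS](_ : _ = 2 `^ (1 - n%:R)); last first.
  by rewrite powRD ?powRr1 ?powRN ?powR_mulrn// ; apply/implyP.
apply: ler_powR; first by rewrite ler1n.
have : n%:R * (gamma j + 1) * alpha gamma j <= (depth n j).+1%:R * alpha gamma j.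
  by rewrite ler_wpM2r ?(ltW a0)// ltW// depth_gt.
rewrite mulfK ?gt_eqF ?addr_gt0// -natr1 mulrDl mul1r; lra.
Qed.

Definition gridsize n : nat := \prod_(j < k) (2 ^ depth n j).+1.

Let side n := (\max_(j < k) 2 ^ depth n j).+1.

Let side_lt n j : (2 ^ depth n j < side n)%N.
Proof. by rewrite ltnS; exact: (@leq_bigmax _ (fun j => (2 ^ depth n j)%N) j). Qed.

(** The sides depend on the coordinate; a common ordinal with a predicate gives a simple finite type
    over which to take union bounds. *)
Definition gridcode n := [pred f : {ffun 'I_k -> 'I_(\max_(j < k) 2 ^ depth n j).+1} |
  [forall j, (f j <= 2 ^ depth n j)%N]].

Definition griddec n (f : {ffun 'I_k -> 'I_(\max_(j < k) 2 ^ depth n j).+1}) :=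
  gridpt n (fun j => f j : nat).
Arguments griddec : clear implicits.

Lemma gridcode_grid n f : gridcode n f -> grid n (griddec n f).
Proof.
move=> /forallP fn; split; last exact: gridproj_gridpt.
exact: gridpt_rectangle.
Qed.

Lemma grid_gridcode n x : grid n x -> exists2 f, gridcode n f & x = griddec n f.
Proof.
move=> [Tx xE]; have lt j : (grididx n x j < side n)%N.
  exact: leq_ltn_trans (grididx_le n j Tx) (side_lt n j).
exists [ffun j => Ordinal (lt j)].
  by apply/forallP => j; rewrite ffunE/= grididx_le.
rewrite -[LHS]xE; apply/rowP => j; rewrite !mxE ffunE//.
Qed.

Lemma gridcode_card n : (#|gridcode n| <= gridsize n)%N.
Proof.
have -> : #|gridcode n| = #|(family (fun j => [pred i : 'I_(side n) | (i <= 2 ^ depth n j)%N]) :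
    simpl_pred {ffun 'I_k -> 'I_(side n)})|.
  by apply: eq_card => f; rewrite !inE; apply/eq_forallb.
by apply: card_family_le => j; exact: card_ord_le.
Qed.

Lemma gridsize_le n : (gridsize n)%:R <= 2 ^+ k * (2 `^ Qdim gamma) ^+ n :> R.
Proof.
rewrite /gridsize natr_prod.
apply: (@le_trans _ _ (\prod_(j < k) (2 * 2 `^ (n%:R * (gamma j + 1))))).
  apply: ler_prod => j _; rewrite ler0n/= -natr1 natrX.
  have h : 2 ^+ depth n j <= 2 `^ (n%:R * (gamma j + 1)) :> R.
    by rewrite -powR_mulrn//; apply: ler_powR; rewrite ?ler1n// depth_le.
  have : 1 <= 2 ^+ depth n j :> R by rewrite exprn_ege1// ler1n.
  lra.
rewrite big_split/= prodr_const card_ord ler_wpM2l ?exprn_ge0//.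
rewrite -powR_mulrn ?powR_ge0// -powRrM QdimE mulrC mulr_sumr.
elim/big_rec2: _ => [|j x y _ h]; first by rewrite powRr0.
rewrite powRD; last by rewrite (_ : 2 == 0 = false) ?implybT// gt_eqF.
by rewrite mulrC ler_wpM2l ?powR_ge0// mulrC.
Qed.

Lemma gridcode_near e (C : R) : 0 <= C -> exists M : nat,
  forall n (f g : {ffun 'I_k -> 'I_(side (n + e))}),
  Delta gamma (griddec (n + e) f) (griddec (n + e) g) <= C * 2 ^- n ->
  forall j, ((f j <= g j + M) && (g j <= f j + M))%N.
Proof.
move=> C0.
pose m j := (2 `^ (e%:R * (gamma j + 1)) * C `^ (gamma j + 1)) / (u 0 j - l 0 j).
have m0 j : 0 <= m j by rewrite divr_ge0 ?mulr_ge0 ?powR_ge0 ?(ltW (L_gt0 j)).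
exists (\max_j (Num.truncn (m j)).+1) => n f g Dfg j.
have h := norm_coord_le gamma_gt0 j Dfg.
have g1 : 0 < gamma j + 1 by rewrite addr_gt0.
have {}h : `|(f j)%:R - (g j)%:R| <= m j.
  move: h; rewrite !mxE opprD addrACA subrr add0r -mulrBr -mulrBl !normrM.
  rewrite (gtr0_norm (L_gt0 j)) [X in _ * (_ * X)]gtr0_norm ?invr_gt0// => h.
  have {}h : `|(f j)%:R - (g j)%:R| <=
      2 ^+ depth (n + e) j * (C / 2 ^+ n) `^ (gamma j + 1) / L j.
    by rewrite ler_pdivlMr// -ler_pdivrMl//; apply: le_trans h; rewrite [_ * L j]mulrC mulrCA [_ / _]mulrC.
  apply: le_trans h _; rewrite ler_wpM2r ?invr_ge0 ?(ltW (L_gt0 j))//.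
  rewrite powRM ?invr_ge0 ?(ltW (pow2_gt0 _))// mulrCA mulrC ler_wpM2r ?powR_ge0//.
  rewrite (_ : 2 ^- n = 2 `^ (- n%:R)); last by rewrite powRN powR_mulrn.
  rewrite -[X in X * _]powR_mulrn// -powRrM -powRD; last exact/implyP.
  apply: ler_powR; first by rewrite ler1n.
  have := depth_le (n + e) j; rewrite natrD; lra.
have hM : m j <= (\max_j (Num.truncn (m j)).+1)%:R.
  rewrite (le_trans (ltW (truncnS_gt _)))// ler_nat.
  exact: (leq_bigmax (F := fun j => (Num.truncn (m j)).+1)).
move: (le_trans h hM); rewrite ler_norml => /andP[h1 h2].
rewrite -!(@ler_nat R) !natrD; apply/andP; split; lra.
Qed.

(** The number of near pairs is linear in the number of points. Counting all pairs would replace [Q]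
    by [2 * Q] in the sharp constant. *)
Lemma gridcode_near_card e (C : R) : 0 <= C -> exists N : nat,
  forall n, (#|[pred p : {ffun 'I_k -> 'I_(side (n + e))} * {ffun 'I_k -> 'I_(side (n + e))} |
     gridcode (n + e) p.1 &&
     (Delta gamma (griddec (n + e) p.1) (griddec (n + e) p.2) <= C * 2 ^- n)%R]|
     <= gridsize (n + e) * N)%N.
Proof.
move=> C0; have [M hM] := gridcode_near e C0; exists ((M.*2).+1 ^ k)%N => n.
rewrite -sum1_card (eq_bigl (fun p => gridcode (n + e) p.1 &&
  (Delta gamma (griddec (n + e) p.1) (griddec (n + e) p.2) <= C * 2 ^- n))); last first.
  by move=> p; rewrite inE.
rewrite -(pair_big_dep (fun f => gridcode (n + e) f) (fun f g =>
  (Delta gamma (griddec (n + e) f) (griddec (n + e) g) <= C * 2 ^- n)) (fun _ _ => 1%N))/=.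
apply: (@leq_trans (\sum_(f | gridcode (n + e) f) ((M.*2).+1 ^ k)%N)); last first.
  by rewrite sum_nat_const leq_mul2r gridcode_card orbT.
apply: leq_sum => f _.
have -> : ((M.*2).+1 ^ k)%N = (\prod_(j < k) (M.*2).+1)%N by rewrite prod_nat_const card_ord.
apply: leq_trans (@card_family_le _ _ (fun j => [pred i : 'I_(side (n + e)) |
  (i <= f j + M)%N && (f j <= i + M)%N]) _ _); last by move=> j; exact: card_ord_near.
rewrite sum1_card; apply: subset_leq_card; apply/fintype.subsetP => g.
rewrite inE => Dfg; apply/familyP => j; rewrite inE andbC; exact: hM.
Qed.

End grid.

(** * Chaining *)

Section borel_cantelli_union.
Context {d : measure_display} {Omega : measurableType d} {R : realType}.
Variable P : probability Omega R.

Lemma union_bound (I : finType) (A : pred I) (E : I -> set Omega) (p : R) :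
  (forall i, A i -> measurable (E i)) -> (forall i, A i -> (P (E i) <= p%:E)%E) ->
  measurable [set w | exists2 i, A i & E i w] /\
  (P [set w | exists2 i, A i & E i w] <= (#|A|%:R * p)%:E)%E.
Proof.
move=> mE Ep.
have h (s : seq I) : measurable [set w | exists2 i, (i \in s) && A i & E i w] /\
    (P [set w | exists2 i, (i \in s) && A i & E i w] <= ((count A s)%:R * p)%:E)%E.
  elim: s => [|i s [ms IH]].
    rewrite (_ : [set w | _] = set0); last by apply/seteqP; split => // w [].
    by split; [exact: measurable0|rewrite measure0 mul0r].
  rewrite (_ : [set w | _] = (if A i then E i else set0) `|`
      [set w | exists2 i, (i \in s) && A i & E i w]); last first.
    apply/seteqP; split => w /=.
      move=> [j /andP[+ Aj] Ejw]; rewrite inE => /predU1P[ji|js].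
        by left; rewrite -ji Aj.
      by right; exists j => //; rewrite js.
    case=> [|[j /andP[js Aj] Ejw]]; last by exists j; rewrite // inE js orbT.
    by case: ifPn => // Ai Eiw; exists i => //; rewrite mem_head.
  have mi : measurable (if A i then E i else set0) by case: ifPn => // Ai; exact: mE.
  split; first exact: measurableU.
  have := measureU2 P mi ms => /le_trans; apply; rewrite /= natrD mulrDl EFinD leeD//.
  by case: ifPn => Ai; rewrite ?mul1r ?Ep// measure0 mul0r.
have -> : [set w | exists2 i, A i & E i w] =
    [set w | exists2 i, (i \in enum I) && A i & E i w].
  by apply/seteqP; split => w [i iA Ew]; exists i => //; move: iA; rewrite mem_enum.
by rewrite (_ : #|A| = count A (enum I))// cardE enumT -size_filter.
Qed.

Lemma borel_cantelli_geometric (I : nat -> finType) (A : forall n, pred (I n))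
    (E : forall n, I n -> set Omega) (p : nat -> R) (C rho : R) N :
  (forall n i, A n i -> measurable (E n i)) ->
  (forall n i, (N <= n)%N -> A n i -> (P (E n i) <= (p n)%:E)%E) ->
  0 <= C -> 0 < rho < 1 ->
  (forall n, (N <= n)%N -> #|A n|%:R * p n <= C * rho ^+ n) ->
  {ae P, forall w, exists n0, forall n i, (n0 <= n)%N -> A n i -> ~ E n i w}.
Proof.
move=> mE Ep C0 /andP[r0 r1] hC.
pose F n := if (N <= n)%N then [set w | exists2 i, A n i & E n i w] else set0.
have mF n : measurable (F n).
  by rewrite /F; case: ifPn => // Nn; have [] := union_bound (mE n) (fun i => Ep n i Nn).
have PF n : (P (F n) <= (geometric C rho n)%:E)%E.
  rewrite /F; case: ifPn => Nn; last by rewrite measure0 lee_fin mulr_ge0// exprn_ge0// ltW.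
  have [_ /le_trans] := union_bound (mE n) (fun i => Ep n i Nn); apply.
  by rewrite lee_fin hC.
have : P (lim_sup_set F) = 0%E.
  apply: lim_sup_set_cvg0 => //; apply: (@le_lt_trans _ _ (C / (1 - rho))%:E); last exact: ltry.
  apply: lime_le; first exact: is_cvg_nneseries.
  apply: nearW => n; apply: (@le_trans _ _ (series (geometric C rho) n)%:E).
    by rewrite /series/= -sumEFin; exact: lee_sum.
  by rewrite lee_fin geometric_le_lim// ger0_norm// ltW.
move=> PF0; exists (lim_sup_set F); split => //.
  by apply: bigcap_measurable => // n _; apply: bigcup_measurable.
move=> w /= nw n _; apply: contrapT => hn; apply: nw; exists (maxn n N) => m i + Ai Ei.
rewrite geq_max => /andP[nm Nm]; apply: hn; exists m => //.
by rewrite /F Nm; exists i.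
Qed.

End borel_cantelli_union.

Section dyadic.
Context {R : realType}.

Lemma ln2_ge : 2^-1 <= ln 2 :> R.
Proof.
rewrite -ler_expR lnK ?posrE//.
have := @expR_ge1Dx R (- 2^-1); rewrite expRN.
have e0 := @expR_gt0 R 2^-1.
rewrite lerBlDr -lerBlDl => h.
have {}h : 2^-1 <= (expR 2^-1)^-1 :> R by lra.
by rewrite -[leRHS]invrK -[leLHS]invrK lef_pV2 ?posrE ?invr_gt0 ?invrK.
Qed.

Lemma exists_halfX_lt (e : R) : 0 < e -> exists n : nat, 2 ^- n < e.
Proof.
move=> e0; exists (Num.truncn e^-1); rewrite invf_plt ?posrE ?exprn_gt0//.
apply: lt_le_trans (truncnS_gt _) _; rewrite -natrX ler_nat; exact: ltn_expl.
Qed.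

Lemma sqrtr_sqr_pos (x : R) : 0 <= x -> Num.sqrt (x ^+ 2) = x.
Proof. by move=> x0; rewrite sqrtr_sqr ger0_norm. Qed.

Lemma dyadic_scale (x : R) n0 : 0 < x <= 2 ^- n0 ->
  exists2 n, (n0 <= n)%N & 2 ^- n.+1 < x <= 2 ^- n.
Proof.
move=> /andP[x0 xn0].
have ex : exists n, 2 ^- n < x by exact: exists_halfX_lt.
have [m mx mmin] := ex_minnP ex.
have le2 (i j : nat) : (i <= j)%N -> 2 ^- j <= 2 ^- i :> R.
  by move=> ij; rewrite lef_pV2 ?posrE ?exprn_gt0// ler_eXn2l ?ltr1n.
have nm : (n0 < m)%N.
  rewrite ltnNge; apply/negP => /le2 h.
  by have := lt_le_trans mx (le_trans xn0 h); rewrite ltxx.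
case: m mx mmin nm => // m mx mmin nm; exists m => //.
rewrite mx/= leNgt; apply/negP => /mmin; by rewrite ltnn.
Qed.

End dyadic.

Section modulus_bound.
Context {R : realType} {k : nat}.
Implicit Types (S : set 'rV[R]_k) (D : 'rV[R]_k -> 'rV[R]_k -> R) (f : 'rV[R]_k -> R).

(** The threshold runs through a countable set, so that over a countable [S] this is a measurable
    event; the quotient is multiplied out to avoid division. *)
Definition modulus_le S D (q : R) f : Prop := exists n : nat, forall x y, S x -> S y ->
  0 < D x y <= n.+1%:R^-1 -> `|f x - f y| <= q * (D x y * Num.sqrt (ln (D x y)^-1)).

End modulus_bound.

Section chaining.
Context {R : realType} {k : nat} (gamma : 'I_k -> R) (l u : 'rV[R]_k).
Hypothesis gamma_gt0 : forall j, 0 < gamma j.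
Hypothesis lu : forall j, l 0 j < u 0 j.
Local Notation T := (rectangle l u).
Local Notation Q := (Qdim gamma).
Local Notation grid := (grid gamma l u).
Local Notation gridproj := (gridproj gamma l u).
Local Notation dense_grid := (dense_grid gamma l u).
Local Notation mesh := (mesh gamma l u).
Implicit Types (f : 'rV[R]_k -> R) (n : nat).

(* Chosen so that a Gaussian tail at height [sqrt (grid_const * n)] is at most
   [2 * 2 ^- ((2 Q + 1) n)], while level [n] has at most [4 ^ k * 2 ^ (2 Q n)]
   pairs of points. *)
Definition grid_const : R := 8 / 3 * (2 * Q + 1) * ln 2.

Lemma grid_const_ge0 : 0 <= grid_const.
Proof.
have := Qdim_ge0 gamma_gt0; have := @ln2_ge R => h q0.
have Q1 : 0 <= 2 * Q + 1 by lra.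
by rewrite mulr_ge0 ?mulr_ge0//; lra.
Qed.

Local Notation B := grid_const.

(* The bound satisfied at all large levels by a process whose increments have
   norm at most [c * Delta]. *)
Definition grid_lip f (c : R) n0 : Prop := forall n p q, (n0 <= n)%N ->
  grid n p -> grid n q -> Delta gamma p q <= (1 + 4 * mesh) * 2 ^- n ->
  `|f p - f q| <= c * Delta gamma p q * Num.sqrt (B * n%:R).

(** The smallest [K] for which the induction of [chain_gridproj] closes: one link costs
    [2 * mesh * Num.sqrt B], and the bound at the next level is at most [3 / 4 * K], so a quarter of
    [K] must cover the link. *)
Definition chain_const : R := 8 * mesh * Num.sqrt B.

Lemma chain_const_ge0 : 0 <= chain_const.
Proof. by rewrite mulr_ge0 ?sqrtr_ge0 // mulr_ge0 ?mesh_ge0. Qed.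

Lemma Delta_gridproj2 n x y : T x -> T y ->
  Delta gamma (gridproj n x) (gridproj n y) <= Delta gamma x y + 2 * mesh * 2 ^- n.
Proof.
move=> Tx Ty; have := Delta_triangle gamma_gt0 x (gridproj n x) (gridproj n y).
have := Delta_triangle gamma_gt0 y x (gridproj n y).
have := Delta_gridproj gamma_gt0 lu n Tx; have := Delta_gridproj gamma_gt0 lu n Ty.
rewrite [Delta gamma x (gridproj n x)]Delta_sym; lra.
Qed.

(** Downward induction on the level, starting from a level where [x] is its own projection; the
    chain is finite and no limit or continuity enters. *)
Lemma chain_gridproj f c n0 n x : 0 <= c -> grid_lip f c n0 -> (n0 <= n)%N -> dense_grid x ->
  `|f x - f (gridproj n x)| <= c * chain_const * 2 ^- n * Num.sqrt n.+1%:R.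
Proof.
move=> c0 hf n0n [m gx]; have [Tx _] := gx.
have K0 := chain_const_ge0.
have rhs0 i : 0 <= c * chain_const * 2 ^- i * Num.sqrt i.+1%:R.
  apply: mulr_ge0; last exact: sqrtr_ge0.
  by apply: mulr_ge0; [exact: mulr_ge0|rewrite invr_ge0 exprn_ge0].
have base i : (m <= i)%N -> `|f x - f (gridproj i x)| <= c * chain_const * 2 ^- i * Num.sqrt i.+1%:R.
  move=> mi; have [_ ->] := grid_mono gamma_gt0 lu mi gx.
  by rewrite subrr normr0.
have [/base//|/ltnW nm] := leqP m n.
move: n0n; rewrite -(subKn nm); set i := (m - n)%N.
have : (i <= m)%N by rewrite leq_subr.
elim: i => [|i IH] im n0i; first by apply: base; rewrite subn0.
have iE : (m - i = (m - i.+1).+1)%N by rewrite -subSn.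
have {IH} := IH (ltnW im) (leq_trans n0i (leq_sub2l m (leqnSn i))).
rewrite iE; set j := (m - i.+1)%N => h.
have D1 : Delta gamma (gridproj j.+1 x) (gridproj j x) <= 2 * mesh * 2 ^- j.
  have := Delta_triangle gamma_gt0 x (gridproj j.+1 x) (gridproj j x).
  have := Delta_gridproj gamma_gt0 lu j Tx; have := Delta_gridproj gamma_gt0 lu j.+1 Tx.
  rewrite [Delta gamma x (gridproj j.+1 x)]Delta_sym.
  have : mesh * 2 ^- j.+1 <= mesh * 2 ^- j.
    by rewrite ler_wpM2l ?mesh_ge0// lef_pV2 ?posrE ?exprn_gt0// ler_eXn2l ?ltr1n.
  lra.
have h2 : `|f (gridproj j.+1 x) - f (gridproj j x)| <= c * (2 * mesh * 2 ^- j) * Num.sqrt (B * j.+1%:R).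
  apply: le_trans (hf j.+1 _ _ _ _ _ _) _.
  - exact: leq_trans n0i _.
  - exact: grid_gridproj.
  - by apply: (grid_mono gamma_gt0 lu (leqnSn j)); exact: grid_gridproj.
  (* In units of level [j.+1] the distance [2 * mesh * 2 ^- j] is [4 * mesh * 2 ^- j.+1], whence the
     radius in [grid_lip]. *)
  - apply: le_trans D1 _; rewrite exprS invfM.
    have : 0 <= 2 ^- j :> R by rewrite invr_ge0 exprn_ge0.
    lra.
  - by rewrite ler_wpM2r ?sqrtr_ge0// ler_wpM2l.
have -> : f x - f (gridproj j x) = (f x - f (gridproj j.+1 x)) + (f (gridproj j.+1 x) - f (gridproj j x)).
  by rewrite addrA subrK.
apply: le_trans (ler_normD _ _) _; apply: le_trans (lerD h h2) _.
have s : Num.sqrt j.+2%:R <= 3 / 2 * Num.sqrt j.+1%:R :> R.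
  rewrite -[3 / 2]sqrtr_sqr_pos// -sqrtrM ?sqr_ge0// ler_wsqrtr//.
  have : 1 <= j.+1%:R :> R by rewrite ler1n.
  by rewrite -[j.+2%:R]natr1; lra.
rewrite sqrtrM ?grid_const_ge0// /chain_const exprS invfM.
set t := 2 ^- j; set s1 := Num.sqrt j.+1%:R; set s2 := Num.sqrt j.+2%:R.
have w0 : 0 <= c * (8 * mesh * Num.sqrt B) * (2^-1 * t).
  apply: mulr_ge0; first exact: (mulr_ge0 c0 K0).
  by apply: mulr_ge0; rewrite ?invr_ge0 ?exprn_ge0.
have := ler_wpM2l w0 s; rewrite -/s1 -/s2; lra.
Qed.

(** Two chains and the link between the projections. The 4 is a factor 2 from [2 ^- n <= 2 * Delta]
    times a factor 2 from [sqrt_le_ln]. *)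
Definition crude_const : R := 4 * (2 * chain_const + (1 + 2 * mesh) * Num.sqrt B).

Lemma crude_const_ge0 : 0 <= crude_const.
Proof.
have := chain_const_ge0; have := mesh_ge0 gamma l u => m0 K0.
have m1 : 0 <= 1 + 2 * mesh by lra.
apply: mulr_ge0 => //; apply: addr_ge0; apply: mulr_ge0 => //; exact: sqrtr_ge0.
Qed.

Lemma ln_dyadic n (x : R) : 0 < x <= 2 ^- n -> n%:R * ln 2 <= ln x^-1.
Proof.
move=> /andP[x0 xn]; rewrite mulr_natl -lnXn//.
by rewrite ler_ln ?posrE ?exprn_gt0 ?invr_gt0// -[leLHS]invrK lef_pV2// posrE invr_gt0 exprn_gt0.
Qed.

Lemma sqrt_le_ln n (x : R) : (0 < n)%N -> 0 < x <= 2 ^- n ->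
  Num.sqrt n.+1%:R <= 2 * Num.sqrt (ln x^-1).
Proof.
move=> n0 /ln_dyadic h; have h2 := @ln2_ge R.
rewrite -[2]sqrtr_sqr_pos// -sqrtrM ?sqr_ge0// ler_wsqrtr//.
have n1 : 1 <= n%:R :> R by rewrite ler1n.
have : n%:R * 2^-1 <= n%:R * ln 2 :> R by rewrite ler_wpM2l// ler0n.
by rewrite -[n.+1%:R]natr1; lra.
Qed.

Lemma grid_lip_modulus f c n0 : 0 <= c -> (0 < n0)%N -> grid_lip f c n0 ->
  modulus_le dense_grid (Delta gamma) (c * crude_const) f.
Proof.
move=> c0 n00 hf; have m0 := mesh_ge0 gamma l u.
exists (2 ^ n0)%N => x y Sx Sy /andP[xy0 xyn].
have {}xyn : 0 < Delta gamma x y <= 2 ^- n0.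
  by rewrite xy0/= (le_trans xyn)// lef_pV2 ?posrE ?exprn_gt0// -natrX ler_nat.
have [n n0n /andP[Dn nD]] := dyadic_scale xyn.
have n1 : (0 < n)%N by exact: leq_trans n00 n0n.
have Tx := dense_grid_rectangle Sx; have Ty := dense_grid_rectangle Sy.
have hx := chain_gridproj c0 hf n0n Sx; have hy := chain_gridproj c0 hf n0n Sy.
have t0 : 0 < 2 ^- n :> R by rewrite invr_gt0 exprn_gt0.
have D2 := Delta_gridproj2 n Tx Ty.
have hxy : `|f (gridproj n x) - f (gridproj n y)| <= c * ((1 + 2 * mesh) * 2 ^- n) * Num.sqrt (B * n%:R).
  apply: le_trans (hf n _ _ n0n _ _ _) _; first exact: grid_gridproj.
  - exact: grid_gridproj.
  - apply: le_trans D2 _; have : 0 <= mesh * 2 ^- n by rewrite mulr_ge0// ltW.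
    lra.
  - rewrite ler_wpM2r ?sqrtr_ge0// ler_wpM2l//; lra.
have -> : f x - f y = (f x - f (gridproj n x)) + (f (gridproj n x) - f (gridproj n y)) - (f y - f (gridproj n y)) by ring.
apply: le_trans (ler_normB _ _) _; apply: le_trans (lerD (ler_normD _ _) hy) _.
apply: le_trans (lerD (lerD hx hxy) (lexx _)) _.
have s1 : Num.sqrt (B * n%:R) <= Num.sqrt B * Num.sqrt n.+1%:R.
  rewrite -sqrtrM ?grid_const_ge0// ler_wsqrtr// ler_wpM2l ?grid_const_ge0//.
  by rewrite ler_nat.
have s2 : Num.sqrt n.+1%:R <= 2 * Num.sqrt (ln (Delta gamma x y)^-1).
  by apply: sqrt_le_ln => //; rewrite xy0.
have t1 : 2 ^- n <= 2 * Delta gamma x y.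
  by move: Dn; rewrite exprS invfM; lra.
set w := c * (2 * chain_const + (1 + 2 * mesh) * Num.sqrt B).
have w0 : 0 <= w.
  by rewrite mulr_ge0//; have := crude_const_ge0; rewrite /crude_const pmulr_rge0.
have w1 : 0 <= c * ((1 + 2 * mesh) * 2 ^- n).
  rewrite !mulr_ge0 ?(ltW t0)//; lra.
have h1 := ler_wpM2l w1 s1.
apply: (@le_trans _ _ (w * 2 ^- n * Num.sqrt n.+1%:R)); first by rewrite /w; lra.
apply: (@le_trans _ _ (w * (2 * Delta gamma x y) * (2 * Num.sqrt (ln (Delta gamma x y)^-1)))).
  apply: ler_pM => //; last by apply: ler_wpM2l.
  by apply: mulr_ge0 => //; exact: ltW.
by rewrite /w /crude_const; lra.
Qed.

(* The bound on neighbours of the grid of level [n + e] from which the sharp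
   constant is obtained by letting [e] grow. *)
Definition grid_sharp D (e : nat) (r : R) f n0 : Prop := forall n p q, (n0 <= n)%N ->
  grid (n + e)%N p -> grid (n + e)%N q -> Delta gamma p q <= (1 + 2 * mesh) * 2 ^- n ->
  `|f p - f q| <= D p q * Num.sqrt (r * n%:R).

(** Projecting at level [n + e] changes [D x y] by a relative error [a * 2 ^- e], and the two chains
    cost a relative [b * 2 ^- e]. The parameters [eta] and [e] are fixed before [f], so that the
    almost sure statements can be invoked for them afterwards. *)
Lemma grid_sharp_modulus (D : 'rV[R]_k -> 'rV[R]_k -> R) (c c3 eps q : R) :
  (forall x y z, T x -> T y -> T z -> D x z <= D x y + D y z) ->
  (forall x y, T x -> T y -> D x y = D y x) ->
  0 < c -> 0 < c3 -> 0 < eps ->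
  (forall x y, T x -> T y -> c3 * Delta gamma x y <= D x y) ->
  (forall x y, T x -> T y -> Delta gamma x y <= eps -> D x y <= c * Delta gamma x y) ->
  Num.sqrt (2 * Q) < q ->
  exists eta e, [/\ 0 < eta, (eta : R) <= 1 &
   forall f n0 n1, grid_lip f c n0 -> grid_sharp D e (2 * Q * (1 + eta) * ln 2) f n1 ->
     modulus_le dense_grid D q f].
Proof.
move=> Dtri Dsym c0 c30 eps0 Dlow Dup qQ.
have Q0 := Qdim_ge0 gamma_gt0; have m0 := mesh_ge0 gamma l u; have K0 := chain_const_ge0.
have s0 : 0 <= Num.sqrt (2 * Q) by exact: sqrtr_ge0.
set sQ := Num.sqrt (2 * Q) in qQ s0 *; set K := chain_const in K0.
(* Half of the gap between [sQ] and [q] is left to [eta], the other half to the errors of order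
   [2 ^- e]. *)
pose m := (sQ + q) / 2.
pose eta := Num.min 1 ((m - sQ) / (sQ + 1)).
have eta0 : 0 < eta by rewrite lt_min ltr01/= divr_gt0// /m; lra.
have eta1 : eta <= 1 by rewrite ge_min lexx.
have eta_m : sQ * (1 + eta) <= m.
  have : eta <= (m - sQ) / (sQ + 1) by rewrite ge_min lexx orbT.
  rewrite ler_pdivlMr; last by lra.
  nra.
pose a := 4 * c * mesh / c3; pose b := 12 * c * K / c3.
have a0 : 0 <= a by rewrite divr_ge0 ?(ltW c30)// mulr_ge0// mulr_ge0 ?ltW.
have b0 : 0 <= b by rewrite divr_ge0 ?(ltW c30)//; apply: mulr_ge0 => //; rewrite mulr_ge0 ?ltW.
have mpos : 0 <= m by rewrite /m; lra.
have mab : 0 <= m * a by rewrite mulr_ge0.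
have qm : 0 < q - m by rewrite /m; lra.
have mab1 : 0 < m * a + b + 1 by lra.
have [e he] := exists_halfX_lt (divr_gt0 qm mab1).
have te0 : 0 < 2 ^- e :> R by rewrite invr_gt0 exprn_gt0.
set te := 2 ^- e in he te0.
have heq : m + (m * a + b) * te <= q.
  move: he; rewrite ltr_pdivlMr; last by lra.
  nra.
exists eta, e; split => // f n0 n1 hf hs.
have [Ne hNe] := @exists_halfX_lt R (eps / (1 + mesh)) (divr_gt0 eps0 (ltr_pwDl ltr01 m0)).
(* From this level on, the additive [ln c] between the logarithms of [D] and [Delta] is absorbed by
   the factor [1 + eta]. *)
have [N1 hN1] : exists N1 : nat, 4 * `|ln c| / eta < N1%:R.
  by exists (Num.truncn (4 * `|ln c| / eta)).+1; exact: truncnS_gt.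
have [N hN] : exists N, forall n, (N <= n)%N ->
    [/\ (n0 <= n)%N, (n1 <= n)%N, (e < n)%N, (N1 <= n)%N & (Ne <= n)%N].
  exists (maxn (maxn n0 n1) (maxn e.+1 (maxn N1 Ne))) => n.
  by rewrite !geq_max => /andP[/andP[-> ->] /andP[-> /andP[-> ->]]].
exists (Num.truncn (2 ^+ N / c3)) => x y Sx Sy /andP[xy0 xyn].
have Tx := dense_grid_rectangle Sx; have Ty := dense_grid_rectangle Sy.
have xyN : c3 * Delta gamma x y <= c3 * 2 ^- N.
  apply: (le_trans (Dlow _ _ Tx Ty)); apply: (le_trans xyn).
  rewrite -[leRHS]invrK lef_pV2 ?posrE ?invr_gt0 ?mulr_gt0 ?invr_gt0 ?exprn_gt0//.
  by rewrite invfM invrK mulrC; apply/ltW/truncnS_gt.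
clear xyn; rewrite ler_pM2l// in xyN.
have leX (i : nat) : (i <= N)%N -> 2 ^- N <= 2 ^- i :> R.
  by move=> iN; rewrite lef_pV2 ?posrE ?exprn_gt0// ler_eXn2l ?ltr1n.
have eps2 : 2 ^- Ne * (1 + mesh) <= eps by rewrite -ler_pdivlMr ?ltr_pwDl// ltW.
have De : Delta gamma x y <= eps.
  apply: (le_trans xyN); apply: (@le_trans _ _ (2 ^- Ne)); first by apply: leX; have [] := hN N (leqnn N).
  apply: le_trans eps2.
  by rewrite ler_peMr ?lerDl// invr_ge0 exprn_ge0.
have D0 : 0 < Delta gamma x y.
  rewrite lt_neqAle Delta_ge0 andbT eq_sym; apply/eqP => D0.
  by have := Dup _ _ Tx Ty De; rewrite D0 mulr0 leNgt xy0.
have [|n Nn /andP[Dn nD]] := @dyadic_scale _ (Delta gamma x y) N; first by rewrite D0.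
have [n0n n1n en N1n Nen] := hN n Nn.
have t0 : 0 < 2 ^- n :> R by rewrite invr_gt0 exprn_gt0.
have tE : 2 ^- (n + e) = 2 ^- n * te :> R by rewrite exprD invfM.
set t := 2 ^- n in t0 tE nD *.
have te1 : te <= 1 by rewrite invf_le1 ?exprn_gt0// exprn_ege1// ler1n.
have tle : t <= 2 / c3 * D x y.
  rewrite mulrAC ler_pdivlMr//; have Dl := Dlow _ _ Tx Ty.
  have t2 : t <= 2 * Delta gamma x y by move: Dn; rewrite exprS invfM -/t; lra.
  apply: (@le_trans _ _ (2 * Delta gamma x y * c3)); first by apply: ler_wpM2r => //; exact: ltW.
  by rewrite -mulrA ler_pM2l// mulrC.
have teps : mesh * (t * te) <= eps.
  have : t <= 2 ^- Ne by rewrite lef_pV2 ?posrE ?exprn_gt0// ler_eXn2l ?ltr1n.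
  move=> h; apply: le_trans eps2; rewrite mulrC; apply: ler_pM => //.
  - by apply: mulr_ge0; exact: ltW.
  - by rewrite -[leRHS]mulr1; apply: ler_pM => //; exact: ltW.
  - by rewrite lerDr.
set p := gridproj (n + e) x; set p' := gridproj (n + e) y.
have Tp : T p by exact: gridproj_rectangle. have Tp' : T p' by exact: gridproj_rectangle.
have Dp z : T z -> D z (gridproj (n + e) z) <= c * (mesh * (t * te)).
  move=> Tz; have h := Delta_gridproj gamma_gt0 lu (n + e) Tz; rewrite tE in h.
  apply: le_trans (Dup _ _ Tz _ (le_trans h teps)) _; first exact: gridproj_rectangle.
  by rewrite ler_pM2l.
have Dpp : D p p' <= D x y * (1 + a * te).
  have h1 := Dtri p x p' Tp Tx Tp'; have h2 := Dtri x y p' Tx Ty Tp'.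
  have h3 := Dp x Tx; have h4 := Dp y Ty; rewrite -/p -/p' in h3 h4.
  rewrite (Dsym p x Tp Tx) in h1.
  have w := mulr_ge0 (mulr_ge0 (mulr_ge0 (ler0n R 2) (ltW c0)) m0) (ltW te0).
  have := ler_wpM2l w tle.
  have -> : 2 * c * mesh * te * (2 / c3 * D x y) = D x y * (a * te) by rewrite /a; field; exact: lt0r_neq0.
  lra.
pose S := Num.sqrt (ln (D x y)^-1).
have S0 : 0 <= S by exact: sqrtr_ge0.
have lnD : n%:R * ln 2 <= (1 + eta) * ln (D x y)^-1.
  have h : n%:R * ln 2 - ln c <= ln (D x y)^-1.
    have Dc : D x y / c <= t.
      by rewrite ler_pdivrMr// mulrC (le_trans (Dup _ _ Tx Ty De))// ler_pM2l.
    have := @ln_dyadic n (D x y / c); rewrite divr_gt0//= Dc => /(_ isT).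
    by rewrite invfM invrK lnM ?posrE ?invr_gt0// ; lra.
  have : 4 * `|ln c| < n%:R * eta.
    by rewrite -ltr_pdivrMr//; apply: (lt_le_trans hN1); rewrite ler_nat.
  have h2 := @ln2_ge R; have := ler_norm (ln c) => h3 h4.
  have nn : 0 <= n%:R * eta by rewrite mulr_ge0 ?ler0n ?ltW.
  have h5 : n%:R * eta * 2^-1 <= n%:R * eta * ln 2 by rewrite ler_wpM2l.
  have h6 : (1 + eta) * (n%:R * ln 2 - ln c) <= (1 + eta) * ln (D x y)^-1 by rewrite ler_wpM2l//; lra.
  have h7 : (1 + eta) * ln c <= 2 * `|ln c|.
    apply: (@le_trans _ _ ((1 + eta) * `|ln c|)); first by rewrite ler_wpM2l//; lra.
    by rewrite ler_wpM2r//; lra.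
  lra.
have nln : n%:R * 2^-1 <= n%:R * ln 2 :> R by rewrite ler_wpM2l ?ler0n// ln2_ge.
have ln0 : 0 <= ln (D x y)^-1.
  have : 0 <= (1 + eta) * ln (D x y)^-1.
    by apply: le_trans lnD; apply: le_trans nln; rewrite mulr_ge0.
  by rewrite pmulr_rge0//; lra.
have sn : Num.sqrt (n + e).+1%:R <= 3 * S.
  rewrite -[3]sqrtr_sqr_pos// -sqrtrM ?sqr_ge0// ler_wsqrtr//.
  have : (n + e).+1%:R <= n%:R + n%:R :> R by rewrite -natrD ler_nat -addnS leq_add2l.
  have : (1 + eta) * ln (D x y)^-1 <= 2 * ln (D x y)^-1 by rewrite ler_wpM2r//; lra.
  lra.
have sS : Num.sqrt (2 * Q * (1 + eta) * ln 2 * n%:R) <= m * S.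
  (* One factor [1 + eta] comes from the rate in [grid_sharp], one from [lnD]; under the root they
     form a square. *)
  apply: (@le_trans _ _ (sQ * (1 + eta) * S)); last by rewrite ler_wpM2r.
  have e0 : 0 <= 1 + eta by lra.
  rewrite -[1 + eta in leRHS]sqrtr_sqr_pos// -!sqrtrM ?mulr_ge0 ?sqr_ge0// ler_wsqrtr//.
  have w : 0 <= 2 * Q * (1 + eta) by rewrite mulr_ge0// mulr_ge0.
  have := ler_wpM2l w lnD; lra.
have hx := chain_gridproj (ltW c0) hf (leq_trans n0n (leq_addr e n)) Sx.
have hy := chain_gridproj (ltW c0) hf (leq_trans n0n (leq_addr e n)) Sy.
rewrite -/p -/p' tE -/K in hx hy.
have hxy : `|f p - f p'| <= D p p' * Num.sqrt (2 * Q * (1 + eta) * ln 2 * n%:R).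
  apply: (hs n _ _ n1n); [exact: grid_gridproj|exact: grid_gridproj|].
  have := Delta_gridproj2 (n + e) Tx Ty; rewrite tE -/p -/p' => /le_trans; apply.
  have : mesh * (t * te) <= mesh * (t * 1) by rewrite ler_wpM2l// ler_pM2l.
  rewrite mulr1 -/t; lra.
have hxy2 : D p p' * Num.sqrt (2 * Q * (1 + eta) * ln 2 * n%:R) <= D x y * (1 + a * te) * (m * S).
  apply: ler_pM => //.
  by apply: le_trans (Dlow _ _ Tp Tp'); rewrite mulr_ge0 ?Delta_ge0 ?ltW.
have hK : c * K * (t * te) * Num.sqrt (n + e).+1%:R <= c * K * (2 / c3 * D x y * te) * (3 * S).
  have cK : 0 <= c * K by rewrite mulr_ge0 ?(ltW c0).
  apply: ler_pM => //.
    by apply: mulr_ge0 => //; rewrite mulr_ge0 ?ltW.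
  by apply: ler_wpM2l => //; apply: ler_wpM2r => //; exact: ltW.
have -> : f x - f y = (f x - f p) + (f p - f p') - (f y - f p') by ring.
apply: le_trans (ler_normB _ _) _; apply: le_trans (lerD (ler_normD _ _) hy) _.
have DS : 0 <= D x y * S by rewrite mulr_ge0// ltW.
have := ler_wpM2r DS heq.
have -> : (m + (m * a + b) * te) * (D x y * S) =
  D x y * (1 + a * te) * (m * S) + 2 * (c * K * (2 / c3 * D x y * te) * (3 * S)).
  by rewrite /b; field; exact: lt0r_neq0.
rewrite -/S; lra.
Qed.

End chaining.

(** * Chaining for Gaussian fields *)

Section gaussian_chaining.
Context {d : measure_display} {Omega : measurableType d} {R : realType}.
Context (P : probability Omega R) {k : nat} (gamma : 'I_k -> R) (l u : 'rV[R]_k).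
Context (H : set (Omega -> R)) (X : 'rV[R]_k -> Omega -> R).
Hypothesis gH : gaussian_space P H.
Hypothesis gamma_gt0 : forall j, 0 < gamma j.
Hypothesis lu : forall j, l 0 j < u 0 j.
Hypothesis HX : forall x, rectangle l u x -> H (X x).
Local Notation T := (rectangle l u).
Local Notation Q := (Qdim gamma).
Local Notation B := (grid_const gamma).
Let D x y := L2norm P (fun w => X x w - X y w).

Let HB x y : T x -> T y -> H (fun w => X x w - X y w).
Proof. by move=> Tx Ty; apply: (gsB gH); exact: HX. Qed.

Let large x y z : set Omega := [set w | D x y * z < `|X x w - X y w|].

Let mlarge x y z : T x -> T y -> measurable (large x y z).
Proof.
move=> Tx Ty; rewrite -[X in measurable X]setTI; apply: measurable_fun_ltr => //.
by apply: measurableT_comp => //; exact: (gs_measurable gH (HB Tx Ty)).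
Qed.

Let Plarge x y lam z : T x -> T y -> 0 < lam -> lam < 1 -> 0 <= z ->
  (P (large x y z) <= (lam^-1 * expR (- (1 - lam ^+ 2) * z ^+ 2 / 2))%:E)%E.
Proof.
move=> Tx Ty l0 l1 z0; have HXY := HB Tx Ty.
exact: (gaussian_tail (gs_measurable gH HXY) (gs_gaussian gH HXY)).
Qed.

Let powRE : 2 `^ Q = expR (Q * ln 2).
Proof. by rewrite /powR pnatr_eq0. Qed.

(** The union bound runs over all pairs of the grid, near or not, since the constant is irrelevant
    here; the tail with [lam = 2^-1] makes it geometric of ratio 1/2. *)
Lemma ae_grid_lip (c eps : R) : 0 <= c -> 0 < eps ->
  (forall x y, T x -> T y -> Delta gamma x y <= eps ->
    L2norm P (fun w => X x w - X y w) <= c * Delta gamma x y) ->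
  {ae P, forall w, exists2 n0, (0 < n0)%N & grid_lip gamma l u (X^~ w) c n0}.
Proof.
move=> c0 eps0 Xc.
have m0 := mesh_ge0 gamma l u.
have B0 : 0 <= B by exact: grid_const_ge0.
pose F n := {ffun 'I_k -> 'I_(\max_(j < k) 2 ^ depth gamma n j).+1}.
pose pt n (f : F n) := griddec l u f.
pose A n (p : F n * F n) := gridcode gamma n p.1 && gridcode gamma n p.2.
pose E n (p : F n * F n) := large (pt n p.1) (pt n p.2) (Num.sqrt (B * n%:R)).
have Tpt n (f : F n) : gridcode gamma n f -> T (pt n f).
  by move=> /(gridcode_grid gamma_gt0 lu)[].
have bc : {ae P, forall w, exists n0, forall n i, (n0 <= n)%N -> A n i -> ~ E n i w}.
  apply: (@borel_cantelli_geometric _ _ _ P (fun n => (F n * F n)%type : finType) A E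
    (fun n => 2 * expR (- ((2 * Q + 1) * ln 2) * n%:R)) (2 * (2 ^+ k) ^+ 2) 2^-1 0%N).
  - by move=> n i /andP[i1 i2]; apply: mlarge; exact: Tpt.
  - move=> n i _ /andP[i1 i2].
    have -> : 2 * expR (- ((2 * Q + 1) * ln 2) * n%:R) =
        (2^-1)^-1 * expR (- (1 - 2^-1 ^+ 2) * Num.sqrt (B * n%:R) ^+ 2 / 2) :> R.
      rewrite invrK sqr_sqrtr ?(mulr_ge0 B0 (ler0n _ _))// /grid_const.
      by congr (_ * expR _); field.
    apply: Plarge; rewrite ?sqrtr_ge0 ?invr_gt0//; [exact: Tpt|exact: Tpt|].
    by rewrite invf_lt1 ?ltr1n.
  - by rewrite mulr_ge0 ?exprn_ge0.
  - by rewrite invr_gt0 ltr0n invf_lt1 ?ltr1n.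
  - move=> n _.
    have cA : #|A n|%:R <= (2 ^+ k * (2 `^ Q) ^+ n) ^+ 2 :> R.
      rewrite (_ : #|A n| = (#|gridcode gamma n| * #|gridcode gamma n|)%N); last first.
        by rewrite -cardX; apply: eq_card => p.
      rewrite natrM -expr2 lerXn2r ?nnegrE ?mulr_ge0 ?exprn_ge0 ?powR_ge0//.
      apply: le_trans (gridsize_le gamma_gt0 n); rewrite ler_nat; exact: gridcode_card.
    apply: (@le_trans _ _ ((2 ^+ k * (2 `^ Q) ^+ n) ^+ 2 *
        (2 * expR (- ((2 * Q + 1) * ln 2) * n%:R)))).
      by rewrite ler_wpM2r// mulr_ge0// expR_ge0.
    rewrite powRE expRM_natr exprMn -[(_ ^+ n) ^+ 2]exprM mulnC exprM.
    rewrite (_ : expR (Q * ln 2) ^+ 2 = expR (2 * (Q * ln 2))); last by rewrite expRM_natl.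
    rewrite mulrCA -!mulrA ler_pM2l// ler_pM2l ?exprn_gt0// -exprMn -expRD.
    rewrite (_ : 2 * (Q * ln 2) + _ = - ln 2); last by ring.
    by rewrite expRN lnK ?posrE.
have m1 : 0 < 1 + 4 * mesh gamma l u by lra.
have [Ne hNe] := exists_halfX_lt (divr_gt0 eps0 m1).
apply: filterS bc => w [n0 hw].
exists (maxn 1 (maxn n0 Ne)); first by rewrite leq_max.
move=> n p q; rewrite !geq_max => /andP[_ /andP[n0n Nen]] gp gq Dpq.
have Tp := gp.1; have Tq := gq.1.
have De : Delta gamma p q <= eps.
  apply: le_trans Dpq _; rewrite mulrC -ler_pdivlMr// (le_trans _ (ltW hNe))//.
  by rewrite lef_pV2 ?posrE ?exprn_gt0// ler_eXn2l ?ltr1n.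
apply: (@le_trans _ _ (D p q * Num.sqrt (B * n%:R))); last first.
  by rewrite ler_wpM2r ?sqrtr_ge0// Xc.
have [f cf pE] := grid_gridcode lu gp.
have [g cg qE] := grid_gridcode lu gq.
have Afg : A n (f, g) by apply/andP.
have /negP := hw n (f, g) n0n Afg.
by rewrite -leNgt /pt -pE -qE.
Qed.

(** Only near pairs are counted, of order [2 ^ (Q n)], against a tail of order
    [2 ^ (- (1 + eta / 2) Q n)]; what remains is geometric of ratio [2 ^ (- eta Q / 2)]. *)
Lemma ae_grid_sharp (e : nat) (eta : R) : (0 < k)%N -> 0 < eta ->
  {ae P, forall w, exists n1, grid_sharp gamma l u
    (fun x y => L2norm P (fun w => X x w - X y w)) e (2 * Q * (1 + eta) * ln 2) (X^~ w) n1}.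
Proof.
move=> k0 eta0.
have m0 := mesh_ge0 gamma l u; have Q0 := Qdim_ge0 gamma_gt0.
have Qp : 0 < Q by exact: Qdim_gt0.
have ln20 : 0 < ln 2 :> R by have := @ln2_ge R; lra.
pose F n := {ffun 'I_k -> 'I_(\max_(j < k) 2 ^ depth gamma (n + e) j).+1}.
pose pt n (f : F n) := griddec l u f.
have m1 : 0 <= 1 + 2 * mesh gamma l u by lra.
have [N hN] := gridcode_near_card gamma_gt0 lu e m1.
pose A n (p : F n * F n) := [&& gridcode gamma (n + e) p.1, gridcode gamma (n + e) p.2 &
  Delta gamma (pt n p.1) (pt n p.2) <= (1 + 2 * mesh gamma l u) * 2 ^- n].
pose r := 2 * Q * (1 + eta) * ln 2.
have r0 : 0 <= r by rewrite /r; apply: mulr_ge0; [apply: mulr_ge0; [exact: mulr_ge0|lra]|exact: ltW].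
pose E n (p : F n * F n) := large (pt n p.1) (pt n p.2) (Num.sqrt (r * n%:R)).
have Tpt n (f : F n) : gridcode gamma (n + e) f -> T (pt n f).
  by move=> /(gridcode_grid gamma_gt0 lu)[].
(* Solves [(1 - lam2) * (1 + eta) = 1 + eta / 2]: the tail estimate loses half of the margin
   [eta]. *)
pose lam2 := (eta / 2) / (1 + eta).
have lam2_itv : 0 < lam2 < 1.
  have e1 : 0 < 1 + eta by lra.
  by rewrite /lam2 ltr_pdivrMr// mul1r; apply/andP; split; [apply: divr_gt0|]; lra.
have /andP[lam20 lam21] := lam2_itv.
pose lam := Num.sqrt lam2.
have lamE : lam ^+ 2 = lam2 by rewrite sqr_sqrtr// ltW.
have lam0 : 0 < lam by rewrite sqrtr_gt0.
have lam1 : lam < 1 by rewrite -sqrtr1 ltr_sqrt.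
have etap : 1 + eta != 0 by apply: lt0r_neq0; lra.
have bc : {ae P, forall w, exists n0, forall n i, (n0 <= n)%N -> A n i -> ~ E n i w}.
  apply: (@borel_cantelli_geometric _ _ _ P (fun n => (F n * F n)%type : finType) A E
    (fun n => lam^-1 * expR (- ((1 + eta / 2) * Q * ln 2) * n%:R))
    (2 ^+ k * (2 `^ Q) ^+ e * N%:R * lam^-1) (expR (- (eta / 2 * Q * ln 2))) 0%N).
  - by move=> n i /and3P[i1 i2 _]; apply: mlarge; exact: Tpt.
  - move=> n i _ /and3P[i1 i2 _].
    have -> : lam^-1 * expR (- ((1 + eta / 2) * Q * ln 2) * n%:R) =
        lam^-1 * expR (- (1 - lam ^+ 2) * Num.sqrt (r * n%:R) ^+ 2 / 2) :> R.
      rewrite lamE sqr_sqrtr ?(mulr_ge0 r0 (ler0n _ _))// /r /lam2.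
      by congr (_ * expR _); field.
    by apply: Plarge; rewrite ?sqrtr_ge0//; exact: Tpt.
  - by apply: mulr_ge0; [apply: mulr_ge0; [apply: mulr_ge0|]|]; rewrite ?exprn_ge0 ?powR_ge0 ?invr_ge0 ?(ltW lam0).
  - by rewrite expR_gt0 expR_lt1 oppr_lt0; apply: mulr_gt0 => //; apply: mulr_gt0 => //; lra.
  - move=> n _.
    have cA : #|A n|%:R <= 2 ^+ k * (2 `^ Q) ^+ (n + e) * N%:R :> R.
      apply: (@le_trans _ _ (gridsize gamma (n + e) * N)%:R).
        rewrite ler_nat; apply: leq_trans (hN n); apply: subset_leq_card.
        by apply/fintype.subsetP => p /and3P[i1 _ i2]; apply/andP.
      by rewrite natrM ler_wpM2r// gridsize_le.
    apply: (@le_trans _ _ (2 ^+ k * (2 `^ Q) ^+ (n + e) * N%:R *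
        (lam^-1 * expR (- ((1 + eta / 2) * Q * ln 2) * n%:R)))).
      by rewrite ler_wpM2r// mulr_ge0 ?expR_ge0// invr_ge0 ltW.
    rewrite exprD (_ : expR (- (eta / 2 * Q * ln 2)) = 2 `^ Q * expR (- ((1 + eta / 2) * Q * ln 2))).
      by rewrite expRM_natr exprMn le_eqVlt; apply/orP; left; apply/eqP; ring.
    by rewrite powRE -expRD; congr expR; field.
apply: filterS bc => w [n0 hw]; exists n0 => n p q n0n gp gq Dpq.
have [f cf pE] := grid_gridcode lu gp.
have [g cg qE] := grid_gridcode lu gq.
have Afg : A n (f, g) by apply/and3P; split; rewrite // /pt /= -pE -qE.
have /negP := hw n (f, g) n0n Afg.
by rewrite -leNgt /pt -pE -qE.
Qed.

Lemma ae_modulus_Delta (c eps : R) : 0 <= c -> 0 < eps ->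
  (forall x y, T x -> T y -> Delta gamma x y <= eps ->
    L2norm P (fun w => X x w - X y w) <= c * Delta gamma x y) ->
  {ae P, forall w, modulus_le (dense_grid gamma l u) (Delta gamma)
    (c * crude_const gamma l u) (X^~ w)}.
Proof.
move=> c0 eps0 Xc; apply: filterS (ae_grid_lip c0 eps0 Xc) => w [n0 n00 hw].
exact: (grid_lip_modulus gamma_gt0 lu c0 n00 hw).
Qed.

Lemma ae_modulus_norm (c c3 eps q : R) : (0 < k)%N -> 0 < c -> 0 < c3 -> 0 < eps ->
  (forall x y, T x -> T y ->
    c3 * Delta gamma x y <= L2norm P (fun w => X x w - X y w)) ->
  (forall x y, T x -> T y -> Delta gamma x y <= eps ->
    L2norm P (fun w => X x w - X y w) <= c * Delta gamma x y) ->
  Num.sqrt (2 * Q) < q ->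
  {ae P, forall w, modulus_le (dense_grid gamma l u)
    (fun x y => L2norm P (fun w => X x w - X y w)) q (X^~ w)}.
Proof.
move=> k0 c0 c30 eps0 Dlow Dup qQ.
have [||eta [e [eta0 eta1 h]]] := grid_sharp_modulus gamma_gt0 lu _ _ c0 c30 eps0 Dlow Dup qQ.
- move=> x y z Tx Ty Tz.
  rewrite (@eq_L2norm _ _ _ _ _ (fun w => (X x w - X y w) + (X y w - X z w))); last first.
    by move=> w; rewrite addrA subrK.
  by apply: L2norm_triangle; apply: (gs_sqint gH); exact: HB.
- move=> x y Tx Ty; rewrite -L2normN; apply: eq_L2norm => w; by rewrite opprB.
have h1 := ae_grid_lip (ltW c0) eps0 Dup; have h2 := ae_grid_sharp e k0 eta0.
apply: filterS2 h1 h2 => w [n0 _ hl] [n1 hs].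
exact: h hl hs.
Qed.

End gaussian_chaining.

(** * Moduli of continuity *)

Section modulus_theory.
Context {R : realType} {k : nat}.
Implicit Types (S : set 'rV[R]_k) (D : 'rV[R]_k -> 'rV[R]_k -> R) (f g : 'rV[R]_k -> R).

Lemma exists_invn_le (e : R) : 0 < e -> exists n : nat, n.+1%:R^-1 <= e.
Proof.
move=> e0; exists (Num.truncn e^-1).
by rewrite invf_ple ?posrE ?ltr0n// ltW// truncnS_gt.
Qed.

Lemma le_invn (m n : nat) : (m <= n)%N -> n.+1%:R^-1 <= m.+1%:R^-1 :> R.
Proof. by move=> mn; rewrite lef_pV2 ?posrE ?ltr0n// ler_nat. Qed.

Lemma modulus_le_mono S D q q' f : q <= q' -> modulus_le S D q f -> modulus_le S D q' f.
Proof.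
move=> qq' [n hn]; exists n => x y Sx Sy xy; apply: le_trans (hn _ _ Sx Sy xy) _.
by rewrite ler_wpM2r// mulr_ge0 ?sqrtr_ge0//; case/andP: xy => /ltW.
Qed.

Lemma modulus_leD S D q q' f g : modulus_le S D q f -> modulus_le S D q' g ->
  modulus_le S D (q + q') (fun x => f x + g x).
Proof.
move=> [n hn] [m hm]; exists (maxn n m) => x y Sx Sy /andP[xy0 xyn].
have h1 := hn x y Sx Sy; rewrite xy0 (le_trans xyn (le_invn (leq_maxl n m))) in h1.
have h2 := hm x y Sx Sy; rewrite xy0 (le_trans xyn (le_invn (leq_maxr n m))) in h2.
rewrite opprD addrACA mulrDl; apply: le_trans (ler_normD _ _) _.
by rewrite lerD ?h1 ?h2.
Qed.

Lemma eq_modulus_le S D q f g : (forall x, S x -> f x = g x) ->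
  modulus_le S D q f -> modulus_le S D q g.
Proof. by move=> fg [n hn]; exists n => x y Sx Sy; rewrite -!fg//; exact: hn. Qed.

(** At small scales the logarithms of comparable distances differ by a bounded term, absorbed by a
    factor [1 + eta]. Hence the constant changes only by [a], and the strict inequality [a * q < q']
    provides [eta]. *)
Lemma modulus_le_compare S D1 D2 (a b eps q q' : R) f :
  0 < a -> 0 < b -> 0 < eps -> 0 <= q ->
  (forall x y, S x -> S y -> D1 x y <= eps -> b * D1 x y <= D2 x y <= a * D1 x y) ->
  a * q < q' -> modulus_le S D2 q f -> modulus_le S D1 q' f.
Proof.
move=> a0 b0 eps0 q0 D12 qq' [n hn].
have aq0 : 0 <= a * q by rewrite mulr_ge0// ltW.
pose eta := (q' - a * q) / (a * q + 1).
have eta0 : 0 < eta by rewrite divr_gt0//; lra.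
have heta : a * q * (1 + eta) <= q'.
  have e1 : eta * (a * q + 1) = q' - a * q by rewrite divfK// lt0r_neq0//; lra.
  lra.
have e1 : 0 < expR (- (`|ln b| / eta)) :> R by exact: expR_gt0.
have e2 : 0 < n.+1%:R^-1 / a :> R by rewrite divr_gt0// invr_gt0 ltr0n.
have [m hm] : exists m : nat, [/\ m.+1%:R^-1 <= eps, a * m.+1%:R^-1 <= n.+1%:R^-1 &
    m.+1%:R^-1 <= expR (- (`|ln b| / eta))].
  have [m1 h1] := exists_invn_le eps0; have [m2 h2] := exists_invn_le e1.
  have [m3 h3] := exists_invn_le e2.
  exists (maxn m1 (maxn m2 m3)); split.
  - exact: le_trans (le_invn (leq_maxl _ _)) h1.
  - rewrite mulrC -ler_pdivlMr//; apply: le_trans (le_invn _) h3.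
    by rewrite !leq_max leqnn !orbT.
  - by apply: le_trans (le_invn _) h2; rewrite !leq_max leqnn !orbT.
case: hm => m1 m2 m3.
exists m => x y Sx Sy /andP[xy0 xym].
have /andP[D1b D2a] := D12 x y Sx Sy (le_trans xym m1).
have D20 : 0 < D2 x y by apply: lt_le_trans D1b; rewrite mulr_gt0.
have D2n : D2 x y <= n.+1%:R^-1.
  by apply: le_trans D2a _; apply: le_trans m2; rewrite ler_pM2l.
have h := hn x y Sx Sy; rewrite D20 D2n in h.
apply: le_trans (h isT) _.
have lnD : ln (D2 x y)^-1 <= (1 + eta) * ln (D1 x y)^-1.
  have h1 : ln (D2 x y)^-1 <= ln (b * D1 x y)^-1.
    by rewrite ler_ln ?posrE ?invr_gt0 ?mulr_gt0// lef_pV2 ?posrE ?mulr_gt0.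
  rewrite invfM lnM ?posrE ?invr_gt0// [ln b^-1]lnV ?posrE// in h1.
  have h2 : `|ln b| / eta <= ln (D1 x y)^-1.
    rewrite lnV ?posrE// lerNr -[leRHS]expRK ler_ln ?posrE ?expR_gt0//.
    exact: le_trans xym m3.
  rewrite ler_pdivrMr// in h2; have nb := ler_norm (- ln b); rewrite normrN in nb; lra.
have s1 : Num.sqrt (ln (D2 x y)^-1) <= (1 + eta) * Num.sqrt (ln (D1 x y)^-1).
  have e10 : 0 <= 1 + eta by lra.
  rewrite -[1 + eta]sqrtr_sqr_pos// -sqrtrM ?sqr_ge0//.
  have [l0|l0] := leP 0 (ln (D1 x y)^-1); last first.
    rewrite !ler0_sqrtr//; first by rewrite ltW// pmulr_rlt0// exprn_gt0//; lra.
    by apply: le_trans lnD _; rewrite ltW// pmulr_rlt0//; lra.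
  apply: ler_wsqrtr; apply: le_trans lnD _; rewrite ler_wpM2r// expr2 ler_peMr//; lra.
have s0 := @sqrtr_ge0 _ (ln (D1 x y)^-1).
apply: (@le_trans _ _ (q * (a * D1 x y * ((1 + eta) * Num.sqrt (ln (D1 x y)^-1))))).
  by apply: ler_wpM2l => //; apply: ler_pM => //; exact: ltW.
have w : 0 <= D1 x y * Num.sqrt (ln (D1 x y)^-1) by apply: mulr_ge0 => //; exact: ltW.
have := ler_wpM2r w heta; lra.
Qed.

(** The upper bound is needed on all of [T], but failure of the bound on the subset [S] already
    supplies, at every scale, pairs whose quotient exceeds [kap - e]. *)
Lemma modulus_cvg (T S : set 'rV[R]_k) D f (kap : R) : S `<=` T ->
  (forall q, kap < q -> exists n : nat, forall x y, T x -> T y -> 0 < D x y < n.+1%:R^-1 ->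
     `|f x - f y| <= q * (D x y * Num.sqrt (ln (D x y)^-1))) ->
  (forall q, q < kap -> ~ modulus_le S D q f) ->
  modulus T D f r @[r --> 0^'+] --> kap%:E.
Proof.
move=> ST up low.
have bounds (e : R) : 0 < e -> \forall r \near 0^'+,
    ((kap - e)%:E <= modulus T D f r <= (kap + e)%:E)%E.
  move=> e0; have [|n hn] := up (kap + e); first by rewrite ltrDl.
  near=> r.
  have r0 : 0 < r by near: r; exact: nbhs_right_gt.
  have rn : r < n.+1%:R^-1 by near: r; apply: nbhs_right_lt; rewrite invr_gt0 ltr0n.
  have r1 : r < 1 by apply: lt_le_trans rn _; rewrite invf_le1 ?ltr0n// ler1n.
  have omega0 x y : 0 < D x y <= r -> 0 < D x y * Num.sqrt (ln (D x y)^-1).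
    move=> /andP[xy0 xyr]; rewrite mulr_gt0// sqrtr_gt0 ln_gt0// invf_gt1//.
    exact: le_lt_trans xyr r1.
  apply/andP; split.
    have [j hj] := exists_invn_le r0.
    have := low (kap - e); rewrite ltrBlDr ltrDl => /(_ e0) nm.
    have [[x y] /= [Sx Sy xy fxy]] : exists p : 'rV[R]_k * 'rV[R]_k,
        [/\ S p.1, S p.2, 0 < D p.1 p.2 <= j.+1%:R^-1 &
         (kap - e) * (D p.1 p.2 * Num.sqrt (ln (D p.1 p.2)^-1)) < `|f p.1 - f p.2|].
      apply: contrapT => hne; apply: nm; exists j => x y Sx Sy xy; rewrite leNgt; apply/negP => h.
      by apply: hne; exists (x, y).
    have xyr : 0 < D x y <= r by case/andP: xy => -> /= /le_trans; exact.
    apply: (@le_trans _ _ (`|f x - f y| / (D x y * Num.sqrt (ln (D x y)^-1)))%:E).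
      by rewrite lee_fin ler_pdivlMr ?omega0// ltW.
    by apply: ereal_sup_ubound; exists (x, y) => //; split => //; exact: ST.
  apply: ub_ereal_sup => _ [[x y] /= [Tx Ty xyr] <-].
  rewrite lee_fin ler_pdivrMr ?omega0//; apply: hn => //.
  by case/andP: xyr => -> /= /le_lt_trans; exact.
apply/fine_cvgP; split.
  near=> r.
  have /andP[h1 h2] : ((kap - 1)%:E <= modulus T D f r <= (kap + 1)%:E)%E.
    by near: r; exact: bounds.
  rewrite fin_numElt (lt_le_trans (ltNyr _) h1)/=.
  exact: le_lt_trans h2 (ltry _).
apply/cvgrPdist_le => e e0; near=> r.
have /andP[h1 h2] : ((kap - e)%:E <= modulus T D f r <= (kap + e)%:E)%E.
  by near: r; exact: bounds.
have fm : modulus T D f r \is a fin_num.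
  rewrite fin_numElt (lt_le_trans (ltNyr _) h1)/=.
  exact: le_lt_trans h2 (ltry _).
rewrite /= distrC ler_distl; move: h1 h2; rewrite -(fineK fm) !lee_fin => -> ->//.
Unshelve. all: by end_near. Qed.

End modulus_theory.

(** * From the dense grid to the rectangle *)

Section density.
Context {R : realType} {k : nat} (gamma : 'I_k -> R) (l u : 'rV[R]_k).
Hypothesis gamma_gt0 : forall j, 0 < gamma j.
Hypothesis lu : forall j, l 0 j < u 0 j.
Local Notation T := (rectangle l u).
Local Notation gridproj := (gridproj gamma l u).
Local Notation dense_grid := (dense_grid gamma l u).
Implicit Types (x : 'rV[R]_k).

Lemma cvg_gridproj x : T x -> gridproj n x @[n --> \oo] --> x.
Proof.
move=> Tx; apply/cvg_ballP => e e0.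
pose M := \sum_j (u 0 j - l 0 j).
have L0 j : 0 < u 0 j - l 0 j by rewrite subr_gt0.
have M0 : 0 <= M by apply: sumr_ge0 => j _; exact: ltW.
have [N hN] : exists N : nat, 2 ^- N < e / (M + 1).
  by apply: exists_halfX_lt; rewrite divr_gt0// ltr_wpDl.
near=> n; split => // i j; rewrite /ball/= ord1.
apply: le_lt_trans (gridproj_coord gamma lu n j Tx) _.
have le1 : (u 0 j - l 0 j) / 2 ^+ depth gamma n j <= (u 0 j - l 0 j) * 2 ^- N.
  rewrite ler_wpM2l ?(ltW (L0 j))// lef_pV2 ?posrE ?exprn_gt0// ler_eXn2l ?ltr1n//.
  apply: (@leq_trans n); first by near: n; exact: nbhs_infty_ge.
  by rewrite /depth truncn_ge_nat ?mulr_ge0 ?addr_ge0 ?(ltW (gamma_gt0 j))// ler_peMr// lerDr ltW.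
apply: le_lt_trans le1 _; rewrite ltr_pdivlMr ?ltr_wpDl// in hN.
apply: le_lt_trans hN; rewrite mulrC ler_wpM2l ?invr_ge0 ?exprn_ge0//.
rewrite (@le_trans _ _ M)// ?lerDl// /M (bigD1 j)//= lerDl.
by apply: sumr_ge0 => i0 _; exact: ltW.
Unshelve. all: by end_near. Qed.

(** Both sides of the inequality are continuous along the projections of [x] and [y]. The strict
    bound on [D x y] in the conclusion leaves room for the approximating pairs to satisfy the
    non-strict one. *)
Lemma modulus_le_rectangle (D : 'rV[R]_k -> 'rV[R]_k -> R) (C q : R) N f :
  (forall x y z, T x -> T y -> T z -> D x z <= D x y + D y z) ->
  (forall x y, T x -> T y -> D x y = D y x) ->
  (forall x n, (N <= n)%N -> T x -> D x (gridproj n x) <= C * 2 ^- n) ->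
  continuous f -> modulus_le dense_grid D q f ->
  exists n : nat, forall x y, T x -> T y -> 0 < D x y < n.+1%:R^-1 ->
    `|f x - f y| <= q * (D x y * Num.sqrt (ln (D x y)^-1)).
Proof.
move=> Dtri Dsym DC cf [n hn]; exists n => x y Tx Ty /andP[xy0 xyn].
have Dcvg : D (gridproj m x) (gridproj m y) @[m --> \oo] --> D x y.
  apply/cvgrPdist_le => e e0.
  have C0 : 0 < `|C| + 1 by rewrite ltr_wpDl.
  have [M hM] : exists M : nat, 2 ^- M < e / (2 * (`|C| + 1)).
    by apply: exists_halfX_lt; rewrite divr_gt0// mulr_gt0.
  near=> m.
  have Nm : (N <= m)%N by near: m; exact: nbhs_infty_ge.
  have Mm : (M <= m)%N by near: m; exact: nbhs_infty_ge.
  have Cm : C * 2 ^- m <= e / 2.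
    rewrite ltr_pdivlMr ?mulr_gt0// in hM.
    have t0 : 0 < 2 ^- m :> R by rewrite invr_gt0 exprn_gt0.
    have tt : 2 ^- m <= 2 ^- M :> R by rewrite lef_pV2 ?posrE ?exprn_gt0// ler_eXn2l ?ltr1n.
    have h1 : C * 2 ^- m <= (`|C| + 1) * 2 ^- m.
      by rewrite ler_wpM2r ?(ltW t0)// (le_trans (ler_norm C))// lerDl.
    have h2 : (`|C| + 1) * 2 ^- m <= (`|C| + 1) * 2 ^- M by rewrite ler_pM2l.
    lra.
  have Tpx : T (gridproj m x) by exact: gridproj_rectangle.
  have Tpy : T (gridproj m y) by exact: gridproj_rectangle.
  have h1 := DC x m Nm Tx; have h2 := DC y m Nm Ty.
  have h3 := Dtri _ _ _ Tpx Tx Tpy; have h4 := Dtri _ _ _ Tx Ty Tpy.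
  have h5 := Dtri _ _ _ Tx Tpx Ty; have h6 := Dtri _ _ _ Tpx Tpy Ty.
  rewrite (Dsym _ _ Tpx Tx) in h3; rewrite (Dsym _ _ Tpy Ty) in h6.
  rewrite /= ler_distl; apply/andP; split; lra.
have fcvg : `|f (gridproj m x) - f (gridproj m y)| @[m --> \oo] --> `|f x - f y|.
  have h z : T z -> f (gridproj m z) @[m --> \oo] --> f z.
    by move=> Tz; apply: (cvg_comp _ _ (cvg_gridproj Tz) (cf z)).
  by apply: cvg_norm; apply: cvgB; exact: h.
have ocvg : q * (D (gridproj m x) (gridproj m y) *
    Num.sqrt (ln (D (gridproj m x) (gridproj m y))^-1)) @[m --> \oo] -->
    q * (D x y * Num.sqrt (ln (D x y)^-1)).
  apply: cvgM; first exact: cvg_cst.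
  apply: cvgM; first exact: Dcvg.
  have Di : (D (gridproj m x) (gridproj m y))^-1 @[m --> \oo] --> (D x y)^-1.
    by apply: cvgV => //; exact: lt0r_neq0.
  have xyi : 0 < (D x y)^-1 by rewrite invr_gt0.
  have Dl := cvg_comp _ _ Di (continuous_ln xyi).
  exact: (cvg_comp _ _ Dl (@sqrt_continuous R _)).
apply: (ler_cvg_to fcvg ocvg).
near=> m; apply: hn.
- by exists m; exact: grid_gridproj.
- by exists m; exact: grid_gridproj.
apply/andP; split.
  near: m; exact: (cvgr_gt _ Dcvg).
by near: m; exact: (cvgr_le _ Dcvg).
Unshelve. all: by end_near. Qed.

End density.

(** * The noise decomposition *)

Section gaussian_space_zero.
Context {d : measure_display} {Omega : measurableType d} {R : realType}.
Variable P : probability Omega R.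

Lemma gs_norm0_ae (H : set (Omega -> R)) X : gaussian_space P H -> H X ->
  L2norm P X = 0 -> {ae P, forall w, X w = 0}.
Proof.
move=> gH HX X0; have mX := gs_measurable gH HX.
have [_ [[_ lX]|[]]] := gaussian_law mX (gs_gaussian gH HX); last by rewrite X0 ltxx.
exact: dirac_law_ae.
Qed.

End gaussian_space_zero.

Section Ico.
Context {R : realType}.
Implicit Types (a b c : R).

Lemma measurable_Ico a (b : \bar R) : measurable (Ico a b).
Proof.
case: b => [b| |].
- rewrite (_ : Ico a _ = `[a, b[%classic); first exact: measurable_itv.
  by apply/seteqP; split => t; rewrite /Ico /= in_itv/= lte_fin => /andP.
- rewrite (_ : Ico a _ = `[a, +oo[%classic); first exact: measurable_itv.
  apply/seteqP; split => t; rewrite /Ico /= in_itv/= andbT; first by case.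
  by move=> ->; rewrite ltry.
- rewrite (_ : Ico a _ = set0); first exact: measurable0.
  by apply/seteqP; split => t // [_].
Qed.

Lemma borel_Ico a (b : \bar R) : 0 <= a -> borel_Rplus (Ico a b).
Proof. by move=> a0; split; [exact: measurable_Ico|move=> t [/(le_trans a0)]]. Qed.

Lemma Ico_cat a b (c : \bar R) : a <= b -> (b%:E <= c)%E ->
  Ico a b%:E `|` Ico b c = Ico a c.
Proof.
move=> ab bc; apply/seteqP; split => t.
  case=> -[h1 h2]; split => //; first exact: lt_le_trans bc.
  exact: le_trans h1.
by case=> h1 h2; have [tb|bt] := ltP t b; [left|right]; split => //; rewrite lte_fin.
Qed.

Lemma Ico_disj a b (c : \bar R) : Ico a b%:E `&` Ico b c = set0.
Proof.
apply/seteqP; split => t // [[_ +] [+ _]]; rewrite lte_fin => h1 h2.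
by have := lt_le_trans h1 h2; rewrite ltxx.
Qed.

Lemma Ico0y : Ico (0 : R) +oo%E = [set t | 0 <= t].
Proof. by apply/seteqP; split => t; [case|move=> t0; split => //; exact: ltry]. Qed.

Lemma Icoaa a : Ico a a%:E = set0.
Proof. by apply/seteqP; split => t // [h1]; rewrite lte_fin ltNge h1. Qed.

End Ico.

Section noise.
Context {d : measure_display} {Omega : measurableType d} {R : realType}.
Context (P : probability Omega R) {k : nat} (T : set 'rV[R]_k).
Context (W : set R -> 'rV[R]_k -> {RV P >-> R}).
Let J : set (set R * 'rV[R]_k) := [set p | borel_Rplus p.1 /\ T p.2].
Hypothesis gW : centered_gaussian_field J (fun p : set R * 'rV[R]_k => W p.1 p.2).
Hypothesis W_sigma_additive : forall x (A : nat -> set R), T x ->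
  (forall i, borel_Rplus (A i)) -> trivIset setT A ->
  L2norm P (fun w => W (\bigcup_i A i) x w - \sum_(i < n) W (A i) x w)
    @[n --> \oo] --> (0 : R).
Implicit Types (A B : set R) (x y : 'rV[R]_k).

Definition noise_space : set (Omega -> R) :=
  gspan J (fun p : set R * 'rV[R]_k => W p.1 p.2).

Lemma noise_gaussian : gaussian_space P noise_space.
Proof. exact: gspan_gaussian. Qed.

Lemma noise_mem A x : borel_Rplus A -> T x -> noise_space (W A x).
Proof.
move=> bA Tx; exact: (@gspan_mem _ _ _ _ _ J (fun p : set R * 'rV[R]_k => W p.1 p.2) (A, x)).
Qed.

Let gH := noise_gaussian.

Lemma borel_Rplus0 : borel_Rplus (set0 : set R). Proof. by split; [exact: measurable0|]. Qed.

(** Along the constant empty sequence, additivity makes [|1 - n|] times the norm tend to 0, while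
    [|1 - n| >= 1] for [n >= 2]. *)
Lemma noise_set0 x : T x -> {ae P, forall w, W set0 x w = 0}.
Proof.
move=> Tx; have HW := noise_mem borel_Rplus0 Tx.
apply: (gs_norm0_ae gH HW); apply/eqP; rewrite eq_le L2norm_ge0 andbT.
have tr : trivIset setT (fun _ : nat => set0 : set R) by move=> i j _ _ [t []].
have c0 := W_sigma_additive Tx (fun=> borel_Rplus0) tr.
apply: (ler_cvg_to (cvg_cst (L2norm P (W set0 x))) c0).
near=> n; rewrite bigcup0//.
have -> : L2norm P (fun w => W set0 x w - \sum_(i < n) W set0 x w) =
   `|1 - n%:R| * L2norm P (W set0 x).
  rewrite -L2normZ; last exact: (gs_sqint gH HW).
  apply: eq_L2norm => w.
  by rewrite sumr_const card_ord mulrBl mul1r mulr_natl.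
rewrite ler_peMl ?L2norm_ge0// distrC ler_normr.
have : 2 <= n%:R :> R by rewrite ler_nat; near: n; exact: nbhs_infty_ge.
by move=> h; apply/orP; left; lra.
Unshelve. all: by end_near. Qed.

Lemma noise_setU A B x : T x -> borel_Rplus A -> borel_Rplus B -> A `&` B = set0 ->
  {ae P, forall w, W (A `|` B) x w = W A x w + W B x w}.
Proof.
move=> Tx bA bB AB.
have bAB : borel_Rplus (A `|` B).
  by split; [exact: measurableU bA.1 bB.1|move=> t [/bA.2|/bB.2]].
have HA := noise_mem bA Tx; have HB := noise_mem bB Tx; have HAB := noise_mem bAB Tx.
pose Z w := W (A `|` B) x w - (W A x w + W B x w).
have HZ : noise_space Z by apply: (gsB gH) => //; exact: (gsD gH).
have Z0 : L2norm P Z = 0.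
  apply/eqP; rewrite eq_le L2norm_ge0 andbT.
  have bC i : borel_Rplus (bigcup2 A B i).
    by rewrite /bigcup2; case: i => [|[|i]] //=; exact: borel_Rplus0.
  have tr : trivIset setT (bigcup2 A B) by rewrite -trivIset_bigcup2.
  have c0 := W_sigma_additive Tx bC tr.
  apply: (ler_cvg_to (cvg_cst (L2norm P Z)) c0).
  near=> n; rewrite bigcup2E.
  have n2 : (2 <= n)%N by near: n; exact: nbhs_infty_ge.
  rewrite le_eqVlt; apply/orP; left; apply/eqP; apply: ae_eq_L2norm.
  - exact: (gs_measurable gH HZ).
  - apply: measurable_funB => //; apply: measurable_sum => i //.
  - apply: filterS (noise_set0 Tx) => w W0; rewrite /Z; congr (_ - _).
    rewrite -(subnKC n2) big_split_ord/= !big_ord_recl big_ord0 addr0 big1 ?addr0//.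
apply: filterS (gs_norm0_ae gH HZ Z0) => w /eqP; rewrite subr_eq0 => /eqP //.
Unshelve. all: by end_near. Qed.

Lemma noise_split (a b : R) (c : \bar R) x : T x -> 0 <= a -> a <= b -> (b%:E <= c)%E ->
  {ae P, forall w, W (Ico a c) x w = W (Ico a b%:E) x w + W (Ico b c) x w}.
Proof.
move=> Tx a0 ab bc; rewrite -(Ico_cat ab bc); apply: noise_setU => //.
- exact: borel_Ico.
- by apply: borel_Ico; exact: le_trans ab.
- exact: Ico_disj.
Qed.

Context (v : 'rV[R]_k -> {RV P >-> R}).
Hypothesis v_total : forall x, T x -> {ae P, forall w, W [set t | 0 <= t] x w = v x w}.

Lemma noise_total (a : R) x : T x -> 0 <= a ->
  {ae P, forall w, v x w = W (Ico 0 a%:E) x w + W (Ico a +oo%E) x w}.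
Proof.
move=> Tx a0; have h := noise_split Tx (lexx 0) a0 (leey a%:E).
rewrite Ico0y in h; have h2 := v_total Tx.
by apply: filterS2 h h2 => w <- ->.
Qed.

Lemma noise_cvg x : T x ->
  L2norm P (fun w => v x w - W (Ico 0 n%:R%:E) x w) @[n --> \oo] --> (0 : R).
Proof.
move=> Tx; pose A (i : nat) : set R := Ico i%:R i.+1%:R%:E.
have bA i : borel_Rplus (A i) by exact: borel_Ico.
have tA : trivIset setT A.
  move=> i j _ _ [t [[h1 h2] [h3 h4]]]; move: h2 h4; rewrite !lte_fin => h2 h4.
  have := le_lt_trans h1 h4; have := le_lt_trans h3 h2; rewrite !ltr_nat !ltnS => ij ji.
  by apply/eqP; rewrite eqn_leq ij ji.
have AU : \bigcup_i A i = [set t | 0 <= t].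
  apply/seteqP; split => t; first by move=> [i _ [h _]]; exact: le_trans h.
  move=> /= t0; exists (Num.truncn t) => //; have /andP[h1 h2] := truncn_itv t0.
  by split => //; rewrite lte_fin.
have Asum n : {ae P, forall w, W (Ico 0 n%:R%:E) x w = \sum_(i < n) W (A i) x w}.
  elim: n => [|n IH].
    by rewrite Icoaa; apply: filterS (noise_set0 Tx) => w ->; rewrite big_ord0.
  have h : {ae P, forall w, W (Ico 0 n.+1%:R%:E) x w =
      W (Ico 0 n%:R%:E) x w + W (A n) x w}.
    by apply: noise_split => //; rewrite lee_fin ler_nat.
  by apply: filterS2 h IH => w -> ->; rewrite big_ord_recr.
have := W_sigma_additive Tx bA tA; rewrite AU; apply: cvg_trans; apply: near_eq_cvg.
near=> n; apply: ae_eq_L2norm.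
- by apply: measurable_funB => //; apply: measurable_sum => i.
- exact: measurable_funB.
- by have h := v_total Tx; apply: filterS2 (Asum n) h => w -> ->.
Unshelve. all: by end_near. Qed.

Context (gamma : 'I_k -> R) (c0 a0 : R).
Hypotheses (c0_gt0 : 0 < c0) (a0_ge0 : 0 <= a0) (gamma_gt0 : forall j, 0 < gamma j).
Hypothesis W_tail : forall (a : R) (b : \bar R) (x y : 'rV[R]_k),
  a0 <= a -> (a%:E < b)%E -> T x -> T y ->
  L2norm P (fun w => W (Ico a b) x w - v x w - W (Ico a b) y w + v y w)
  <= c0 * (\sum_(j < k) a `^ gamma j * `|x 0 j - y 0 j| + fine b^-1%E).
Hypothesis W_head : forall x y : 'rV[R]_k, T x -> T y ->
  L2norm P (fun w => W (Ico 0 a0%:E) x w - W (Ico 0 a0%:E) y w)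
  <= c0 * \sum_(j < k) `|x 0 j - y 0 j|.

(** The tail hypothesis with [b = +oo], where the noise of [[a, +oo)] minus [v] is the opposite of
    the noise of [[0, a)]. *)
Lemma noise_head_lip (a : R) x y : a0 <= a -> T x -> T y ->
  L2norm P (fun w => W (Ico 0 a%:E) x w - W (Ico 0 a%:E) y w)
  <= c0 * \sum_(j < k) a `^ gamma j * `|x 0 j - y 0 j|.
Proof.
move=> aa0 Tx Ty; have a_ge0 : 0 <= a by exact: le_trans aa0.
have := W_tail aa0 (ltry a) Tx Ty; rewrite invey addr0; apply: le_trans.
rewrite -L2normN le_eqVlt; apply/orP; left; apply/eqP; apply: ae_eq_L2norm.
- by apply: measurableT_comp => //; exact: measurable_funB.
- by apply: measurable_funD => //; apply: measurable_funB => //; exact: measurable_funB.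
- by apply: filterS2 (noise_total Tx a_ge0) (noise_total Ty a_ge0) => w -> ->; ring.
Qed.

Lemma noise_upper : exists c1 eps1 : R, [/\ 0 < c1, 0 < eps1 & forall x y, T x -> T y ->
  Delta gamma x y <= eps1 -> L2norm P (fun w => v x w - v y w) <= c1 * Delta gamma x y].
Proof.
pose c1 := c0 * (k%:R + \sum_(j < k) a0 `^ gamma j + 1 + k%:R).
have sa0 : 0 <= \sum_(j < k) a0 `^ gamma j by apply: sumr_ge0 => j _; exact: powR_ge0.
have k0 : 0 <= k%:R :> R by exact: ler0n.
(* This threshold gives both [a0 < D^-1] and [D <= 1]. *)
exists c1, (a0 + 1)^-1; split.
- by apply: mulr_gt0 => //; lra.
- by rewrite invr_gt0 ltr_wpDl.
move=> x y Tx Ty Dxy; set D := Delta gamma x y in Dxy *.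
have D0 : 0 <= D by exact: Delta_ge0.
have [De|Dn] := eqVneq D 0.
  have -> : x = y.
    apply/rowP => j; have := norm_coord_le gamma_gt0 j (_ : Delta gamma x y <= 0).
    rewrite -/D De => /(_ (lexx 0)); rewrite powR0 ?gt_eqF ?addr_gt0//.
    by rewrite normr_le0 subr_eq0 => /eqP.
  rewrite De mulr0 (@eq_L2norm _ _ _ _ _ (cst 0)); last by move=> w; rewrite subrr.
  rewrite L2normE (_ : (fun w => _) = cst 0) ?Rintegral_cst1 ?sqrtr0//.
  by apply/funext => w; rewrite expr0n.
pose b := D^-1.
have Dp : 0 < D by rewrite lt_neqAle eq_sym Dn.
have b0 : 0 < b by rewrite invr_gt0.
have a0b : a0 + 1 <= b by rewrite -[leLHS]invrK lef_pV2 ?posrE ?invr_gt0 ?ltr_wpDl.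
have a0b' : a0 <= b by lra.
have D1 : D <= 1 by apply: le_trans Dxy _; rewrite invf_le1 ?ltr_wpDl// lerDr.
have coord j : `|x 0 j - y 0 j| <= D * D `^ gamma j.
  have := norm_coord_le gamma_gt0 j (lexx D).
  by rewrite [gamma j + 1]addrC powRD ?powRr1// Dn implybT.
have h1 := noise_head_lip a0b' Tx Ty.
have h2 : L2norm P (fun w => W (Ico a0 b%:E) x w - v x w - W (Ico a0 b%:E) y w + v y w)
    <= c0 * (\sum_(j < k) a0 `^ gamma j * `|x 0 j - y 0 j| + D).
  have := W_tail (lexx a0) (_ : (a0%:E < b%:E)%E) Tx Ty; rewrite inver gt_eqF//= invrK.
  by apply; rewrite lte_fin; lra.
have h3 := W_head Tx Ty.
have s1 : \sum_(j < k) b `^ gamma j * `|x 0 j - y 0 j| <= k%:R * D.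
  rewrite mulr_natl -[X in _ *+ X]card_ord -sumr_const; apply: ler_sum => j _.
  apply: (@le_trans _ _ (b `^ gamma j * (D * D `^ gamma j))).
    by rewrite ler_wpM2l ?powR_ge0.
  by rewrite mulrCA -powRM ?(ltW b0)// mulVf// powR1 mulr1.
have cD j : `|x 0 j - y 0 j| <= D.
  apply: le_trans (coord j) _; rewrite ler_piMr// (_ : 1 = 1 `^ gamma j); last by rewrite powR1.
  by apply: ge0_ler_powR; rewrite ?nnegrE// ltW.
have s2 : \sum_(j < k) a0 `^ gamma j * `|x 0 j - y 0 j| <= (\sum_(j < k) a0 `^ gamma j) * D.
  by rewrite mulr_suml; apply: ler_sum => j _; rewrite ler_wpM2l ?powR_ge0.
have s3 : \sum_(j < k) `|x 0 j - y 0 j| <= k%:R * D.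
  by rewrite mulr_natl -[X in _ *+ X]card_ord -sumr_const; apply: ler_sum => j _.
have bI c (e : \bar R) z : 0 <= c -> T z -> noise_space (W (Ico c e) z).
  by move=> cc Tz; apply: noise_mem => //; exact: borel_Ico.
pose X1 w := W (Ico 0 b%:E) x w - W (Ico 0 b%:E) y w.
pose Y1 w := W (Ico 0 a0%:E) x w - W (Ico 0 a0%:E) y w.
pose Y2 w := W (Ico b +oo%E) x w - W (Ico b +oo%E) y w + Y1 w.
have HX1 : noise_space X1 by apply: (gsB gH); apply: bI.
have HY1 : noise_space Y1 by apply: (gsB gH); apply: bI.
have HY2' : noise_space (fun w => W (Ico b +oo%E) x w - W (Ico b +oo%E) y w).
  by apply: (gsB gH); apply: bI => //; exact: ltW.
have HY2 : noise_space Y2 by exact: (gsD gH).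
have tx := noise_total Tx (ltW b0); have ty := noise_total Ty (ltW b0).
have sx := noise_split Tx (lexx 0) a0_ge0 (_ : (a0%:E <= b%:E)%E).
have sy := noise_split Ty (lexx 0) a0_ge0 (_ : (a0%:E <= b%:E)%E).
rewrite lee_fin in sx sy; have {}sx := sx a0b'; have {}sy := sy a0b'.
have e2 : L2norm P Y2 = L2norm P (fun w => W (Ico a0 b%:E) x w - v x w - W (Ico a0 b%:E) y w + v y w).
  rewrite -L2normN; apply: ae_eq_L2norm.
  - by apply: measurableT_comp => //; exact: (gs_measurable gH HY2).
  - by apply: measurable_funD => //; apply: measurable_funB => //; exact: measurable_funB.
  - have tt : {ae P, forall w, v x w = W (Ico 0 b%:E) x w + W (Ico b +oo%E) x w /\
        v y w = W (Ico 0 b%:E) y w + W (Ico b +oo%E) y w}.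
      by apply: filterS2 tx ty => w.
    have ss : {ae P, forall w, W (Ico 0 b%:E) x w = W (Ico 0 a0%:E) x w + W (Ico a0 b%:E) x w /\
        W (Ico 0 b%:E) y w = W (Ico 0 a0%:E) y w + W (Ico a0 b%:E) y w}.
      by apply: filterS2 sx sy => w.
    by apply: filterS2 tt ss => w [-> ->] [-> ->]; rewrite /Y2 /Y1; ring.
have e1 : L2norm P (fun w => v x w - v y w) = L2norm P (fun w => X1 w + (Y2 w - Y1 w)).
  apply: ae_eq_L2norm.
  - exact: measurable_funB.
  - exact: (gs_measurable gH (gsD gH HX1 (gsB gH HY2 HY1))).
  - by apply: filterS2 tx ty => w -> ->; rewrite /Y2 /X1; ring.
rewrite e1.
have t1 := L2norm_triangle (gs_sqint gH HX1) (gs_sqint gH (gsB gH HY2 HY1)).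
have t2 := L2norm_triangleB (gs_sqint gH HY2) (gs_sqint gH HY1).
apply: (le_trans t1).
have -> : c1 * D = c0 * (k%:R * D) + (c0 * ((\sum_(j < k) a0 `^ gamma j) * D + D) + c0 * (k%:R * D)).
  by rewrite /c1; ring.
apply: lerD; first by apply: le_trans h1 _; rewrite ler_pM2l.
apply: (le_trans t2); apply: lerD.
  by rewrite e2; apply: le_trans h2 _; rewrite ler_pM2l// lerD2r.
by apply: le_trans h3 _; rewrite ler_pM2l.
Qed.

(** [|x j - y j|] is at most [D]^ (gamma j + 1)[, which is negligible before]D[;]q
    j[is the size of]D [^ gamma j] at which coordinate [j] uses only its share [c / (k + 1)]. *)
Lemma noise_head_small (a c : R) : a0 <= a -> 0 < c ->
  exists2 eps : R, 0 < eps & forall x y, T x -> T y -> Delta gamma x y <= eps ->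
    L2norm P (fun w => W (Ico 0 a%:E) x w - W (Ico 0 a%:E) y w) <= c * Delta gamma x y.
Proof.
move=> aa0 cp; have a_ge0 : 0 <= a by exact: le_trans aa0.
pose q j := c / (k%:R + 1) / (c0 * (a `^ gamma j + 1)).
have k1 : 0 < k%:R + 1 :> R by rewrite ltr_wpDl.
have q0 j : 0 < q j.
  by rewrite divr_gt0 ?divr_gt0// mulr_gt0// ltr_wpDl// powR_ge0.
exists (\big[Num.min/1]_j q j `^ (gamma j)^-1).
  by apply/lt_bigmin => // j _; rewrite powR_gt0.
move=> x y Tx Ty Dxy; set D := Delta gamma x y in Dxy *.
have D0 : 0 <= D by exact: Delta_ge0.
apply: (le_trans (noise_head_lip aa0 Tx Ty)).
apply: (@le_trans _ _ (\sum_(j < k) (c / (k%:R + 1) * D))); last first.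
  rewrite sumr_const card_ord -[leLHS]mulr_natl mulrA ler_wpM2r// mulrCA ler_piMr ?(ltW cp)//.
  by rewrite ler_pdivrMr// mul1r lerDl.
rewrite mulr_sumr; apply: ler_sum => j _.
have g0 := gamma_gt0 j.
have coord : `|x 0 j - y 0 j| <= D * D `^ gamma j.
  have := norm_coord_le gamma_gt0 j (lexx D).
  by rewrite [gamma j + 1]addrC powRD ?powRr1// gt_eqF// addr_gt0.
have Dq : D `^ gamma j <= q j.
  have -> : q j = (q j `^ (gamma j)^-1) `^ gamma j.
    by rewrite -powRrM mulVf ?gt_eqF// powRr1 ?(ltW (q0 j)).
  apply: ge0_ler_powR; rewrite ?nnegrE ?powR_ge0 ?(ltW g0)//.
  by apply: (le_trans Dxy); apply: bigmin_le.
have ag : 0 <= a `^ gamma j by exact: powR_ge0.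
apply: (@le_trans _ _ (c0 * (a `^ gamma j + 1) * (D * q j))).
  rewrite -mulrA ler_pM2l//; apply: ler_pM => //; first by rewrite lerDl.
  by apply: (le_trans coord); rewrite ler_wpM2l.
have den : c0 * (a `^ gamma j + 1) != 0 by rewrite lt0r_neq0// mulr_gt0// ltr_wpDl.
rewrite (_ : c0 * (a `^ gamma j + 1) * (D * q j) = q j * (c0 * (a `^ gamma j + 1)) * D); last by ring.
by rewrite /q divfK.
Qed.

End noise.

(** * Zero-one law *)

Section independence_integral.
Context {d : measure_display} {Omega : measurableType d} {R : realType}.
Variable P : probability Omega R.

Lemma ge0_integral_mrestr (G : set Omega) (mG : measurable G) (f : Omega -> \bar R) :
  measurable_fun setT f -> (forall w, 0 <= f w)%E ->
  (\int[mrestr P mG]_w f w = \int[P]_(w in G) f w)%E.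
Proof.
move=> mf f0; rewrite -(setUv G) ge0_integral_setU//; last 3 first.
- exact: measurableC.
- by rewrite setUv.
- by rewrite disj_set2E setICr.
rewrite [X in (_ + X)%E](_ : _ = 0%E) ?adde0; last first.
  apply: null_set_integral; first exact: measurableC.
  - exact: measurable_funS mf.
  - by change (P (~` G `&` G) = 0%E); rewrite setICl measure0.
by apply: eq_measure_integral => A mA AG; change (P (A `&` G) = P A); rewrite setIidl.
Qed.

(** Under [P] restricted to [G], the law of [U] is [P G] times its original law. Adding [M] makes
    the integrand nonnegative, so that integrals of measures can be compared directly. *)
Lemma independent_integral_comp (G : set Omega) (U : Omega -> R) (f : R -> R) (M : R) :
  measurable G -> measurable_fun setT U -> measurable_fun setT f -> (forall x, `|f x| <= M) ->
  (forall B : set R, measurable B -> P (G `&` U @^-1` B) = (P G * P (U @^-1` B))%E) ->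
  \int[P]_w ((\1_G w - fine (P G)) * f (U w)) = 0.
Proof.
move=> mG mU mf fM indep; pose p := fine (P G).
have p0 : 0 <= p by exact: fine_ge0.
pose h x : \bar R := (f x + M)%:E.
have h0 x : (0 <= h x)%E by rewrite lee_fin -lerBlDr sub0r; have := fM x; rewrite ler_norml => /andP[].
have mh : measurable_fun setT h by apply/measurable_EFinP; exact: measurable_funD.
have mU' : measurable_fun setT (U : Omega -> measurableTypeR R) := mU.
have mfU : measurable_fun setT (f \o U) by exact: measurableT_comp.
have mhU : measurable_fun setT (h \o U) by exact: measurableT_comp.
have e1 : (\int[P]_(w in G) (h (U w)) = p%:E * \int[P]_w h (U w))%E.
  transitivity (\int[pushforward (mrestr P mG) (U : Omega -> measurableTypeR R)]_x h x)%E.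
    by rewrite (@ge0_integral_pushforward _ _ _ _ _ _ mU')// preimage_setT ge0_integral_mrestr// => w; exact: h0.
  transitivity (\int[pushforward (mscale (NngNum p0) P) (U : Omega -> measurableTypeR R)]_x h x)%E.
    apply: eq_measure_integral => A mA _; change (P ((U @^-1` A) `&` G) = (p%:E * P (U @^-1` A))%E).
    rewrite setIC indep//.
    by rewrite /p fineK// fin_num_measure.
  by rewrite (@ge0_integral_pushforward _ _ _ _ _ _ mU')// preimage_setT ge0_integral_mscale// => w _; exact: h0.
have ifU : P.-integrable setT (EFin \o (f \o U)) by apply: (@bounded_integrable _ _ _ _ _ M) => // w; exact: fM.
have iM : P.-integrable setT (EFin \o (cst M : Omega -> R)).
  by apply: (@bounded_integrable _ _ _ _ _ `|M|) => // w; exact: lexx.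
have ih : P.-integrable setT (h \o U).
  by have := integrableD measurableT ifU iM; apply: eq_integrable.
have ihG : P.-integrable setT (EFin \o (fun w => \1_G w * (f (U w) + M))).
  apply: (@bounded_integrable _ _ _ _ _ (M + M)).
    by apply: measurable_funM => //; exact: measurable_funD.
  move=> w; rewrite indicE; case: (_ \in _); rewrite ?mul1r ?mul0r ?normr0.
    apply: le_trans (ler_normD _ _) _; rewrite lerD ?fM// ger0_norm//.
    exact: le_trans (fM 0).
  by have := le_trans (normr_ge0 _) (fM 0) => M0; rewrite addr_ge0.
have e2 : \int[P]_w (\1_G w * (f (U w) + M)) = p * \int[P]_w (f (U w) + M).
  transitivity (fine (p%:E * \int[P]_w h (U w))%E); last first.
    by rewrite fineM//; exact: integrable_fin_num.
  rewrite -e1 /Rintegral; congr fine; rewrite [RHS]integral_mkcond; apply: eq_integral => w _.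
  by rewrite patchE indicE; case: ifP => _; rewrite ?mul1r ?mul0r.
have iG : P.-integrable setT (EFin \o (\1_G : Omega -> R)) by exact: integrable_indic.
have iMG := integrableZl measurableT M iG.
have ipf := integrableZl measurableT p ih.
have ipf' : P.-integrable setT (EFin \o (fun w => p * (f (U w) + M))) by apply: eq_integrable ipf.
have i3 : P.-integrable setT (EFin \o (fun w => M * \1_G w)) by apply: eq_integrable iMG.
have ic : P.-integrable setT (EFin \o (fun=> M * p : R)).
  by apply: (@bounded_integrable _ _ _ _ _ `|M * p|) => // w; exact: lexx.
have i12 := integrableB measurableT ihG ipf'.
have i34 := integrableB measurableT i3 ic.
transitivity (\int[P]_w (\1_G w * (f (U w) + M)) - \int[P]_w (p * (f (U w) + M)) -
   (\int[P]_w (M * \1_G w) - \int[P]_w (M * p))).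
  rewrite -RintegralB// -RintegralB// -RintegralB//.
  by apply: eq_Rintegral => w _; rewrite /p; ring.
have r1 : \int[P]_w (p * (f (U w) + M)) = p * \int[P]_w (f (U w) + M) by rewrite RintegralZl.
have r2 : \int[P]_w (M * \1_G w) = M * p by rewrite RintegralZl// Rintegral_indic.
by rewrite e2 r1 r2 Rintegral_cst1 !subrr.
Qed.

Lemma norm_cosB_le (a b : R) : `|cos a - cos b| <= `|a - b|.
Proof.
pose s := (a + b) / 2; pose t := (a - b) / 2.
have -> : a = s + t by rewrite /s /t; field.
have -> : b = s - t by rewrite /s /t; field.
rewrite cosD cosB (_ : _ - _ = - (2 * (sin s * sin t))); last by ring.
rewrite (_ : s + t - (s - t) = 2 * t); last by ring.
rewrite normrN !(normrM 2) ler_wpM2l// normrM.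
apply: le_trans (norm_sin_le t); rewrite ler_piMl//; exact: sin_max.
Qed.

Lemma L1_le_L2 (X : Omega -> R) : sqint P X -> \int[P]_w `|X w| <= L2norm P X.
Proof.
move=> sX; have sA : sqint P (fun w => `|X w|).
  case: sX => mX iX; split; first exact: measurableT_comp.
  by apply: eq_integrable iX => // w _ /=; rewrite real_normK ?num_real.
have s1 : sqint P (cst 1).
  split=> //; apply: (@bounded_integrable _ _ _ _ _ 1); first exact: measurable_funX.
  by move=> w; rewrite expr1n normr1.
have := cauchy_schwarz sA s1.
have -> : inner P (fun w => `|X w|) (cst 1) = \int[P]_w `|X w|.
  by apply: eq_Rintegral => w _; rewrite mulr1.
have -> : inner P (cst 1) (cst 1) = 1.
  by rewrite /inner -[RHS](Rintegral_cst1 P); apply: eq_Rintegral => w _; rewrite mulr1.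
have -> : inner P (fun w => `|X w|) (fun w => `|X w|) = L2norm P X ^+ 2.
  by rewrite L2norm_sqr; apply: eq_Rintegral => w _; rewrite -expr2 real_normK ?num_real.
rewrite mulr1 ler_pXn2r ?nnegrE ?L2norm_ge0//.
by apply: Rintegral_ge0 => w _.
Qed.

(** For each [n] the event agrees almost surely with one independent of [V n], so the centered
    indicator is orthogonal to [cos (V n + c)]. The cosine is 1-Lipschitz and L1 is bounded by L2,
    so this passes to the limit [U]. *)
Lemma independent_limit_cos (E : set Omega) (U : Omega -> R) (G : nat -> set Omega)
    (V : nat -> Omega -> R) (c : R) :
  measurable E -> sqint P U -> (forall n, measurable (G n)) -> (forall n, sqint P (V n)) ->
  (forall n, {ae P, forall w, E w <-> G n w}) ->
  (forall n (B : set R), measurable B -> P (G n `&` V n @^-1` B) = (P (G n) * P (V n @^-1` B))%E) ->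
  L2norm P (fun w => U w - V n w) @[n --> \oo] --> (0 : R) ->
  \int[P]_w ((\1_E w - fine (P E)) * cos (U w + c)) = 0.
Proof.
move=> mE sU mG sV EG indep UV.
have mcos (X : Omega -> R) : measurable_fun setT X -> measurable_fun setT (fun w => cos (X w + c)).
  move=> mX; apply: (@measurableT_comp _ _ _ _ _ _ (@cos R)); last exact: measurable_funD.
  by apply: continuous_measurable_fun; exact: continuous_cos.
pose g w : R := \1_E w - fine (P E).
have mg : measurable_fun setT g by apply: measurable_funB.
have p01 : 0 <= fine (P E) <= 1.
  by rewrite fine_ge0//= -lee_fin fineK ?fin_num_measure// probability_le1.
have g1 w : `|g w| <= 1.
  rewrite /g indicE; case/andP: p01 => p0 p1; rewrite ler_norml.
  case: (_ \in _); apply/andP; split; rewrite /=; lra.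
have indE n : {ae P, forall w, \1_E w = \1_(G n) w :> R}.
  apply: filterS (EG n) => w [h1 h2]; rewrite !indicE; congr ((nat_of_bool _)%:R).
  by apply/idP/idP => /set_mem h; apply/mem_set; [exact: h1|exact: h2].
have PEG n : P E = P (G n).
  have : \int[P]_w \1_E w = \int[P]_w \1_(G n) w by apply: ae_eq_Rintegral.
  rewrite !Rintegral_indic// => h.
  by rewrite -[LHS]fineK ?fin_num_measure// h fineK// fin_num_measure.
have zero n : \int[P]_w (g w * cos (V n w + c)) = 0.
  have [mV _] := sV n.
  transitivity (\int[P]_w ((\1_(G n) w - fine (P (G n))) * cos (V n w + c))).
    apply: ae_eq_Rintegral.
    - by apply: measurable_funM => //; exact: mcos.
    - by apply: measurable_funM; [exact: measurable_funB|exact: mcos].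
    - by apply: filterS (indE n) => w h; rewrite /g h (PEG n).
  apply: (@independent_integral_comp (G n) (V n) (fun x => cos (x + c)) 1) => //.
  - apply: (@measurableT_comp _ _ _ _ _ _ (@cos R)); last exact: measurable_funD.
    by apply: continuous_measurable_fun; exact: continuous_cos.
  - by move=> x; exact: cos_max.
  - exact: indep.
have icos (X : Omega -> R) : measurable_fun setT X ->
    P.-integrable setT (EFin \o (fun w => g w * cos (X w + c))).
  move=> mX; apply: (@bounded_integrable _ _ _ _ _ 1).
    by apply: measurable_funM => //; exact: mcos.
  by move=> w; rewrite normrM mulr_ile1//; exact: cos_max.
have bound n : `|\int[P]_w (g w * cos (U w + c))| <= L2norm P (fun w => U w - V n w).
  have [mU _] := sU; have [mV _] := sV n.
  have sUV := sqintB sU (sV n); have [mUV _] := sUV.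
  have iB := integrableB measurableT (icos _ mU) (icos _ mV).
  rewrite -[X in `|X|]subr0 -(zero n) -RintegralB//; [|exact: icos|exact: icos].
  apply: le_trans (le_normr_Rintegral _ _) _ => //.
  apply: le_trans (L1_le_L2 sUV).
  apply: le_Rintegral => //.
  - by have := integrable_norm iB; apply: eq_integrable.
  - by have := integrable_norm (sqint_integrable sUV); apply: eq_integrable.
  move=> w _; rewrite -mulrBr normrM.
  apply: (@le_trans _ _ (1 * `|cos (U w + c) - cos (V n w + c)|)); first by rewrite ler_wpM2r.
  rewrite mul1r (le_trans (norm_cosB_le _ _))// (_ : _ - (V n w + c) = U w - V n w)//; ring.
apply/eqP; rewrite -normr_le0.
by apply: (ler_cvg_to (cvg_cst _) UV); exact: (nearW _ bound).
Qed.

Lemma cylinder_independent (S : set (Omega -> R)) (E F : set Omega) :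
  (forall X, S X -> measurable_fun setT X) -> measurable E ->
  (forall C, cylinder S C -> P (E `&` C) = (P E * P C)%E) ->
  <<s cylinder S >> F -> P (E `&` F) = (P E * P F)%E.
Proof.
move=> mS mE EC SF; pose p := fine (P E).
have p0 : 0 <= p by exact: fine_ge0.
have pE : p%:E = P E by rewrite fineK// fin_num_measure.
have := @g_sigma_algebra_measure_unique _ R Omega (cylinder S) _ (fun=> setT) _ _
  (mrestr P mE) (mscale (NngNum p0) P) _ _ _ F SF.
move=> h; rewrite setIC -pE; apply: h.
- by move=> C cC; exact: (measurable_cylinder mS cC).
- by move=> _; exact: cylinderT.
- by rewrite bigcup_const//; exists 0%N.
- by move=> A B; exact: cylinder_setI.
- by move=> C cC; change (P (C `&` E) = (p%:E * P C)%E); rewrite setIC EC// pE.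
- move=> _; change (P (setT `&` E) < +oo)%E; rewrite setTI; apply: le_lt_trans (probability_le1 P mE) _; exact: ltry.
Qed.

(* The cosines determine the law of [S], so the hypothesis makes [E] independent
   of every event generated by [S], in particular of itself. *)
Lemma zero_one_law (S : set (Omega -> R)) (E : set Omega) :
  (forall X, S X -> measurable_fun setT X) ->
  (forall (a : R) X Y, S X -> S Y -> S (fun w => a * X w + Y w)) -> S (cst 0) ->
  measurable E -> <<s cylinder S >> E ->
  (forall U c, S U -> \int[P]_w ((\1_E w - fine (P E)) * cos (U w + c)) = 0) ->
  P E = 0%E \/ P E = 1%E.
Proof.
move=> mS linS S0 mE SE Ecos.
have cog : cos_orthogonal P S (fun w => \1_E w - fine (P E)).
  split; first exact: measurable_funB.
    exists (1 + `|fine (P E)|) => w; rewrite (le_trans (ler_normB _ _))// lerD// indicE.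
    by case: (_ \in _); rewrite ?normr1 ?normr0.
  exact: Ecos.
have EC C : cylinder S C -> P (E `&` C) = (P E * P C)%E.
  move=> cC; have mC := measurable_cylinder mS cC.
  have [_ _ /(_ _ 0 S0)] := cos_orthogonal_cylinder mS linS cC cog.
  under eq_Rintegral do rewrite addr0 cos0 mulr1 mulrBl -[\1_E _ * _]/((\1_E \* \1_C) _) -indicI.
  have iEC : P.-integrable setT (EFin \o (\1_(E `&` C) : Omega -> R)).
    by apply: integrable_indic => //; exact: measurableI.
  have iC : P.-integrable setT (EFin \o (\1_C : Omega -> R)) by exact: integrable_indic.
  rewrite RintegralB//; last by have := integrableZl measurableT (fine (P E)) iC; apply: eq_integrable.
  rewrite RintegralZl// !Rintegral_indic//; last exact: measurableI.
  move/eqP; rewrite subr_eq0 => /eqP h.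
  rewrite -[LHS]fineK ?h ?EFinM ?fineK ?fin_num_measure//; exact: measurableI.
have := cylinder_independent mS mE EC SE; rewrite setIid.
have : P E \is a fin_num by rewrite fin_num_measure.
case: (P E) => // r _ [] /eqP; rewrite -subr_eq0 -{1}[r]mulr1 -mulrBr mulf_eq0 subr_eq0.
by case/orP => /eqP; [left|right]; congr EFin.
Qed.

End independence_integral.

Lemma dense_grid_enum {R : realType} {k : nat} (gamma : 'I_k -> R) (l u : 'rV[R]_k) :
  (forall j, 0 < gamma j) -> (forall j, l 0 j < u 0 j) ->
  exists e : nat -> 'rV[R]_k, (forall m, dense_grid gamma l u (e m)) /\
    forall x, dense_grid gamma l u x -> exists m, e m = x.
Proof.
move=> gamma_gt0 lu.
have Tl : rectangle l u l by move=> j; rewrite lexx ltW.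
pose x0 := gridproj gamma l u 0 l.
have gx0 : dense_grid gamma l u x0 by exists 0%N; exact: grid_gridproj.
pose code := {n : nat & {ffun 'I_k -> 'I_(\max_(j < k) 2 ^ depth gamma n j).+1}}.
pose dec (s : code) := griddec l u (tagged s).
(* Codes that do not decode to a grid point are sent to the default point [x0], so the enumeration
   is total. *)
exists (fun m => if unpickle m is Some s then
  if pselect (dense_grid gamma l u (dec s)) then dec s else x0 else x0); split.
  by move=> m; case: unpickle => // s; case: pselect.
move=> x [n gx]; have [f _ xE] := grid_gridcode lu gx.
exists (pickle (Tagged (fun n => {ffun 'I_k -> 'I_(\max_(j < k) 2 ^ depth gamma n j).+1}) f : code)).
rewrite pickleK; case: pselect => [|h]; rewrite /dec/=; first by rewrite -xE.
by exfalso; apply: h; rewrite /dec/= -xE; exists n.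
Qed.

(** * Measurability and stability of the modulus events *)

Section enumerated_modulus.
Context {R : realType} {k : nat} (S : set 'rV[R]_k) (D : 'rV[R]_k -> 'rV[R]_k -> R).
Context (e : nat -> 'rV[R]_k).
Hypotheses (Se : forall m, S (e m)) (eS : forall x, S x -> exists m, e m = x).
Implicit Types f : 'rV[R]_k -> R.

Lemma measurable_modulus_le {d} {Omega : measurableType d} (f : 'rV[R]_k -> Omega -> R) (q : R) :
  (forall x, S x -> measurable_fun setT (f x)) ->
  measurable [set w | modulus_le S D q (f^~ w)].
Proof.
move=> mf.
pose F n i j : set Omega := if 0 < D (e i) (e j) <= n.+1%:R^-1 then
  [set w | `|f (e i) w - f (e j) w| <= q * (D (e i) (e j) * Num.sqrt (ln (D (e i) (e j))^-1))]
  else setT.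
have mF n i j : measurable (F n i j).
  rewrite /F; case: ifP => // _; rewrite -[X in measurable X]setTI.
  apply: measurable_fun_ler => //; apply: measurableT_comp => //.
  by apply: measurable_funB; exact: mf.
rewrite (_ : [set w | _] = \bigcup_n \bigcap_i \bigcap_j F n i j).
  apply: bigcupT_measurable => n; apply: bigcapT_measurable => i.
  by apply: bigcapT_measurable => j; exact: mF.
apply/seteqP; split => w.
  by move=> [n hn]; exists n => // i _ j _; rewrite /F; case: ifP => // Dij; exact: hn.
move=> [n _ hn]; exists n => x y /eS[i <-] /eS[j <-] Dij.
by have := hn i I j I; rewrite /F Dij.
Qed.

(* Insensitive to perturbations that are negligible at every scale, which
   [modulus_le] is not. *)
Definition tail_modulus_le (q : R) f : Prop :=
  forall j : nat, modulus_le S D (q + j.+1%:R^-1) f.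

Lemma modulus_le_tail q f : modulus_le S D q f -> tail_modulus_le q f.
Proof. by move=> h j; apply: modulus_le_mono h; rewrite lerDl invr_ge0 ler0n. Qed.

Lemma tail_modulus_leD q f g : tail_modulus_le q f -> tail_modulus_le 0 g ->
  tail_modulus_le q (fun x => f x + g x).
Proof.
(* Two slacks at index [j.*2.+1], each [(2 * (j + 1))^-1], add up to the allowed one. *)
move=> hf hg j; have := modulus_leD (hf (j.*2.+1)) (hg (j.*2.+1)).
apply: modulus_le_mono; rewrite add0r -addrA lerD2l.
have -> : j.*2.+2%:R = 2 * j.+1%:R :> R by rewrite -natrM mul2n doubleS.
have : j.+1%:R != 0 :> R by rewrite pnatr_eq0.
by move=> h; rewrite le_eqVlt; apply/orP; left; apply/eqP; field.
Qed.

Lemma measurable_tail_modulus_le {d} {Omega : measurableType d}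
    (f : 'rV[R]_k -> Omega -> R) (q : R) :
  (forall x, S x -> measurable_fun setT (f x)) ->
  measurable [set w | tail_modulus_le q (f^~ w)].
Proof.
move=> mf; rewrite (_ : [set w | _] = \bigcap_j [set w | modulus_le S D (q + j.+1%:R^-1) (f^~ w)]).
  by apply: bigcapT_measurable => j; exact: measurable_modulus_le.
by apply/seteqP; split => w h j; [move=> _|]; exact: h.
Qed.

(** Re-equipping [Omega] with a generated sigma-algebra lets the measurability of the modulus events
    be reused to place them in the sigma-algebra of a single noise. *)
Lemma sigma_gen_measurable {d} {Omega : measurableType d} (T : set 'rV[R]_k)
    (f : 'rV[R]_k -> Omega -> R) x : T x ->
  @measurable_fun _ _ (g_sigma_algebraType
    (\bigcup_(i in T) preimage_set_system setT (f i) measurable)) R setT (f x).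
Proof.
move=> Tx _ B mB; apply: sub_sigma_algebra; exists x => //.
by exists B.
Qed.

End enumerated_modulus.

Lemma cvg_sum0 {R : realType} n (f : 'I_n -> nat -> R) :
  (forall i, f i m @[m --> \oo] --> (0 : R)) -> \sum_(i < n) f i m @[m --> \oo] --> (0 : R).
Proof.
elim: n f => [|n IH] f f0.
  by under eq_cvg do rewrite big_ord0; exact: cvg_cst.
under eq_cvg do rewrite big_ord_recl.
have h := cvgD (f0 ord0) (IH (fun i => f (lift ord0 i)) (fun i => f0 _)).
by rewrite addr0 in h; exact: h.
Qed.

Section L2norm_sum.
Context {d : measure_display} {Omega : measurableType d} {R : realType}.
Variable P : probability Omega R.

Lemma L2norm_sum_le n (a : 'I_n -> R) (Y : 'I_n -> Omega -> R) : (forall i, sqint P (Y i)) ->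
  L2norm P (fun w => \sum_(i < n) a i * Y i w) <= \sum_(i < n) `|a i| * L2norm P (Y i).
Proof.
elim: n a Y => [|n IH] a Y sY.
  rewrite big_ord0 (@eq_L2norm _ _ _ _ _ (fun w => 0 * cst 0 w)).
    by rewrite (L2normZ 0 (sqint0 P)) normr0 mul0r.
  by move=> w; rewrite big_ord0 mul0r.
rewrite big_ord_recl (@eq_L2norm _ _ _ _ _ (fun w => a ord0 * Y ord0 w +
  \sum_(i < n) a (lift ord0 i) * Y (lift ord0 i) w)); last by move=> w; rewrite big_ord_recl.
have s0 := sqint_sum (fun i => a (lift ord0 i)) (fun i => sY (lift ord0 i)).
apply: le_trans (L2norm_triangle _ s0) _.
  have := sqint_lin (a ord0) (sY ord0) (sqint0 P).
  by rewrite (_ : (fun w => _) = (fun w => a ord0 * Y ord0 w))//; apply/funext => w; rewrite addr0.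
by apply: lerD; [rewrite L2normZ|exact: IH].
Qed.

End L2norm_sum.

Section noise_zero_one.
Context {d : measure_display} {Omega : measurableType d} {R : realType}.
Context (P : probability Omega R) {k : nat} (T S : set 'rV[R]_k) (D : 'rV[R]_k -> 'rV[R]_k -> R).
Context (W : set R -> 'rV[R]_k -> {RV P >-> R}) (v : 'rV[R]_k -> {RV P >-> R}) (a0 : R).
Let J : set (set R * 'rV[R]_k) := [set p | borel_Rplus p.1 /\ T p.2].
Hypothesis gW : centered_gaussian_field J (fun p : set R * 'rV[R]_k => W p.1 p.2).
Hypothesis W_sigma_additive : forall x (A : nat -> set R), T x ->
  (forall i, borel_Rplus (A i)) -> trivIset setT A ->
  L2norm P (fun w => W (\bigcup_i A i) x w - \sum_(i < n) W (A i) x w)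
    @[n --> \oo] --> (0 : R).
Hypothesis v_total : forall x, T x -> {ae P, forall w, W [set t | 0 <= t] x w = v x w}.
Hypothesis W_indep : forall A B, borel_Rplus A -> borel_Rplus B -> A `&` B = set0 ->
  independent_sets P (sigma_gen T (W A)) (sigma_gen T (W B)).
Hypothesis gv : centered_gaussian_field setT v.
Hypothesis ST : S `<=` T.
Context (e : nat -> 'rV[R]_k).
Hypotheses (Se : forall m, S (e m)) (eS : forall x, S x -> exists m, e m = x).
Hypothesis a0_ge0 : 0 <= a0.
Hypothesis W_head0 : forall n : nat, a0 <= n%:R ->
  {ae P, forall w, tail_modulus_le S D 0 (fun x => W (Ico 0 n%:R%:E) x w)}.

Lemma tail_modulus_zero_one (q : R) :
  P [set w | tail_modulus_le S D q (v^~ w)] = 0%E \/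
  P [set w | tail_modulus_le S D q (v^~ w)] = 1%E.
Proof.
set E := [set w | _].
have mE : measurable E by apply: (measurable_tail_modulus_le D Se eS).
have gH := noise_gaussian gW.
have gV : gaussian_space P (gspan T v).
  by apply: gspan_gaussian => n t a _; exact: gv.
have vT x : T x -> gspan T v (v x) by exact: gspan_mem.
apply: (@zero_one_law _ _ _ P (gspan T v)) => //.
- by move=> X; exact: (gs_measurable gV).
- by move=> a X Y; exact: (gs_lin gV).
- exact: (gs0 gV (vT _ (ST (Se 0%N)))).
- have := @measurable_tail_modulus_le R k S D e Se eS _
    (g_sigma_algebraType (cylinder (gspan T v))) (fun x => (v x : Omega -> R)) q.
  apply => x Sx _ B mB; apply: sub_sigma_algebra; rewrite setIC.
  by apply: cylinderI => //; [apply: vT; exact: ST|exact: cylinderT].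
(* A linear combination of values of [v] is approximated by the same combination of the noises of
   [[0, m + N)], which is independent of the event defined from the complementary noise. The shift
   by [N] keeps every cut above [a0]. *)
move=> U c [n [t [a [Tt ->]]]].
have [N aN] : exists N : nat, a0 <= N%:R.
  by exists (Num.truncn a0).+1; rewrite ltW// truncnS_gt.
have aNn (m : nat) : a0 <= (m + N)%:R by rewrite (le_trans aN)// ler_nat leq_addl.
have bh (m : nat) : borel_Rplus (Ico (0 : R) m%:R%:E) by exact: borel_Ico.
have bt (m : nat) : borel_Rplus (Ico (m%:R : R) +oo%E) by exact: borel_Ico.
have sv x : T x -> sqint P (v x) by move=> Tx; exact: (gs_sqint gV (vT _ Tx)).
have sW A x : borel_Rplus A -> T x -> sqint P (W A x).
  by move=> bA Tx; exact: (gs_sqint gH (noise_mem _ bA Tx)).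
apply: (@independent_limit_cos _ _ _ P E _
  (fun m => [set w | tail_modulus_le S D q (fun x => W (Ico (m + N)%:R +oo%E) x w)])
  (fun m w => \sum_(i < n) a i * W (Ico 0 (m + N)%:R%:E) (t i) w)) => //.
- by apply: sqint_sum => i; exact: sv.
- by move=> m; apply: (measurable_tail_modulus_le D Se eS).
- by move=> m; apply: sqint_sum => i; exact: sW.
- move=> m; have h1 := W_head0 (aNn m).
  have h2 : {ae P, forall w, forall i, v (e i) w =
      W (Ico 0 (m + N)%:R%:E) (e i) w + W (Ico (m + N)%:R +oo%E) (e i) w}.
    by apply: ae_foralln => i; apply: (noise_total gW W_sigma_additive v_total) => //; exact: ST.
  apply: filterS2 h1 h2 => w h1 h2.
  have eqS x : S x -> v x w = W (Ico 0 (m + N)%:R%:E) x w + W (Ico (m + N)%:R +oo%E) x w.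
    by move=> /eS[i <-].
  split => h.
    have hN : tail_modulus_le S D 0 (fun x => - W (Ico 0 (m + N)%:R%:E) x w).
      move=> j; have [n1 hn1] := h1 j; exists n1 => x y Sx Sy xy.
      by rewrite -opprD normrN; exact: hn1.
    have := tail_modulus_leD h hN; move=> h3 j; apply: eq_modulus_le (h3 j) => x Sx.
    by rewrite eqS//; ring.
  move=> j; apply: eq_modulus_le (tail_modulus_leD h h1 j) => x Sx.
  by rewrite eqS// addrC.
- move=> m B mB; apply: (W_indep (bt (m + N)%N) (bh (m + N)%N)).
  + by rewrite setIC; exact: Ico_disj.
  + have := @measurable_tail_modulus_le R k S D e Se eS _
      (g_sigma_algebraType (\bigcup_(i in T) preimage_set_system setT (W (Ico (m + N)%:R +oo%E) i : Omega -> R) measurable))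
      (fun x => (W (Ico (m + N)%:R +oo%E) x : Omega -> R)) q.
    by apply => x Sx; apply: sigma_gen_measurable; exact: ST.
  + pose Om := g_sigma_algebraType (\bigcup_(i in T) preimage_set_system setT
      (W (Ico 0 (m + N)%:R%:E) i : Omega -> R) measurable).
    have := @measurable_sum _ Om R setT 'I_n (index_enum _) (fun i w => a i * W (Ico 0 (m + N)%:R%:E) (t i) w).
    move=> hm; rewrite -[X in sigma_gen _ _ X]setTI; apply: hm => // i.
    by apply: measurable_funM => //; exact: (@sigma_gen_measurable R k _ _ T (W (Ico 0 (m + N)%:R%:E))).
- have c0 : \sum_(i < n) `|a i| * L2norm P (fun w => v (t i) w - W (Ico 0 (m + N)%:R%:E) (t i) w)
      @[m --> \oo] --> (0 : R).
    apply: cvg_sum0 => i.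
    have hi := noise_cvg gW W_sigma_additive v_total (Tt i).
    rewrite -(cvg_shiftn N) in hi.
    by have h := cvgM (cvg_cst `|a i|) hi; rewrite mulr0 in h; exact: h.
  apply: (squeeze_cvgr _ (cvg_cst 0) c0).
  near=> m; rewrite L2norm_ge0/=.
  apply: le_trans (L2norm_sum_le a _); last by move=> i; apply: sqintB; [exact: sv|exact: sW].
  rewrite le_eqVlt; apply/orP; left; apply/eqP; apply: eq_L2norm => w.
  by rewrite -sumrB; apply: eq_bigr => i _; rewrite mulrBr.
Unshelve. all: by end_near. Qed.

End noise_zero_one.

(** * Critical constants *)

Section almost_everywhere.
Context {d : measure_display} {Omega : measurableType d} {R : realType}.
Variable P : probability Omega R.

Lemma ae_False : ~ {ae P, forall w, False}.
Proof.
case=> A [mA A0 TA]; have AT : A = setT by apply/seteqP; split => // w _; apply: TA.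
have := @probability_setT _ _ _ P; rewrite -AT A0 => /esym/eqP.
by rewrite onee_eq0.
Qed.

Lemma probability0_ae (E : set Omega) : measurable E -> P E = 0%E -> {ae P, forall w, ~ E w}.
Proof. by move=> mE E0; exists E; split => // w /= /contrapT. Qed.

Lemma probability1_ae (E : set Omega) : measurable E -> P E = 1%E -> {ae P, forall w, E w}.
Proof.
move=> mE E1; exists (~` E); split => //; first exact: measurableC.
by rewrite probability_setC// E1 subee.
Qed.

End almost_everywhere.

Section critical.
Context {d : measure_display} {Omega : measurableType d} {R : realType}.
Context (P : probability Omega R) {k : nat} (S : set 'rV[R]_k).
Context (D : 'rV[R]_k -> 'rV[R]_k -> R) (X : 'rV[R]_k -> Omega -> R).

Definition is_critical (kap : R) : Prop :=
  [/\ 0 <= kap, forall q, kap < q -> {ae P, forall w, modulus_le S D q (X^~ w)} &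
      forall q, 0 <= q -> q < kap -> {ae P, forall w, ~ modulus_le S D q (X^~ w)}].

(** The infimum of the levels whose relaxed event has probability 1. The relaxed bound at a level
    gives the exact one at every larger level, and the exact bound implies the relaxed one at the
    same level, so both have this critical value. *)
Lemma critical_exists (q0 : R) :
  (forall q, measurable [set w | tail_modulus_le S D q (X^~ w)]) ->
  (forall q, P [set w | tail_modulus_le S D q (X^~ w)] = 0%E \/
             P [set w | tail_modulus_le S D q (X^~ w)] = 1%E) ->
  0 <= q0 -> {ae P, forall w, modulus_le S D q0 (X^~ w)} ->
  exists kap, is_critical kap.
Proof.
move=> mE zo q00 aeq0; pose E q := [set w | tail_modulus_le S D q (X^~ w)].
pose A := [set q | 0 <= q /\ P (E q) = 1%E].
have Aq0 : A q0.
  split => //; case: (zo q0) => // E0.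
  exfalso; apply: (@ae_False _ _ _ P).
  have := probability0_ae (mE q0) E0.
  by apply: filterS2 aeq0 => w h; apply; exact: modulus_le_tail.
have lA : has_lbound A by exists 0 => q [].
have A0 : A !=set0 by exists q0.
exists (inf A); split.
- by apply: lb_le_inf => // q [].
- move=> q /(inf_lt A0)[q1 [q10 Eq1] q1q].
  have qq1 : 0 < q - q1 by rewrite subr_gt0.
  have [j hj] := exists_invn_le qq1.
  apply: filterS (probability1_ae (mE q1) Eq1) => w /(_ j).
  by apply: modulus_le_mono; rewrite -lerBrDl.
- move=> q qge0 qinf; case: (zo q) => Eq; last first.
    by have := ge_inf lA (conj qge0 Eq : A q); rewrite leNgt qinf.
  apply: filterS (probability0_ae (mE q) Eq) => w h hq; apply: h.
  exact: modulus_le_tail.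
Qed.

Lemma critical_le (kap q : R) : is_critical kap -> 0 <= q ->
  {ae P, forall w, modulus_le S D q (X^~ w)} -> kap <= q.
Proof.
move=> [k0 _ low] q0 hq; rewrite leNgt; apply/negP => qk.
apply: (@ae_False _ _ _ P); apply: filterS2 hq (low q q0 qk) => w h; exact.
Qed.

End critical.

Section critical_limit.
Context {d : measure_display} {Omega : measurableType d} {R : realType}.
Context (P : probability Omega R) {k : nat} (gamma : 'I_k -> R) (l u : 'rV[R]_k).
Context (D : 'rV[R]_k -> 'rV[R]_k -> R) (X : 'rV[R]_k -> Omega -> R).
Hypothesis gamma_gt0 : forall j, 0 < gamma j.
Hypothesis lu : forall j, l 0 j < u 0 j.
Local Notation T := (rectangle l u).
Local Notation dense_grid := (dense_grid gamma l u).

(** Countably many levels tending to [kap] from each side leave one null set. Those below are taken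
    multiplicatively to remain nonnegative, as [is_critical] requires. *)
Lemma critical_cvg (C kap : R) N :
  (forall x y z, T x -> T y -> T z -> D x z <= D x y + D y z) ->
  (forall x y, T x -> T y -> D x y = D y x) ->
  (forall x n, (N <= n)%N -> T x -> D x (gridproj gamma l u n x) <= C * 2 ^- n) ->
  {ae P, forall w, continuous (X^~ w)} ->
  is_critical P dense_grid D X kap -> 0 < kap ->
  {ae P, forall w, modulus T D (X^~ w) r @[r --> 0^'+] --> kap%:E}.
Proof.
move=> Dtri Dsym DC cX [_ up low] kap0.
have hup : {ae P, forall w, forall j : nat, modulus_le dense_grid D (kap + j.+1%:R^-1) (X^~ w)}.
  by apply: ae_foralln => j; apply: up; rewrite ltrDl invr_gt0.
have hlow : {ae P, forall w, forall j : nat, ~ modulus_le dense_grid D (kap * (1 - j.+1%:R^-1)) (X^~ w)}.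
  apply: ae_foralln => j; have j1 : j.+1%:R^-1 <= 1 :> R by rewrite invf_le1 ?ltr0n// ler1n.
  apply: low; first by rewrite mulr_ge0 ?subr_ge0// ltW.
  by rewrite gtr_pMr// ltrBlDr ltrDl invr_gt0.
apply: filterS3 cX hup hlow => w cw hw1 hw2.
apply: (@modulus_cvg _ _ T dense_grid); first by move=> x; exact: dense_grid_rectangle.
  move=> q kq; have qk : 0 < q - kap by rewrite subr_gt0.
  have [j hj] := exists_invn_le qk.
  apply: (modulus_le_rectangle gamma_gt0 lu Dtri Dsym DC cw).
  by apply: modulus_le_mono (hw1 j); rewrite -lerBrDl.
move=> q qk hq; have qk' : 0 < (kap - q) / kap by rewrite divr_gt0// subr_gt0.
have [j hj] := exists_invn_le qk'.
apply: (hw2 j); apply: modulus_le_mono hq.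
move: hj; rewrite ler_pdivlMr// => hj.
by rewrite mulrBr mulr1 lerBrDl -lerBrDr mulrC.
Qed.

End critical_limit.

(** * Lower bound *)

Section separated_pairs.
Context {R : realType} {k : nat} (gamma : 'I_k -> R) (l u : 'rV[R]_k).
Hypothesis gamma_gt0 : forall j, 0 < gamma j.
Hypothesis lu : forall j, l 0 j < u 0 j.
Local Notation T := (rectangle l u).
Let L j := u 0 j - l 0 j.
Let L_gt0 j : 0 < L j. Proof. by rewrite subr_gt0. Qed.

(* The minimum in assumption B also involves the point [0]. *)
Lemma away_from_zero j : exists b, forall t, b <= t <= b + L j / 4 ->
  (l 0 j <= t <= u 0 j) /\ L j / 4 <= `|t|.
Proof.
have L0 := L_gt0 j; rewrite /L in L0 *.
have [m0|m0] := leP 0 ((l 0 j + u 0 j) / 2).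
  exists ((l 0 j + 3 * u 0 j) / 4) => t /andP[t1 t2]; split; first by apply/andP; split; lra.
  by apply: le_trans (ler_norm t); lra.
exists (l 0 j) => t /andP[t1 t2]; split; first by apply/andP; split; lra.
by rewrite -normrN; apply: le_trans (ler_norm (- t)); lra.
Qed.

Lemma Delta_ge_coord (x y : 'rV[R]_k) j (r : R) : 0 <= r -> r `^ (gamma j + 1) <= `|x 0 j - y 0 j| ->
  r <= Delta gamma x y.
Proof.
move=> r0 h; apply: le_trans (coord_le_Delta gamma x y j).
have a0 := alpha_gt0 gamma_gt0 j; have g0 : 0 < gamma j + 1 by rewrite addr_gt0.
have -> : r = (r `^ (gamma j + 1)) `^ alpha gamma j.
  by rewrite -powRrM mulfV ?gt_eqF// powRr1.
by apply: ge0_ler_powR; rewrite ?nnegrE ?powR_ge0 ?(ltW a0).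
Qed.

(** The conditions are those under which assumption B applies to [y i] given points of both
    families; the points [x i] may be arbitrarily close to one another. *)
Definition separated (r : R) (N : nat) (x y : nat -> 'rV[R]_k) : Prop :=
  [/\ forall i, (i < N)%N -> [/\ T (x i), T (y i) & Delta gamma (x i) (y i) = r],
      forall i, (i < N)%N -> r <= Delta gamma (y i) 0,
      forall i j, (i < N)%N -> (j < N)%N -> r <= Delta gamma (y i) (x j) &
      forall i j, (i < N)%N -> (j < N)%N -> i != j -> r <= Delta gamma (y i) (y j)].

Let int_sep (m n : nat) (e : R) : 0 <= e <= 1 -> m != n -> 1 <= `|2 * (m%:R - n%:R) + e|.
Proof.
move=> /andP[e0 e1]; rewrite neq_ltn => /orP[] mn.
  have : m%:R + 1 <= n%:R :> R by rewrite natr1 ler_nat.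
  by move=> h; rewrite -normrN; apply: le_trans (ler_norm _); lra.
have : n%:R + 1 <= m%:R :> R by rewrite natr1 ler_nat.
by move=> h; apply: le_trans (ler_norm _); lra.
Qed.

(** The [x i] form a lattice of spacing [2 * rho j] in coordinate [j], where [rho j] is the length
    of [Delta]-size [r]. Each [y i] is shifted by one [rho] in the coordinate [j0], hence lies
    midway between lattice points and at distance at least [r] from all of them. *)
Lemma separated_exists : (0 < k)%N -> exists C r0 : R, [/\ 0 < C, 0 < r0 &
  forall r, 0 < r <= r0 -> exists N x y, separated r N x y /\ C * r `^ (- Qdim gamma) <= N%:R].
Proof.
move=> k0; pose j0 := Ordinal k0.
have [b hb] : exists b : 'I_k -> R, forall j t, b j <= t <= b j + L j / 4 ->
    (l 0 j <= t <= u 0 j) /\ L j / 4 <= `|t|.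
  have /choice[b hb] := away_from_zero; by exists b.
exists (\prod_j (L j / 16)), (\big[Num.min/1]_j (L j / 16)); split.
- by apply: prodr_gt0 => j _; rewrite divr_gt0.
- by apply/lt_bigmin => // j _; rewrite divr_gt0.
move=> r /andP[r_gt0 rr0].
have r1 : r <= 1 by apply: le_trans rr0 _; exact: bigmin_le_id.
have rL j : r <= L j / 16 by apply: le_trans rr0 _; exact: bigmin_le.
pose rho j := r `^ (gamma j + 1).
have rho0 j : 0 < rho j by exact: powR_gt0.
have rhor j : rho j <= r.
  by rewrite -[leRHS]powRr1 ?(ltW r_gt0)// /rho ger_powR ?r_gt0// lerDr ltW.
have rhoL j : rho j <= L j / 16 by exact: le_trans (rhor j) (rL j).
(* With this many steps of [2 * rho j] the lattice fits in an interval of length [L j / 4]; since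
   [rho j <= L j / 16], truncation at most halves the count. *)
pose N j := Num.truncn (L j / (8 * rho j)).
have rho8 j : 0 < 8 * rho j by rewrite mulr_gt0.
have N1 j : (N j)%:R * (8 * rho j) <= L j.
  by rewrite -ler_pdivlMr// truncn_le// divr_ge0 ?(ltW (L_gt0 j)) ?(ltW (rho8 j)).
have N2 j : L j / 16 * (rho j)^-1 <= (N j)%:R.
  have h : L j / (8 * rho j) < (N j).+1%:R by exact: truncnS_gt.
  rewrite -[ltRHS]natr1 ltr_pdivrMr// in h.
  by rewrite ler_pdivrMr//; have := rhoL j; have := rho0 j; lra.
have Npos j : (0 < N j)%N.
  rewrite -(ltr_nat R); apply: lt_le_trans (N2 j).
  by rewrite mulr_gt0 ?invr_gt0// divr_gt0.
pose F := {dffun forall j : 'I_k, 'I_(N j)}.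
pose f0 : F := [ffun j => Ordinal (Npos j)].
pose pt (e : R) (f : F) : 'rV[R]_k :=
  \row_j (b j + 2 * (f j)%:R * rho j + (if j == j0 then e * rho j else 0)).
pose s := enum F; pose fi i := nth f0 s i.
have ptb (e : R) f j : 0 <= e <= 1 -> b j <= pt e f 0 j <= b j + L j / 4.
  move=> /andP[e0 e1]; rewrite mxE.
  have fN : (f j)%:R + 1 <= (N j)%:R :> R by rewrite natr1 ler_nat.
  have f0' : 0 <= (f j)%:R :> R by exact: ler0n.
  have r0 := rho0 j; have h1 := N1 j.
  have h2 : ((f j)%:R + 1) * rho j <= (N j)%:R * rho j by rewrite ler_pM2r.
  have h3 : 0 <= (f j)%:R * rho j by rewrite mulr_ge0// ltW.
  have h4 : 0 <= (if j == j0 then e * rho j else 0) <= rho j.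
    case: ifP => _; last by rewrite lexx ltW.
    by rewrite mulr_ge0 ?(ltW r0)//= ler_piMl// ltW.
  by case/andP: h4 => h4 h5; apply/andP; split; lra.
have e01 : 0 <= (0 : R) <= 1 by rewrite lexx ler01.
have e11 : 0 <= (1 : R) <= 1 by rewrite lexx ler01.
have ptT e f : 0 <= e <= 1 -> T (pt e f).
  by move=> e1 j; have [] := hb j _ (ptb e f j e1).
have diff (e e' : R) f g j : pt e f 0 j - pt e' g 0 j =
    (2 * ((f j)%:R - (g j)%:R) + (if j == j0 then e - e' else 0)) * rho j.
  by rewrite !mxE; case: ifP => _; ring.
have sep (e e' : R) f g : 0 <= e - e' <= 1 -> f != g -> r <= Delta gamma (pt e f) (pt e' g).
  move=> ee fg.
  have [j fgj] : exists j, f j != g j.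
    apply: contrapT => h; move/eqP: fg; apply; apply/ffunP => j.
    by apply/eqP; apply: contrapT => /negP h'; apply: h; exists j.
  apply: (@Delta_ge_coord _ _ j) => //; first exact: ltW.
  rewrite diff normrM (gtr0_norm (rho0 j)) -/(rho j) ler_pMl//; apply: int_sep; last by [].
  by case: ifP => // _; rewrite lexx ler01.
have pair f : Delta gamma (pt 0 f) (pt 1 f) = r.
  rewrite /Delta (bigD1 j0)//= big1 ?addr0; last first.
    move=> j jj0; rewrite diff (negbTE jj0) subrr mulr0 addr0 mul0r normr0 powR0//.
    by rewrite gt_eqF// alpha_gt0.
  rewrite diff eqxx subrr mulr0 add0r sub0r mulN1r normrN (gtr0_norm (rho0 j0)).
  by rewrite -powRrM mulfV ?powRr1 ?(ltW r_gt0)// gt_eqF// addr_gt0.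
have sz : size s = #|F| by rewrite -cardE.
exists #|F|, (fun i => pt 0 (fi i)), (fun i => pt 1 (fi i)); split; last first.
  have -> : #|F| = \prod_j N j.
    rewrite card_dep_ffun foldrE big_map big_enum/=.
    by apply: eq_bigr => j _; rewrite card_ord.
  rewrite natr_prod.
  apply: (@le_trans _ _ (\prod_j (L j / 16 * (rho j)^-1))).
    rewrite [leRHS]big_split/= ler_wpM2l//.
      by apply: prodr_ge0 => j _; rewrite divr_ge0// ltW.
    rewrite QdimE -sumrN.
    elim/big_rec2: _ => [|j a c _ h]; first by rewrite powRr0.
    rewrite powRD; last by rewrite (gt_eqF r_gt0) implybT.
    by rewrite powRN; apply: ler_wpM2l => //; rewrite invr_ge0 powR_ge0.
  by apply: ler_prod => j _; rewrite N2 andbT mulr_ge0 ?invr_ge0 ?(ltW (rho0 j))// divr_ge0// ltW.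
split.
- by move=> i iN; split; [exact: ptT|exact: ptT|exact: pair].
- move=> i iN; apply: (@Delta_ge_coord _ _ j0); first exact: ltW.
  rewrite [X in _ - X]mxE subr0; have [_] := hb j0 _ (ptb 1 (fi i) j0 e11).
  by apply: le_trans; apply: le_trans (rhoL j0) _; have := L_gt0 j0; lra.
- move=> i j iN jN; have [ij|ij] := eqVneq (fi i) (fi j).
    by rewrite ij Delta_sym pair.
  by apply: sep => //; rewrite subr0.
- move=> i j iN jN ij; apply: sep; first by rewrite subrr lexx ler01.
  by rewrite nth_uniq ?sz ?enum_uniq.
Qed.

End separated_pairs.

Section lower_bound.
Context {d : measure_display} {Omega : measurableType d} {R : realType}.
Context (P : probability Omega R) {k : nat} (gamma : 'I_k -> R) (l u : 'rV[R]_k).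
Context (v : 'rV[R]_k -> {RV P >-> R}) (c2 : R).
Hypothesis gamma_gt0 : forall j, 0 < gamma j.
Hypothesis lu : forall j, l 0 j < u 0 j.
Hypothesis gv : centered_gaussian_field setT v.
Hypothesis vB : assumptionB v (rectangle l u) gamma c2.
Local Notation T := (rectangle l u).
Local Notation Q := (Qdim gamma).

Let c2_gt0 : 0 < c2. Proof. by case: vB. Qed.

Let gV : gaussian_space P (gspan setT v).
Proof. by apply: gspan_gaussian => n t a _; exact: gv. Qed.

Let Hv x : gspan setT v (v x). Proof. exact: gspan_mem. Qed.

Let sv x : sqint P (v x). Proof. exact: (gs_sqint gV (Hv x)). Qed.

(** The residual of an increment is [v (y i)] minus a combination of [v] at the earlier [y j], the
    earlier [x j] and [x i], with coefficients [a j], [- a j] and 1. All these points, and 0, are at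
    distance at least [r] from [y i]. *)
Lemma separated_residual r N x y i (a : 'I_i -> R) : 0 < r -> separated gamma l u r N x y ->
  (i < N)%N ->
  Num.sqrt c2 * r <= L2norm P (fun w => (v (y i) w - v (x i) w) -
    \sum_(j < i) a j * (v (y j) w - v (x j) w)).
Proof.
move=> r0 [Txy y0 yx yy] iN.
pose xs (s : 'I_(i + (i + 1))) : 'rV[R]_k := match fintype.split s with
  | inl j => y j
  | inr s' => match fintype.split s' with inl j => x j | inr _ => x i end end.
pose b (s : 'I_(i + (i + 1))) : R := match fintype.split s with
  | inl j => a j
  | inr s' => match fintype.split s' with inl j => - a j | inr _ => 1 end end.
have jN (j : 'I_i) : (j < N)%N by exact: ltn_trans iN.
have Txs s : T (xs s).
  rewrite /xs; case: (fintype.split s) => [j|s']; first by have [] := Txy j (jN j).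
  by case: (fintype.split s') => [j|_]; [have [] := Txy j (jN j)|have [] := Txy i iN].
have Dxs s : r <= Delta gamma (y i) (xs s).
  rewrite /xs; case: (fintype.split s) => [j|s'].
    by apply: yy; rewrite // gtn_eqF.
  by case: (fintype.split s') => [j|_]; apply: yx.
have [_ Ty _] := Txy i iN.
have [V hV cV] := vB.2 (i + (i + 1))%N (y i) xs (ltn_addl _ (ltn_addl _ (ltnSn 0))) Ty Txs.
have cV' : {ae P, forall w, c2 * r ^+ 2 <= V w}.
  apply: filterS cV => w; apply: le_trans; rewrite ler_pM2l//.
  elim/big_rec: _ => [|s z _ h]; first by rewrite ler_pXn2r ?nnegrE ?Delta_ge0 ?(ltW r0)// y0.
  by rewrite le_min h andbT ler_pXn2r ?nnegrE ?Delta_ge0 ?(ltW r0).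
have := conditional_variance_le b (sv (y i)) (fun s => sv (xs s)) hV cV'.
have e : (fun w => v (y i) w - \sum_(s < i + (i + 1)) b s * v (xs s) w) =1
  (fun w => (v (y i) w - v (x i) w) - \sum_(j < i) a j * (v (y j) w - v (x j) w)).
  move=> w; rewrite !big_split_ord/= big_ord1.
  under [X in _ - (X + _)]eq_bigr => j _.
    rewrite /b /xs; case: (fintype.split _) (unsplitK (inl j : 'I_i + 'I_(i + 1))%type) => //= _ [->].
    over.
  under [X in _ - (_ + (X + _))]eq_bigr => j _.
    rewrite /b /xs; case: (fintype.split _) (unsplitK (inr (lshift 1 j) : 'I_i + 'I_(i + 1))%type) => //= _ [->].
    case: (fintype.split _) (unsplitK (inl j : 'I_i + 'I_1)%type) => //= _ [->].
    over.
  rewrite /b /xs /=.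
  case: (fintype.split _) (unsplitK (inr (rshift i ord0) : 'I_i + 'I_(i + 1))%type) => //= _ [->].
  case: (fintype.split _) (unsplitK (inr ord0 : 'I_i + 'I_1)%type) => //= _ _.
  rewrite mul1r.
  under [X in _ = _ - _ - X]eq_bigr do rewrite mulrBr.
  rewrite sumrB; under [X in _ - (_ + (X + _))]eq_bigr do rewrite mulNr.
  by rewrite sumrN; ring.
rewrite -L2norm_inner (eq_L2norm _ e) => h.
rewrite -(@ler_pXn2r _ 2) ?nnegrE ?L2norm_ge0 ?mulr_ge0 ?sqrtr_ge0 ?(ltW r0)//.
by rewrite exprMn sqr_sqrtr// ltW.
Qed.

Lemma measurable_small_ball N (x y : nat -> 'rV[R]_k) (theta : R) :
  measurable [set w | forall i, (i < N)%N -> (`|v (y i) w - v (x i) w| <= theta)%R].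
Proof.
rewrite (_ : [set w | _] = \bigcap_i (if (i < N)%N then
  [set w | `|v (y i) w - v (x i) w| <= theta] else setT)).
  apply: bigcapT_measurable => i; case: ifP => // _.
  rewrite -[X in measurable X]setTI; apply: measurable_fun_ler => //.
  by apply: measurableT_comp => //; exact: measurable_funB.
apply/seteqP; split => w h i; first by move=> _; case: ifPn => // iN; exact: h.
by move=> iN; have := h i I; rewrite iN.
Qed.

Lemma separated_small_ball r N x y (theta : R) : 0 < r -> separated gamma l u r N x y -> 0 <= theta ->
  (P [set w | forall i, (i < N)%N -> (`|v (y i) w - v (x i) w| <= theta)%R] <=
  (expR (- (N%:R * (normal_peak 1 * expR (- (theta / (Num.sqrt c2 * r) + 1) ^+ 2 / 2)))))%:E)%E.
Proof.
move=> r0 sep th0.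
have s0 : 0 < Num.sqrt c2 * r by rewrite mulr_gt0// sqrtr_gt0.
have HX i : gspan setT v (fun w => v (y i) w - v (x i) w) by exact: (gsB gV).
have h := gaussian_small_ball gV HX s0 th0 (fun i a iN => separated_residual a r0 sep iN).
rewrite -lee_fin fineK// in h; apply: fin_num_measure; exact: measurable_small_ball.
Qed.

(** With [r = expR (- s ^+ 2)] and [b = q / Num.sqrt c2], the number of pairs contributes
    [Q * s ^+ 2] to the exponent and the Gaussian tail removes [(b * s + 1) ^+ 2 / 2]. As
    [b ^+ 2 < 2 * Q], the difference grows like [e0 * s ^+ 2]. *)
Lemma small_ball_vanish (q C r0 eps : R) : 0 <= q -> q < Num.sqrt (2 * Q * c2) ->
  0 < C -> 0 < r0 -> 0 < eps -> exists2 r : R, 0 < r < r0 & forall N : nat, C * r `^ (- Q) <= N%:R ->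
  expR (- (N%:R * (normal_peak 1 * expR (- (q * (r * Num.sqrt (ln r^-1)) / (Num.sqrt c2 * r) + 1) ^+ 2 / 2))))
    <= eps.
Proof.
move=> q0 qQ C0 r00 eps0.
have sc0 : 0 < Num.sqrt c2 by rewrite sqrtr_gt0.
pose b := q / Num.sqrt c2.
have b0 : 0 <= b by rewrite divr_ge0 ?(ltW sc0).
have Q0 := Qdim_ge0 gamma_gt0.
have bQ : b ^+ 2 < 2 * Q.
  rewrite /b expr_div_n sqr_sqrtr ?(ltW c2_gt0)// ltr_pdivrMr//.
  have Qc : 0 <= 2 * Q * c2 by rewrite mulr_ge0 ?(ltW c2_gt0)// mulr_ge0.
  by rewrite -(sqr_sqrtr Qc) ltr_pXn2r ?nnegrE ?sqrtr_ge0.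
pose e0 := Q - b ^+ 2 / 2; have e00 : 0 < e0 by rewrite /e0; lra.
have p0 : 0 < normal_peak (1 : R) by rewrite normal_peak_gt0// oner_neq0.
set p1 := normal_peak 1 in p0 *.
have Cp : 0 < C * p1 by rewrite mulr_gt0.
(* The summands ensure in turn [1 <= s], an exponent at least [s - 2^-1], a final bound below [eps],
   and [r < r0]. *)
pose s := 1 + (b + 1) / e0 + `|ln eps| / (C * p1) + `|ln r0|.
have t1 : 0 <= (b + 1) / e0 by rewrite divr_ge0 ?(ltW e00)// addr_ge0.
have t2 : 0 <= `|ln eps| / (C * p1) by rewrite divr_ge0 ?(ltW Cp).
have t3 := normr_ge0 (ln r0).
have s1 : 1 <= s by rewrite /s; lra.
have sb : b + 1 <= e0 * s by rewrite mulrC -ler_pdivrMr// /s; lra.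
have se : `|ln eps| <= C * p1 * s by rewrite mulrC -ler_pdivrMr// /s; lra.
have sr : `|ln r0| < s ^+ 2.
  apply: (@lt_le_trans _ _ s); first by rewrite /s; lra.
  by rewrite expr2 ler_peMr//; lra.
exists (expR (- s ^+ 2)).
  rewrite expR_gt0/= -[ltRHS]lnK ?posrE// ltr_expR.
  have := ler_norm (- ln r0); rewrite normrN; lra.
move=> N hN; set r := expR (- s ^+ 2) in hN *.
have r_gt0 : 0 < r by exact: expR_gt0.
have lnr : ln r^-1 = s ^+ 2 by rewrite lnV ?posrE// expRK opprK.
have s_ge0 : 0 <= s by lra.
rewrite lnr sqrtr_sqr_pos// (_ : q * (r * s) / (Num.sqrt c2 * r) = b * s); last first.
  by rewrite /b; field; rewrite !lt0r_neq0.
have rQ : r `^ (- Q) = expR (Q * s ^+ 2).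
  by rewrite /powR gt_eqF// expRK; congr expR; ring.
rewrite -[leRHS]lnK ?posrE// ler_expR lerNl.
apply: (@le_trans _ _ (C * p1 * s)).
  by apply: le_trans se; rewrite -normrN; exact: ler_norm.
apply: (@le_trans _ _ (C * expR (Q * s ^+ 2) * (p1 * expR (- (b * s + 1) ^+ 2 / 2)))); last first.
  by rewrite -rQ ler_wpM2r// mulr_ge0 ?expR_ge0 ?(ltW p0).
rewrite (_ : C * expR (Q * s ^+ 2) * _ = C * p1 * (expR (Q * s ^+ 2) * expR (- (b * s + 1) ^+ 2 / 2))); last by ring.
rewrite ler_pM2l// -expRD.
apply: le_trans (expR_ge1Dx _).
have -> : Q * s ^+ 2 + - (b * s + 1) ^+ 2 / 2 = s * (e0 * s - b) - 2^-1.
  by rewrite /e0; field.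
have : s * 1 <= s * (e0 * s - b) by rewrite ler_wpM2l//; lra.
lra.
Qed.

(** The scales may be chosen one by one, the [m]-th so small that the small ball event has
    probability at most [2 ^- m]; Borel-Cantelli then excludes these events eventually. The pairs
    need not be grid points, so the assumed bound is first extended to the rectangle by
    continuity. *)
Lemma modulus_lower_bound (q : R) : (0 < k)%N ->
  {ae P, forall w, continuous (fun x : 'rV[R]_k => v x w)} ->
  0 <= q -> q < Num.sqrt (2 * Q * c2) ->
  ~ {ae P, forall w, modulus_le (dense_grid gamma l u) (Delta gamma) q (fun x => v x w)}.
Proof.
move=> k0 cv q0 qQ aeq.
have [C [r0 [C0 r00 hsep]]] := separated_exists gamma_gt0 lu k0.
have pick (m : nat) : exists s : R * nat * (nat -> 'rV[R]_k) * (nat -> 'rV[R]_k),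
    [/\ 0 < s.1.1.1 < m.+1%:R^-1, separated gamma l u s.1.1.1 s.1.1.2 s.1.2 s.2 &
     (P [set w | forall i, (i < s.1.1.2)%N -> (`|v (s.2 i) w - v (s.1.2 i) w| <=
        q * (s.1.1.1 * Num.sqrt (ln s.1.1.1^-1)))%R] <= (2 ^- m)%:E)%E].
  have m0 : 0 < Num.min r0 m.+1%:R^-1 by rewrite lt_min r00 invr_gt0 ltr0n.
  have e0 : 0 < 2 ^- m :> R by rewrite invr_gt0 exprn_gt0.
  have [r /andP[r_gt0 rm] hr] := small_ball_vanish q0 qQ C0 m0 e0.
  move: rm; rewrite lt_min => /andP[rr0 rm].
  have [|N [x [y [sep CN]]]] := hsep r; first by rewrite r_gt0 ltW.
  exists (r, N, x, y); split => //=; first by rewrite r_gt0.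
  have th0 : 0 <= q * (r * Num.sqrt (ln r^-1)) by rewrite mulr_ge0// mulr_ge0 ?sqrtr_ge0 ?ltW.
  apply: le_trans (separated_small_ball r_gt0 sep th0) _.
  by rewrite lee_fin; exact: hr.
have [s hs] := choice pick.
pose E m (_ : unit) := [set w | forall i, (i < (s m).1.1.2)%N ->
  (`|v ((s m).2 i) w - v ((s m).1.2 i) w| <= q * ((s m).1.1.1 * Num.sqrt (ln (s m).1.1.1^-1)))%R].
have bc : {ae P, forall w, exists n0, forall n (i : unit), (n0 <= n)%N -> predT i -> ~ E n i w}.
  apply: (@borel_cantelli_geometric _ _ _ P (fun=> unit : finType) (fun=> predT) E
    (fun n => 2 ^- n) 1 2^-1 0%N) => //.
  - by move=> n i _; exact: measurable_small_ball.
  - by move=> n i _ _; have [] := hs n.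
  - by rewrite invr_gt0 ltr0n invf_lt1 ?ltr1n.
  - by move=> n _; rewrite card_unit mul1r mul1r exprVn.
apply: (@ae_False _ _ _ P); apply: filterS3 bc cv aeq => w [n0 hw] cw mw.
have [n hn] : exists n : nat, forall x y, T x -> T y -> 0 < Delta gamma x y < n.+1%:R^-1 ->
    `|v x w - v y w| <= q * (Delta gamma x y * Num.sqrt (ln (Delta gamma x y)^-1)).
  apply: (@modulus_le_rectangle _ _ gamma l u gamma_gt0 lu (Delta gamma) (mesh gamma l u) q 0%N
    (fun x => v x w)) => //.
  - by move=> x y z _ _ _; exact: Delta_triangle.
  - by move=> x y _ _; exact: Delta_sym.
  - by move=> x m _ Tx; exact: Delta_gridproj.
apply: (hw (maxn n0 n) tt (leq_maxl _ _) isT) => i iN.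
have [rm [Txy _ _ _] _] := hs (maxn n0 n).
have [Tx Ty xyE] := Txy i iN; rewrite distrC -xyE; apply: hn => //.
rewrite xyE; case/andP: rm => -> /= /lt_le_trans; apply.
by apply: le_invn; exact: leq_maxr.
Qed.

End lower_bound.

(** * The modulus of continuity *)

Lemma mid_lt {R : realType} (a b : R) : a < b -> exists2 c, a < c & c < b.
Proof. by move=> ab; exists ((a + b) / 2); lra. Qed.

Theorem theorem6p1 (R : realType) (d : measure_display)
    (Omega : measurableType d) (P : probability Omega R)
    (k : nat) (v : 'rV[R]_k -> {RV P >-> R}) (l u : 'rV[R]_k)
    (gamma : 'I_k -> R) (c2 : R) :
  (1 <= k)%N ->
  centered_gaussian_field setT v ->
  {ae P, forall w, continuous (fun x : 'rV[R]_k => v x w)} ->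
  (forall j, l 0 j < u 0 j) ->
  assumptionA v (rectangle l u) gamma ->
  assumptionB v (rectangle l u) gamma c2 ->
  assumptionC v (rectangle l u) gamma ->
  (exists c1 : R, local_upper_bound v (rectangle l u) gamma c1) /\
  exists kappa kappa' : R,
    [/\ 0 < kappa /\ 0 < kappa',
        {ae P, forall w,
          modulus (rectangle l u) (Delta gamma) (fun x => v x w) r
            @[r --> 0^'+] --> kappa%:E},
        {ae P, forall w,
          modulus (rectangle l u) (canonical_dist v) (fun x => v x w) r
            @[r --> 0^'+] --> kappa'%:E} &
        forall c1 : R, local_upper_bound v (rectangle l u) gamma c1 ->
          Num.sqrt (2 * Qdim gamma * c2) <= kappa
            <= Num.sqrt (2 * Qdim gamma) * c1 /\
          Num.sqrt (2 * Qdim gamma * c2) * c1^-1 <= kappa'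
            <= Num.sqrt (2 * Qdim gamma)].
Proof.
move=> k0 gv cv lu [W [gW Wx W_indep [c0 [a0 [c0_gt0 a0_ge0 gamma_gt0 W_tail W_head]]]]] vB [c3 c3_gt0 vC].
set T := rectangle l u in vC Wx W_indep W_tail W_head gW *.
have c2_gt0 : 0 < c2 by case: vB.
have W_add x (A : nat -> set R) : T x -> (forall i, borel_Rplus (A i)) -> trivIset setT A ->
    L2norm P (fun w => W (\bigcup_i A i) x w - \sum_(i < n) W (A i) x w) @[n --> \oo] --> (0 : R).
  by move=> Tx; have [_ h _] := Wx x Tx; exact: h.
have W_tot x : T x -> {ae P, forall w, W [set t | 0 <= t] x w = v x w}.
  by move=> Tx; have [_ _] := Wx x Tx.
have [c1' [eps1 [c1'_gt0 eps1_gt0 vup]]] :=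
  noise_upper gW W_add W_tot c0_gt0 a0_ge0 gamma_gt0 W_tail W_head.
have Q_gt0 := Qdim_gt0 gamma_gt0 k0.
have sQ0 : 0 <= Num.sqrt (2 * Qdim gamma) by exact: sqrtr_ge0.
have sQc : 0 < Num.sqrt (2 * Qdim gamma * c2) by rewrite sqrtr_gt0 mulr_gt0// mulr_gt0.
pose S := dense_grid gamma l u; pose dv := canonical_dist v.
have ST : S `<=` T by move=> x; exact: dense_grid_rectangle.
have [e [Se eS]] := dense_grid_enum gamma_gt0 lu.
have gV : gaussian_space P (gspan setT v) by apply: gspan_gaussian => n t a _; exact: gv.
have Hv x : gspan setT v (v x) by exact: gspan_mem.
have gN := noise_gaussian gW.
have crude0 : 0 <= crude_const gamma l u by exact: crude_const_ge0.
have dtri x y z : T x -> T y -> T z -> dv x z <= dv x y + dv y z.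
  move=> _ _ _; rewrite /dv /canonical_dist.
  rewrite (@eq_L2norm _ _ _ P (fun w => v x w - v z w) (fun w => (v x w - v y w) + (v y w - v z w))).
    by apply: L2norm_triangle; apply: (gs_sqint gV); exact: (gsB gV).
  by move=> w; rewrite addrA subrK.
have dsym x y : T x -> T y -> dv x y = dv y x.
  by move=> _ _; rewrite /dv /canonical_dist -L2normN; apply: eq_L2norm => w; rewrite opprB.
(* At small scales the noise of [[0, n)] has increments of norm at most [eps / (K + 1)] times
   [Delta], and crude chaining multiplies this by [K]. *)
have Wsmall (n : nat) (eps : R) : a0 <= n%:R -> 0 < eps ->
    {ae P, forall w, modulus_le S (Delta gamma) eps (fun x => W (Ico 0 n%:R%:E) x w)}.
  move=> an eps0; set K := crude_const gamma l u in crude0.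
  have c_gt0 : 0 < eps / (K + 1) by rewrite divr_gt0// ltr_wpDl.
  have [del del0 hdel] := noise_head_small gW W_add W_tot c0_gt0 a0_ge0 gamma_gt0 W_tail an c_gt0.
  have h : {ae P, forall w, modulus_le S (Delta gamma) (eps / (K + 1) * K)
      (fun x => W (Ico 0 n%:R%:E) x w)}.
    apply: (ae_modulus_Delta gN gamma_gt0 lu _ (ltW c_gt0) del0 hdel).
    by move=> x Tx; apply: noise_mem => //; exact: borel_Ico.
  apply: filterS h => w; apply: modulus_le_mono.
  rewrite mulrAC ler_pdivrMr ?ltr_wpDl// ler_pM2l// lerDl//.
have headD (n : nat) : a0 <= n%:R ->
    {ae P, forall w, tail_modulus_le S (Delta gamma) 0 (fun x => W (Ico 0 n%:R%:E) x w)}.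
  by move=> an; apply: ae_foralln => j; apply: Wsmall => //; rewrite add0r invr_gt0.
(* Assumption C turns a bound on [dv] into one on [Delta], whence the threshold [c3 * eps1]. *)
have cmp_d x y : S x -> S y -> dv x y <= c3 * eps1 ->
    c1'^-1 * dv x y <= Delta gamma x y <= c3^-1 * dv x y.
  move=> /ST Tx /ST Ty xy; have h := vC x y Tx Ty.
  have De : Delta gamma x y <= eps1 by rewrite -(ler_pM2l c3_gt0) (le_trans h).
  by rewrite ler_pdivrMl// ler_pdivlMl// h andbT vup.
have headd (n : nat) : a0 <= n%:R ->
    {ae P, forall w, tail_modulus_le S dv 0 (fun x => W (Ico 0 n%:R%:E) x w)}.
  move=> an; apply: ae_foralln => j.
  (* Passing from [Delta] to [dv] costs the factor [c3^-1]; the half provides the strict inequality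
     required by [modulus_le_compare]. *)
  have q0 : 0 < c3 * (j.+1%:R^-1 / 2) by rewrite mulr_gt0// divr_gt0// invr_gt0.
  apply: filterS (Wsmall n _ an q0) => w.
  apply: (modulus_le_compare (a := c3^-1) (b := c1'^-1) (eps := c3 * eps1));
    rewrite ?invr_gt0 ?mulr_gt0 ?(ltW q0)//.
  rewrite mulKf ?gt_eqF// add0r ltr_pdivrMr// ltr_pMr ?invr_gt0//.
  by rewrite ltr1n.
have mE D q : measurable [set w | tail_modulus_le S D q (fun x => v x w)].
  by apply: (measurable_tail_modulus_le D Se eS) => x _.
have [kap crit] : exists kap, is_critical P S (Delta gamma) (fun x => v x) kap.
  apply: (@critical_exists _ _ _ P k S (Delta gamma) (fun x => v x) (c1' * crude_const gamma l u)) => //.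
  - exact: (tail_modulus_zero_one gW W_add W_tot W_indep gv ST Se eS headD).
  - by rewrite mulr_ge0// ltW.
  - by apply: (ae_modulus_Delta gV gamma_gt0 lu _ (ltW c1'_gt0) eps1_gt0 vup) => x _.
have normd (q : R) : Num.sqrt (2 * Qdim gamma) < q ->
    {ae P, forall w, modulus_le S dv q (fun x => v x w)}.
  move=> qQ.
  by apply: (ae_modulus_norm gV gamma_gt0 lu _ k0 c1'_gt0 c3_gt0 eps1_gt0 vC vup qQ) => x _.
have [kap' crit'] : exists kap', is_critical P S dv (fun x => v x) kap'.
  apply: (@critical_exists _ _ _ P k S dv (fun x => v x) (Num.sqrt (2 * Qdim gamma) + 1)) => //.
  - exact: (tail_modulus_zero_one gW W_add W_tot W_indep gv ST Se eS headd).
  - by apply: normd; rewrite ltrDl.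
have kap'_le : kap' <= Num.sqrt (2 * Qdim gamma).
  rewrite leNgt; apply/negP => /mid_lt[q q1 q2].
  have := critical_le crit' (le_trans sQ0 (ltW q1)) (normd q q1).
  by rewrite leNgt q2.
have kap_ge : Num.sqrt (2 * Qdim gamma * c2) <= kap.
  rewrite leNgt; apply/negP => /mid_lt[q q1 q2].
  have [kap0 up _] := crit.
  apply: (@modulus_lower_bound _ _ _ P k gamma l u v c2 gamma_gt0 lu gv vB q k0 cv _ q2 (up q q1)).
  exact: le_trans (ltW q1).
(* A pair of points at a small positive [Delta]-distance, taken from a separated family, forces
   [c3 <= c1]. *)
have c1_gt0 c1 : local_upper_bound v T gamma c1 -> 0 < c1.
  move=> [del del0 hdel].
  have [C [r0 [C0 r00 hsep]]] := separated_exists gamma_gt0 lu k0.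
  have r_gt0 : 0 < Num.min r0 del by rewrite lt_min r00.
  have [|N [x [y [[Txy _ _ _] CN]]]] := hsep (Num.min r0 del).
    by rewrite r_gt0 ge_min lexx.
  have N0 : (0 < N)%N.
    by rewrite -(ltr_nat R); apply: lt_le_trans CN; rewrite mulr_gt0// powR_gt0.
  have [Tx Ty xyE] := Txy 0%N N0.
  have h1 := vC _ _ Tx Ty; have := hdel _ _ Tx Ty; rewrite xyE ge_min lexx orbT => /(_ isT) h2.
  apply: lt_le_trans c3_gt0 _; rewrite -(ler_pM2r r_gt0).
  by apply: le_trans h2; rewrite -xyE.
have kap_le c1 : local_upper_bound v T gamma c1 -> kap <= c1 * kap'.
  move=> hc1; have c1p := c1_gt0 c1 hc1; case: hc1 => del del0 hdel.
  rewrite leNgt; apply/negP => h.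
  have [q q1 q2] : exists2 q, kap' < q & q < kap / c1.
    by apply: mid_lt; rewrite ltr_pdivlMr// mulrC.
  have q2' : c1 * q < kap by rewrite mulrC -ltr_pdivlMr.
  have [q' q3 q4] := mid_lt q2'.
  have [kap'0 up' _] := crit'.
  have q0 : 0 <= q by exact: le_trans (ltW q1).
  have ae1 : {ae P, forall w, modulus_le S (Delta gamma) q' (fun x => v x w)}.
    apply: filterS (up' q q1) => w.
    apply: (modulus_le_compare c1p c3_gt0 del0 q0 _ q3) => x y Sx Sy xy.
    by rewrite vC ?hdel//; exact: ST.
  have q'0 : 0 <= q' by apply: le_trans (ltW q3); rewrite mulr_ge0// ltW.
  by have := critical_le crit q'0 ae1; rewrite leNgt q4.
have lub : local_upper_bound v T gamma c1' by exists eps1.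
have kap_gt0 : 0 < kap by exact: lt_le_trans kap_ge.
(* Positivity is inherited from [kap], through [kap <= c1' * kap']. *)
have kap'_gt0 : 0 < kap' by rewrite -(pmulr_rgt0 _ c1'_gt0); exact: lt_le_trans (kap_le _ lub).
split; first by exists c1'.
exists kap, kap'; split.
- by [].
- apply: (critical_cvg gamma_gt0 lu (C := mesh gamma l u) (N := 0) _ _ _ cv crit kap_gt0).
  + by move=> x y z _ _ _; exact: Delta_triangle.
  + by move=> x y _ _; exact: Delta_sym.
  + by move=> x n _ Tx; exact: Delta_gridproj.
- have m0 := mesh_ge0 gamma l u.
  have m1 : 0 < mesh gamma l u + 1 by rewrite ltr_wpDl.
  (* From level [N] on, a point and its projection are within [eps1] for [Delta], so [vup] bounds
     their [dv]-distance. *)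
  have [N hN] := exists_halfX_lt (divr_gt0 eps1_gt0 m1).
  apply: (critical_cvg gamma_gt0 lu (C := c1' * mesh gamma l u) (N := N) dtri dsym _ cv crit' kap'_gt0).
  move=> x n Nn Tx; have h := Delta_gridproj gamma_gt0 lu n Tx.
  rewrite -mulrA (le_trans (vup _ _ Tx (gridproj_rectangle gamma lu n Tx) _))//; last first.
    by rewrite ler_pM2l.
  apply: (le_trans h); rewrite ltr_pdivlMr// in hN; apply: le_trans (ltW hN).
  rewrite mulrC; apply: ler_pM; rewrite ?invr_ge0 ?exprn_ge0// ?lerDl//.
  by rewrite lef_pV2 ?posrE ?exprn_gt0// ler_eXn2l ?ltr1n.
- move=> c1 hc1; have c1p := c1_gt0 c1 hc1; have h := kap_le c1 hc1; split.
    rewrite kap_ge/=; apply: (le_trans h); rewrite mulrC; apply: ler_wpM2r => //; exact: ltW.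
  by rewrite kap'_le andbT ler_pdivrMr// (le_trans kap_ge)// [kap' * _]mulrC.
Qed.
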